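(* Let $a\in\mathbb{R}$, $N\in\mathbb{N}$ with $N\ge1$, and let $\{\lambda_i,\alpha_i\}_{i=1}^N$ be real numbers. Then $\{\lambda_i,\alpha_i\}_{i=1}^N$ is the interior spectral data at $a$ of some pair $(\omega,v)$ if and only if the following three conditions hold: (i) for any $j$ with $\alpha_j=0$, $\lambda_j$ is a zero of the function $$G(z):=\Big(1-\sum_{i=1}^N\alpha_i^2\Big)z-\sum_{i=1}^N\lambda_i\alpha_i^2+\sum_{i=1}^N\frac{\lambda_i^2\alpha_i^2}{\lambda_i-z};$$ (ii) if $\alpha_j=0$ for some $j\neq1,N$, then $\alpha_{j-1}\alpha_{j+1}<0$; (iii) $\{\lambda_i,\alpha_i\}_{i=1}^N\in\mathcal{T}$.
   Context: A pair $(\omega,v)$ means: for some $n\in\mathbb{N}$, $n\ge 1$, and real points $x_1<\dots<x_n$, $\omega=\sum_{i=1}^n\omega_i\delta_{x_i}$ and $v=\sum_{i=1}^n v_i\delta_{x_i}$ with $\omega_i\in\mathbb{R}$, $v_i\ge 0$ and $|\omega_i|+v_i>0$ ($\delta_x$ is the Dirac measure at $x$). The number $n$, the points and the weights may differ from pair to pair. For $z\in\mathbb{C}$ consider $-f''+\frac14 f=z\omega f+z^2vf$ on $\mathbb{R}$, meaning: $f$ is continuous, $-f''+\frac14 f=0$ on $\mathbb{R}\setminus\{x_1,\dots,x_n\}$, and $f'(x_i-)=f'(x_i+)+z\omega_if(x_i)+z^2v_if(x_i)$ for every $i$. An eigenvalue is a $z$ for which there is a nontrivial bounded solution. The eigenvalues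 form a finite set of nonzero real numbers $\lambda_1<\dots<\lambda_N$. For $z\in\mathbb{C}$, $\phi_\pm(z,\cdot)$ are the solutions with $\phi_\pm(z,x)=e^{\mp x/2}$ for all $x$ near $\pm\infty$. For an eigenvalue $\lambda$ put $\gamma_\lambda^2:=\int_{\mathbb{R}}|\phi_+(\lambda,x)|^2d\omega(x)+2\lambda\int_{\mathbb{R}}|\phi_+(\lambda,x)|^2dv(x)$; one has $\lambda\gamma_\lambda^2>0$. The normalized eigenfunctions are $\varphi_i(x)=\phi_+(\lambda_i,x)/\sqrt{\lambda_i\gamma_{\lambda_i}^2}$. For $a\in\mathbb{R}$, the family $\{\lambda_i,\varphi_i(a)\}_{i=1}^N$ is called the interior spectral data of $(\omega,v)$ at $a$. $\mathcal{T}$ is the set of families of real numbers $\{\lambda_i,\alpha_i\}_{i=1}^N$ with $\lambda_1<\lambda_2<\dots<\lambda_N$, $\sum_{i=1}^N\alpha_i^2\le1$, and, for some $j_0\in\{0,\dots,N\}$, $\lambda_{j_0}<0<\lambda_{j_0+1}$, $\alpha_{j_0}>0$, $\alpha_{j_0+1}>0$, where $j_0=0$ means $\lambda_1>0,\alpha_1>0$ and $j_0=N$ means $\lambda_N<0,\alpha_N>0$. *)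

(* Defs.v *)
From HB Require Import structures.
From mathcomp Require Import all_boot all_order all_algebra.
From mathcomp Require Import all_classical all_reals all_analysis.
From mathcomp Require Import complex.
Set Implicit Arguments.
Unset Strict Implicit.
Unset Printing Implicit Defensive.
Import Order.TTheory GRing.Theory Num.Theory.
Import numFieldNormedType.Exports.
Local Open Scope classical_set_scope.
Local Open Scope complex_scope.
Local Open Scope ring_scope.

(* The pair (omega, v) of discrete measures
     omega = \sum_i omega_i * delta_(x_i),  v = \sum_i v_i * delta_(x_i). *)
Record discrete_pair (R : realType) := DiscretePair {
  supp_size : nat;
  mass_point : 'I_supp_size -> R;
  omega_weight : 'I_supp_size -> R;
  v_weight : 'I_supp_size -> R;
  supp_size_gt0 : (0 < supp_size)%N;
  mass_point_increasing : forall i j : 'I_supp_size, (i < j)%N -> mass_point i < mass_point j;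
  v_weight_ge0 : forall i, 0 <= v_weight i;
  weights_gt0 : forall i, 0 < `|omega_weight i| + v_weight i
}.

Arguments mass_point {R} d _.
Arguments omega_weight {R} d _.
Arguments v_weight {R} d _.

(* R[i] carries no normed R-module structure, so limits and derivatives of
   functions R -> R[i] are taken on real and imaginary parts. *)
Section ComplexValued.
Context {R : realType}.
Implicit Types (f : R -> R[i]).

Definition ccontinuous f : Prop :=
  continuous (fun t => complex.Re (f t)) /\
  continuous (fun t => complex.Im (f t)).

Definition is_cderive (x : R) f (l : R[i]) : Prop :=
  is_derive x 1 (fun t => complex.Re (f t)) (complex.Re l) /\
  is_derive x 1 (fun t => complex.Im (f t)) (complex.Im l).

Definition ccvg_to (F : set_system R) f (l : R[i]) : Prop :=
  ((fun t => complex.Re (f t)) @ F --> complex.Re l) /\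
  ((fun t => complex.Im (f t)) @ F --> complex.Im l).

End ComplexValued.

Section SpectralProblem.
Context {R : realType}.
Implicit Types (p : discrete_pair R) (z : R[i]) (f phi : R -> R[i]).

(* -f'' + f / 4 = z omega f + z^2 v f.  The function f' is the derivative of f
   away from the points x_i; its values at the x_i are irrelevant, only its
   one-sided limits (l from the left, r from the right) matter there. *)
Definition is_solution p z f : Prop :=
  ccontinuous f /\
  exists f' : R -> R[i],
    (forall x, (forall i, x <> mass_point p i) ->
       is_cderive x f (f' x) /\
       exists f2 : R[i], is_cderive x f' f2 /\ - f2 + 4^-1 * f x = 0) /\
    (forall i, exists l r : R[i],
       ccvg_to ((mass_point p i)^'-) f' l /\
       ccvg_to ((mass_point p i)^'+) f' r /\
       l = r + z * (omega_weight p i)%:C * f (mass_point p i)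
             + z ^+ 2 * (v_weight p i)%:C * f (mass_point p i)).

Definition is_eigenvalue p z : Prop :=
  exists f, [/\ is_solution p z f,
                exists x, f x <> 0
              & exists M : R, forall x, ComplexField.Normc.normc (f x) <= M].

Definition is_phi_plus p z phi : Prop :=
  is_solution p z phi /\ \forall x \near +oo, phi x = (expR (- x / 2))%:C.

(* Integral of g against the finite signed measure \sum_i w_i * delta_(x_i). *)
Definition discrete_integral (n : nat) (x w : 'I_n -> R) (g : R -> R) : R :=
  \sum_(i < n) w i * \int[\d_(x i)]_t g t.

(* gamma_lam^2, for phi = phi_+(lam, .) *)
Definition gamma_sq p (lam : R) phi : R :=
  let g := fun t => ComplexField.Normc.normc (phi t) ^+ 2 in
  discrete_integral (mass_point p) (omega_weight p) g
  + 2 * lam * discrete_integral (mass_point p) (v_weight p) g.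

Definition is_interior_spectral_data p (a : R) (N : nat)
    (lam alpha : 'I_N -> R) : Prop :=
  [/\ forall i j : 'I_N, (i < j)%N -> lam i < lam j,
      forall z, is_eigenvalue p z <-> exists i, z = (lam i)%:C
    & forall i, exists2 phi, is_phi_plus p (lam i)%:C phi &
        (alpha i)%:C = phi a / (Num.sqrt (lam i * gamma_sq p (lam i) phi))%:C].

(* The class T.  Indices are 0-based: the family entry of index j_0 is the one
   with i.+1 = j0 (none if j0 = 0), that of index j_0 + 1 is the one with
   i = j0 (none if j0 = N). *)
Definition in_T (N : nat) (lam alpha : 'I_N -> R) : Prop :=
  [/\ forall i j : 'I_N, (i < j)%N -> lam i < lam j,
      \sum_(i < N) alpha i ^+ 2 <= 1
    & exists2 j0 : nat, (j0 <= N)%N &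
        forall i : 'I_N, ((i.+1 = j0 -> lam i < 0 /\ 0 < alpha i) /\
                          (i = j0 :> nat -> 0 < lam i /\ 0 < alpha i))].

(* For alpha_j = 0 the j-th summand of the last sum is identically zero; at
   z = lam_j this agrees with the library's convention 0 / 0 = 0. *)
Definition G (N : nat) (lam alpha : 'I_N -> R) (z : R) : R :=
  (1 - \sum_(i < N) alpha i ^+ 2) * z
  - \sum_(i < N) lam i * alpha i ^+ 2
  + \sum_(i < N) lam i ^+ 2 * alpha i ^+ 2 / (lam i - z).

End SpectralProblem.

(* Main.v *)
Require Import Defs.
From mathcomp Require Import all_boot all_order all_algebra.
From mathcomp Require Import all_classical all_reals all_analysis.
From mathcomp Require Import complex polyrcf measurable_realfun ring lra.
Set Implicit Arguments.
Unset Strict Implicit.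
Unset Printing Implicit Defensive.
Import Order.TTheory GRing.Theory Num.Theory.
Import numFieldNormedType.Exports.
Local Open Scope ring_scope.

(** Off the support every solution is [A e^(x/2) + B e^(-x/2)], and crossing a
    point mass changes [(A, B)] by a shear whose entries are polynomials in the
    spectral parameter z ([kick]).  So the solutions phi_+ and phi_-, decaying
    at +oo and at -oo, have polynomial values at every point.  Cut the line at
    a, and let p_+, q_+ be the values of phi_+ and - phi_+' just left of a, and p_-,
    q_- those of phi_- and phi_-'.  The eigenvalues are the zeros of the Wronskian
    [W = p_+ q_- + q_+ p_-], and [P = p_+ p_-] is the numerator of the diagonal
    Green's function P / W at a.

    The Lagrange identity in z ([wronsk_chain]) shows
    [W'(lam) A(lam) = - gamma_lam^2], with A the coefficient of e^(x/2) in
    phi_+ near -oo, while [p_+ = A p_-] at an eigenvalue.  Hence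
    [P(lam_i) = - lam_i W'(lam_i) alpha_i^2]: the data determine W, which is 1
    at 0, and then P by interpolation ([Ppoly]).  The function of condition
    (i) is [G(z) = z P(z) / W(z)] ([G_Ppoly]).

    All sign information comes from one fact: G is a rational function mapping
    the upper half-plane to itself.  [nevanlinna] states this through poles and
    residues; the class is stable under [h -> -1/h] ([nev_recip]), so zeros and
    poles interlace ([nev_interlace]).

    Necessity.  If alpha_j = 0, then p_+ and p_- both vanish at lam_j, so P has
    a double zero where W has a simple one, and G(lam_j) = 0.  By interlacing
    p_+ has no other zero between lam_(j-1) and lam_(j+1), so it changes sign
    there, and it has no zero between 0 and the eigenvalue next to 0 on either
    side, where it therefore keeps the sign it has at 0.  The bound on
    the sum of the alpha_i^2 compares leading coefficients of P and W.

    Sufficiency.  Expand -1/G in partial fractions.  Its linear part is a point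
    mass at a; its poles other than 0 must be shared between the two sides,
    i.e. one has to choose which zeros of P belong to p_+ and which to p_-.  A
    zero between consecutive lam_i with nonzero alpha goes to p_+ exactly when
    the two alpha have opposite signs, which gives p_+(lam_i) the sign of
    alpha_i ([selected_sign]); conditions (i)-(iii) make this consistent with
    the zeros lam_j, alpha_j = 0, which belong to both factors and whose
    residue is shared equally.  Each side then satisfies the hypotheses of the
    inverse problem on a half-line, which is solved by a continued fraction
    expansion, one point mass at a time ([halfline_inverse]). *)

(** * Rational Nevanlinna functions *)

(** Says that D splits over R with simple roots, without mentioning a leading
    coefficient. *)
Definition root_seq (R : rcfType) (D : {poly R}) (s : seq R) : Prop :=
  [/\ uniq s, all (root D) s & size D = (size s).+1].

(** N / D is a rational Nevanlinna function: its poles are real and simple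
    with negative residues N(x) / D'(x), and at infinity it grows at most
    linearly, with a nonnegative slope. *)
Definition nevanlinna (R : rcfType) (N D : {poly R}) : Prop :=
  [/\ exists s, root_seq D s,
      forall x, root D x -> N.[x] * D^`().[x] < 0,
      (size N <= (size D).+1)%N
    & 0 <= N`_(size D) * lead_coef D].

Lemma root_seq_neq0 (R : rcfType) (D : {poly R}) s : root_seq D s -> D != 0.
Proof. by case=> _ _ sz; rewrite -size_poly_gt0 sz. Qed.

Lemma mem_root_seq (R : rcfType) (D : {poly R}) s x :
  root_seq D s -> (x \in s) = root D x.
Proof.
move=> h; have D0 := root_seq_neq0 h; case: h => us rs sz.
apply/idP/idP => [xs|rx]; first exact: (allP rs).
apply: contraT => xs.
have := @max_poly_roots _ D (x :: s) D0.
by rewrite /= rx rs xs us sz ltnn => /(_ isT isT).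
Qed.

Lemma root_seq_prod (R : rcfType) (D : {poly R}) s :
  root_seq D s -> D = lead_coef D *: \prod_(x <- s) ('X - x%:P).
Proof.
by case=> us rs sz; apply: all_roots_prod_XsubC => //; rewrite uniq_rootsE.
Qed.

Lemma nev_neq0 (R : rcfType) (N D : {poly R}) : nevanlinna N D -> D != 0.
Proof. by case=> -[s /root_seq_neq0]. Qed.

Lemma divX_root (R : rcfType) (D : {poly R}) x :
  root D x -> D = (D %/ ('X - x%:P)) * ('X - x%:P).
Proof. by rewrite root_factor_theorem => /divpK ->. Qed.

Lemma horner_deriv_divX (R : rcfType) (D : {poly R}) x :
  root D x -> (D %/ ('X - x%:P)).[x] = D^`().[x].
Proof.
move=> /divX_root {2}->.
by rewrite derivM derivXsubC !hornerE subrr mulr0 add0r.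
Qed.

Lemma interpolation (R : rcfType) (N D : {poly R}) s :
  root_seq D s -> (forall x, x \in s -> D^`().[x] != 0) ->
  (size N <= size s)%N ->
  N = \sum_(x <- s) (N.[x] / D^`().[x]) *: (D %/ ('X - x%:P)).
Proof.
move=> h D'0 sN; have [us rs sz] := h; apply/eqP; rewrite -subr_eq0; apply/eqP.
apply: (@roots_geq_poly_eq0 _ _ s) => //.
  apply/allP => x xs; rewrite rootE hornerD hornerN horner_sum (bigD1_seq x) //=.
  rewrite hornerZ horner_deriv_divX ?(allP rs) // divfK ?D'0 //.
  rewrite big1_seq ?addr0 ?subrr // => y /andP[yx ys].
  have /eqP := rootP (allP rs _ xs); rewrite {1}(divX_root (allP rs _ ys)).
  rewrite hornerM hornerXsubC mulf_eq0 subr_eq0 [x == y]eq_sym (negbTE yx) orbF.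
  by rewrite hornerZ => /eqP ->; rewrite mulr0.
rewrite (leq_trans (size_polyD _ _)) // geq_max sN size_polyN.
rewrite (leq_trans (size_sum _ _ _)) //; apply/bigmax_leqP_seq => x xs _.
rewrite (leq_trans (size_scale_leq _ _)) // size_divp ?polyXsubC_eq0 //.
by rewrite size_XsubC sz subSS subn0.
Qed.

Lemma partial_fractions (R : rcfType) (N D : {poly R}) s :
  root_seq D s -> (forall x, x \in s -> D^`().[x] != 0) ->
  (size N <= (size D).+1)%N ->
  exists b, N = ((N`_(size D) / lead_coef D)%:P * 'X + b%:P) * D
    + \sum_(x <- s) (N.[x] / D^`().[x]) *: (D %/ ('X - x%:P)).
Proof.
move=> h D'0 sN; have [us rs sz] := h; have D0 := root_seq_neq0 h.
have lD : lead_coef D != 0 by rewrite lead_coef_eq0.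
set a := _ / _; pose M := N - a%:P * ('X * D).
have sM : (size M <= size D)%N.
  apply/leq_sizeP => j; rewrite leq_eqVlt => /predU1P[<-|jD]; rewrite !coefE.
    have -> : (size D == 0)%N = false by rewrite sz.
    by rewrite -lead_coefE /a divfK ?subrr.
  rewrite (leq_sizeP _ _ sN) // [D`__](leq_sizeP _ _ (leqnn (size D))).
    by rewrite if_same mulr0 subr0.
  by case: j jD => // j; rewrite ltnS.
pose b := M`_(size D).-1 / lead_coef D; exists b.
pose Q := M - b%:P * D.
have sQ : (size Q <= size s)%N.
  apply/leq_sizeP => j; rewrite leq_eqVlt => /predU1P[<-|jD]; rewrite /Q coefB coefCM.
    have -> : size s = (size D).-1 by rewrite sz.
    by rewrite /b -[D`__]lead_coefE divfK ?subrr.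
  by rewrite (leq_sizeP _ _ sM) ?sz // (leq_sizeP _ _ (leqnn (size D))) ?sz // mulr0 subrr.
have eQ x : x \in s -> Q.[x] = N.[x].
  move=> /(allP rs)/rootP Dx.
  by rewrite /Q /M !hornerE /= Dx !mulr0 !subr0.
rewrite -(eq_big_seq _ (fun x xs => congr1 (fun t => (t / _) *: _) (eQ x xs))).
rewrite -(interpolation h D'0 sQ) /Q /M. ring.
Qed.

(** Over R[i] the polynomial is a product of linear factors; these are real by
    the first hypothesis and distinct by the second. *)
Lemma simple_real_roots (R : rcfType) (N : {poly R}) :
  N != 0 ->
  (forall z : R[i], root (map_poly (real_complex R) N) z -> complex.Im z = 0) ->
  (forall x, root N x -> N^`().[x] != 0) ->
  exists s, root_seq N s.
Proof.
move=> N0 real simple.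
have [rs eN] := closed_field_poly_normal (map_poly (real_complex R) N).
pose s := [seq complex.Re z | z <- rs].
have lN : lead_coef (map_poly (real_complex R) N) = (real_complex R (lead_coef N)).
  by rewrite lead_coef_map.
have ers : rs = [seq real_complex R x | x <- s].
  rewrite -map_comp -[LHS]map_id; apply/eq_in_map => z zs /=.
  have /real : root (map_poly (real_complex R) N) z.
    by rewrite eN rootZ ?lN ?fmorph_eq0 ?lead_coef_eq0 // root_prod_XsubC.
  by case: (z) => a b /= ->.
have {}eN : N = lead_coef N *: \prod_(x <- s) ('X - x%:P).
  apply: (map_poly_inj (real_complex R)); rewrite {1}eN lN map_polyZ /=.
  by rewrite ers big_map map_prod_XsubC.
have us : uniq s.
  have: forall x, x \in s -> (\prod_(x <- s) ('X - x%:P))^`().[x] != 0.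
    move=> x xs; have : root N x by rewrite eN rootZ ?lead_coef_eq0 // root_prod_XsubC.
    move/simple; apply: contraNneq => h0.
    by rewrite eN derivZ hornerZ h0 mulr0.
  elim: (s) => //= x t IH h; apply/andP; split.
    apply/negP => xt; have := h x; rewrite inE eqxx => /(_ isT)/negP; apply.
    rewrite big_cons derivM derivXsubC !hornerE subrr mul0r addr0.
    by have := xt; rewrite -root_prod_XsubC => /rootP ->.
  apply: IH => y yt; have := h y; rewrite inE yt orbT => /(_ isT).
  rewrite big_cons derivM derivXsubC !hornerE.
  have := yt; rewrite -root_prod_XsubC => /rootP ->; rewrite add0r.
  by rewrite mulf_eq0 negb_or => /andP[].
exists s; split=> //.
  by apply/allP => x xs; rewrite eN rootZ ?lead_coef_eq0 // root_prod_XsubC.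
by rewrite eN size_scale ?lead_coef_eq0 // size_prod_XsubC.
Qed.

Lemma Im_invC (R : rcfType) (z : R[i]) :
  complex.Im z^-1 = - (complex.Im z / ((complex.Re z) ^+ 2 + (complex.Im z) ^+ 2)).
Proof. by case: z => a b; rewrite /= /GRing.inv /=; rewrite ?mulNr. Qed.

Lemma nev_deriv_neq0 (R : rcfType) (N D : {poly R}) x :
  nevanlinna N D -> root D x -> D^`().[x] != 0.
Proof.
by case=> _ sgn _ _ /sgn; apply: contraTneq => ->; rewrite mulr0 ltxx.
Qed.

Lemma nev_nonroot (R : rcfType) (N D : {poly R}) x :
  nevanlinna N D -> root N x -> ~~ root D x.
Proof.
by case=> _ sgn _ _ /rootP Nx; apply/negP => /sgn; rewrite Nx mul0r ltxx.
Qed.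

Lemma nev_ratio_lt0 (R : rcfType) (N D : {poly R}) x :
  nevanlinna N D -> root D x -> N.[x] / D^`().[x] < 0.
Proof.
move=> h Dx; have D'0 := nev_deriv_neq0 h Dx; case: h => _ /(_ x Dx) sgn _ _.
have -> : N.[x] / D^`().[x] = (N.[x] * D^`().[x]) / (D^`().[x] ^+ 2) by field.
by rewrite pmulr_llt0 // invr_gt0 exprn_even_gt0.
Qed.

Lemma nev_expansion (R : rcfType) (N D : {poly R}) :
  nevanlinna N D -> exists a b s c, [/\ 0 <= a, root_seq D s,
    forall x, x \in s -> c x < 0 &
    N = (a%:P * 'X + b%:P) * D + \sum_(x <- s) c x *: (D %/ ('X - x%:P))].
Proof.
move=> h; have [[s hs] sgn sN a0] := h.
have [||b eN] := @partial_fractions _ N D s hs => //.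
  by move=> x; rewrite (mem_root_seq _ hs) => /(nev_deriv_neq0 h).
exists (N`_(size D) / lead_coef D), b, s, (fun x => N.[x] / D^`().[x]); split=> //.
  have -> : N`_(size D) / lead_coef D = (N`_(size D) * lead_coef D) / lead_coef D ^+ 2.
    by field; rewrite lead_coef_eq0 (nev_neq0 h).
  by rewrite divr_ge0 // exprn_even_ge0.
by move=> x; rewrite (mem_root_seq _ hs); apply: nev_ratio_lt0.
Qed.

(** At a zero z of N the partial fraction expansion a z + b + sum c_x / (z - x)
    vanishes, and its imaginary part is Im z times a - sum c_x / |z - x|^2,
    which is positive unless N / D is constant. *)
Lemma nev_real_roots (R : rcfType) (N D : {poly R}) (z : R[i]) :
  nevanlinna N D -> N != 0 -> root (map_poly (real_complex R) N) z -> complex.Im z = 0.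
Proof.
move=> h N0 Nz; have [a [b [s [c [a0 hs cneg eN]]]]] := nev_expansion h.
apply/eqP; apply: contraT => y0.
have [us rs sz] := hs.
set D' := map_poly (real_complex R) D.
have zx x : z - real_complex R x != 0.
  apply: contraNneq y0 => /eqP; rewrite subr_eq0 => /eqP ->.
  by [].
have Dz : D'.[z] != 0.
  rewrite /D' (root_seq_prod hs) map_polyZ map_prod_XsubC hornerZ mulf_neq0 //.
    by rewrite fmorph_eq0 lead_coef_eq0 (root_seq_neq0 hs).
  by rewrite horner_prod prodf_seq_neq0; apply/allP => x _ /=; rewrite hornerXsubC zx.
have divz x : x \in s ->
    (map_poly (real_complex R) (D %/ ('X - x%:P))).[z] = D'.[z] / (z - real_complex R x).
  move=> xs; rewrite /D' {2}(divX_root (allP rs _ xs)) rmorphM /= hornerM.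
  by rewrite rmorphB /= map_polyX map_polyC hornerXsubC mulfK ?zx.
have : (real_complex R a) * z + real_complex R b
  + \sum_(x <- s) (real_complex R (c x)) / (z - real_complex R x) = 0.
  apply: (mulIf Dz); rewrite mul0r -[RHS](rootP Nz) {1}eN rmorphD /= rmorphM /= rmorphD /=.
  rewrite rmorphM /= !map_polyC /= map_polyX hornerD hornerM hornerD hornerM.
  rewrite !hornerC hornerX mulrDl; congr (_ + _).
  rewrite mulr_suml raddf_sum horner_sum; apply: eq_big_seq => x xs /=.
  by rewrite map_polyZ hornerZ divz //= mulrA mulrAC.
have Imsum (I : Type) (r : seq I) (F : I -> R[i]) :
  complex.Im (\sum_(i <- r) F i) = \sum_(i <- r) complex.Im (F i).
  by apply: (big_morph (@complex.Im R)) => // -[? ?] [].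
have ImD (u v : R[i]) : complex.Im (u + v) = complex.Im u + complex.Im v.
  by case: u v => ? ? [].
have Imr (k : R) (u : R[i]) : complex.Im (real_complex R k * u) = k * complex.Im u.
  by case: u => u v /=; rewrite mul0r addr0.
pose m x := (complex.Re z - x) ^+ 2 + complex.Im z ^+ 2.
have mpos x : 0 < m x.
  by rewrite ltr_wpDl ?sqr_ge0 // exprn_even_gt0.
have ImV x : complex.Im (z - real_complex R x)^-1 = - (complex.Im z / m x).
  by rewrite Im_invC /m; case: (z) => p q /=; rewrite subr0.
move=> /(congr1 (@complex.Im R)); rewrite !ImD Imsum Imr.
under eq_bigr do rewrite Imr ImV.
rewrite /= addr0 => e0.
have {e0} : a + \sum_(x <- s) - (c x / m x) = 0.
  apply: (mulIf y0); rewrite mul0r -[RHS]e0 mulrDl; congr (_ + _).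
  by rewrite mulr_suml; apply: eq_bigr => x _; ring.
case es : s => [|x t].
  rewrite big_nil addr0 => a00.
  move: Nz; rewrite eN es big_nil a00 mul0r add0r addr0 => /rootP.
  rewrite rmorphM /= map_polyC hornerM hornerC => /eqP; rewrite mulf_eq0 (negbTE Dz) orbF.
  rewrite fmorph_eq0 => /eqP b0.
  by move: N0; rewrite eN es big_nil a00 b0 mul0r !addr0 mul0r eqxx.
rewrite big_cons => /eqP; rewrite gt_eqF //.
have pos y : y \in s -> 0 < - (c y / m y).
  by move=> /cneg cy; rewrite oppr_gt0 pmulr_llt0 // invr_gt0.
rewrite ltr_wpDl // ltr_wpDr //; last by apply: pos; rewrite es mem_head.
by rewrite big_seq sumr_ge0 // => y yt; apply/ltW/pos; rewrite es inE yt orbT.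
Qed.

(** The derivative a - sum c_x / (z - x)^2 of N / D is positive on the
    real line, unless N / D is constant. *)
Lemma nev_deriv_sign (R : rcfType) (N D : {poly R}) x :
  nevanlinna N D -> N != 0 -> root N x -> 0 < D.[x] * N^`().[x].
Proof.
move=> h N0 Nx; have [a [b [s [c [a0 hs cneg eN]]]]] := nev_expansion h.
have [us rs sz] := hs.
have Dx : D.[x] != 0 by have := nev_nonroot h Nx; rewrite rootE.
have xy y : y \in s -> x - y != 0.
  move=> /(allP rs) Dy; apply: contraNneq Dx => /eqP; rewrite subr_eq0 => /eqP ->.
  exact: Dy.
have divx y : y \in s -> (D %/ ('X - y%:P)).[x] = D.[x] / (x - y).
  by move=> ys; rewrite [in RHS](divX_root (allP rs _ ys)) hornerM hornerXsubC mulfK ?xy.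
have ddivx y : y \in s ->
    (D %/ ('X - y%:P))^`().[x] = D^`().[x] / (x - y) - D.[x] / (x - y) ^+ 2.
  move=> ys; have := congr1 (fun p : {poly R} => p^`().[x]) (divX_root (allP rs _ ys)).
  rewrite derivM derivXsubC hornerD !hornerM hornerC mulr1 hornerXsubC divx // => ->.
  by field; rewrite xy.
have e0 : a * x + b + \sum_(y <- s) c y / (x - y) = 0.
  apply: (mulIf Dx); rewrite mul0r -[RHS](rootP Nx) eN !hornerE /= mulrDl; congr (_ + _).
  rewrite mulr_suml horner_sum; apply: eq_big_seq => y ys.
  by rewrite hornerZ divx // mulrA mulrAC.
have -> : N^`().[x] = D.[x] * (a + \sum_(y <- s) - (c y / (x - y) ^+ 2))
   + D^`().[x] * (a * x + b + \sum_(y <- s) c y / (x - y)).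
  rewrite {1}eN !mulrDr !mulr_sumr derivD hornerD derivM derivD derivM !derivC derivX.
  rewrite raddf_sum horner_sum /= !(hornerD, hornerM, hornerC, hornerX).
  rewrite (eq_big_seq (fun y => D.[x] * - (c y / (x - y) ^+ 2) + D^`().[x] * (c y / (x - y)))).
    by rewrite big_split /=; ring.
  by move=> y ys; rewrite derivZ hornerZ ddivx //; field; rewrite xy.
rewrite e0 mulr0 addr0 mulrA -expr2 mulr_gt0 ?exprn_even_gt0 //.
have pos y : y \in s -> 0 < - (c y / (x - y) ^+ 2).
  by move=> ys; rewrite oppr_gt0 pmulr_llt0 ?cneg // invr_gt0 exprn_even_gt0 //= xy.
case es : s => [|y t].
  rewrite big_nil addr0 lt_neqAle a0 andbT; apply: contraNneq Dx => a00.
  move: e0; rewrite es big_nil -a00 mul0r add0r addr0 => b0.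
  by move: N0; rewrite eN es big_nil -a00 b0 mul0r !addr0 mul0r eqxx.
rewrite big_cons ltr_wpDl // ltr_wpDr //; last by apply: pos; rewrite es mem_head.
by rewrite big_seq sumr_ge0 // => u ut; apply/ltW/pos; rewrite es inE ut orbT.
Qed.

(** If N / D vanishes at infinity, it behaves like
    (sum c_x) / z with a negative numerator; this is the growth condition for
    the reciprocal. *)
Lemma nev_top (R : rcfType) (N D : {poly R}) :
  nevanlinna N D -> N != 0 ->
  (size D <= (size N).+1)%N /\ 0 <= - D`_(size N) * lead_coef N.
Proof.
move=> h N0; have [a [b [s [c [a0 hs cneg eN]]]]] := nev_expansion h.
have [us rs sz] := hs; have [_ _ sN a0'] := h.
have D0 := nev_neq0 h.
have [sND|sND] := leqP (size D) (size N).
  split; first exact: leqW.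
  move: sND; rewrite leq_eqVlt => /predU1P[e|lt].
    by rewrite [D`__]nth_default ?oppr0 ?mul0r // e.
  by rewrite [D`__]nth_default ?oppr0 ?mul0r // ltnW.
have cD y : y \in s -> (D %/ ('X - y%:P))`_(size s).-1 = lead_coef D.
  move=> ys; have sq : size (D %/ ('X - y%:P)) = size s.
    by rewrite size_divp ?polyXsubC_eq0 // size_XsubC sz subSS subn0.
  rewrite -sq -lead_coefE {2}(divX_root (allP rs _ ys)) lead_coefM.
  by rewrite lead_coefXsubC mulr1.
have lD : lead_coef D != 0 by rewrite lead_coef_eq0.
have sumsz : (size (\sum_(x <- s) c x *: (D %/ ('X - x%:P)))%R <= size s)%N.
  rewrite (leq_trans (size_sum _ _ _)) //; apply/bigmax_leqP_seq => y ys _.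
  rewrite (leq_trans (size_scale_leq _ _)) // size_divp ?polyXsubC_eq0 //.
  by rewrite size_XsubC sz subSS subn0.
have aE : a = 0.
  have := congr1 (fun p : {poly R} => p`_(size D)) eN.
  rewrite [N`__]nth_default; last exact: ltnW.
  rewrite coefD [X in _ + X]nth_default; last by rewrite (leq_trans sumsz) // sz.
  rewrite mulrDl -mulrA coefD !coefCM coefXM addr0 sz /= [D`_(_.+1)]nth_default ?sz //.
  have -> : D`_(size s) = lead_coef D by rewrite lead_coefE sz.
  by rewrite mulr0 addr0 => /esym/eqP; rewrite mulf_eq0 (negbTE lD) orbF => /eqP.
have bE : b = 0.
  have := congr1 (fun p : {poly R} => p`_(size s)) eN.
  rewrite [N`__]nth_default; last by rewrite -ltnS -sz.
  rewrite aE mul0r add0r coefD [X in _ + X]nth_default // coefCM addr0.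
  have -> : D`_(size s) = lead_coef D by rewrite lead_coefE sz.
  by move=> /esym/eqP; rewrite mulf_eq0 (negbTE lD) orbF => /eqP.
case es : s => [|y t].
  by move: N0; rewrite eN es big_nil aE bE mul0r !addr0 mul0r eqxx.
have coefN : N`_(size s).-1 = (\sum_(x <- s) c x) * lead_coef D.
  rewrite {1}eN aE bE mul0r addr0 mul0r add0r coef_sum mulr_suml.
  by apply: eq_big_seq => u us'; rewrite coefZ cD.
have cs : \sum_(x <- s) c x < 0.
  rewrite es big_cons ltr_wnDr ?cneg ?es ?mem_head //.
  by rewrite big_seq sumr_le0 // => u ut; apply/ltW/cneg; rewrite es inE ut orbT.
have szN : size N = size s.
  apply/eqP; rewrite eqn_leq -ltnS -sz sND /= leqNgt; apply/negP => lt.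
  have : N`_(size s).-1 = 0 by rewrite nth_default // -ltnS prednK // es.
  by move/eqP; rewrite coefN mulf_eq0 (lt_eqF cs) (negbTE lD).
rewrite szN sz; split=> //.
have -> : D`_(size s) = lead_coef D by rewrite lead_coefE sz.
rewrite [lead_coef N]lead_coefE szN coefN mulNr mulrCA -expr2 -mulNr.
by rewrite mulr_ge0 ?sqr_ge0 // oppr_ge0 ltW.
Qed.

Lemma nev_recip (R : rcfType) (N D : {poly R}) :
  nevanlinna N D -> N != 0 -> nevanlinna (- D) N.
Proof.
move=> h N0; have [sD cD] := nev_top h N0; split.
- apply: simple_real_roots => // [z|x Nx]; first exact: (nev_real_roots h N0).
  by have := nev_deriv_sign h N0 Nx; apply: contraTneq => ->; rewrite mulr0 ltxx.
- by move=> x Nx; rewrite hornerN mulNr oppr_lt0 (nev_deriv_sign h).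
- by rewrite size_polyN.
- by rewrite coefN.
Qed.

(** Between consecutive poles N / D increases from -oo to +oo. *)
Lemma nev_interlace (R : rcfType) (N D : {poly R}) x y :
  nevanlinna N D -> root D x -> root D y -> x < y ->
  exists2 t, x < t < y & root N t.
Proof.
move=> h Dx; have [[s hs] sgn _ _] := h.
move=> Dy xy.
(* y' is the root of D that follows x. *)
have [y' /andP[xy' y'y] [Dy' min]] : exists2 y', x < y' <= y &
    root D y' /\ forall u, x < u < y' -> ~~ root D u.
  pose t := [seq u <- s | x < u <= y].
  have yt : y \in t by rewrite mem_filter xy lexx (mem_root_seq _ hs).
  pose m := \big[Num.min/y]_(u <- t) u.
  have mt : m \in t.
    by rewrite /m big_seq; elim/big_ind: _ => // u v ut vt; rewrite minEle; case: ifP.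
  move: (mt); rewrite mem_filter => /andP[xm ms].
  exists m => //; split; first by rewrite -(mem_root_seq _ hs).
  move=> u /andP[xu um]; apply/negP; rewrite -(mem_root_seq _ hs) => us.
  have : u \in t by rewrite mem_filter xu us (ltW (lt_le_trans um _)) //; case/andP: xm.
  move=> ut; have : m <= u by rewrite /m; apply: ge_bigmin_seq.
  by rewrite leNgt um.
suff [u /andP[xu uy] Nu] : exists2 t, x < t < y' & root N t.
  by exists u => //; rewrite xu (lt_le_trans uy).
have D'sgn : D^`().[x] * D^`().[y'] < 0.
  have y'x : y' != x by rewrite gt_eqF.
  have [us rs sz] := hs.
  have xs : x \in s by rewrite (mem_root_seq _ hs).
  have ys : y' \in s by rewrite (mem_root_seq _ hs).
  pose Q := \prod_(u <- rem y' (rem x s)) ('X - u%:P).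
  have ys' : y' \in rem x s by rewrite mem_rem_uniq // inE y'x.
  have eD : D = lead_coef D *: (('X - x%:P) * (('X - y'%:P) * Q)).
    rewrite {1}(root_seq_prod hs) (perm_big _ (perm_to_rem xs)) big_cons.
    by rewrite (perm_big _ (perm_to_rem ys')) big_cons.
  have -> : D^`().[x] = lead_coef D * ((x - y') * Q.[x]).
    rewrite {1}eD derivZ hornerZ !derivM !derivXsubC.
    by rewrite !mul1r !(hornerXsubC, hornerD, hornerM); ring.
  have -> : D^`().[y'] = lead_coef D * ((y' - x) * Q.[y']).
    rewrite {1}eD derivZ hornerZ !derivM !derivXsubC.
    by rewrite !mul1r !(hornerXsubC, hornerD, hornerM); ring.
  have lD : 0 < lead_coef D ^+ 2.
    by rewrite exprn_even_gt0 //= lead_coef_eq0 (root_seq_neq0 hs).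
  have Qsgn : 0 < Q.[x] * Q.[y'].
    rewrite /Q !horner_prod -big_split /= big_seq prodr_gt0 // => u.
    have urs : uniq (rem x s) by rewrite rem_uniq.
    rewrite mem_rem_uniq // inE mem_rem_uniq // inE => /and3P[uy ux uS].
    rewrite !hornerXsubC.
    have : ~~ (x < u < y').
      by apply/negP => /min; rewrite -(mem_root_seq _ hs) uS.
    rewrite negb_and -!leNgt => /orP[ux'|uy'].
      have uxl : u < x by rewrite lt_neqAle ux.
      by rewrite mulr_gt0 ?subr_gt0 // (lt_trans uxl).
    have uyl : y' < u by rewrite lt_neqAle eq_sym uy.
    by rewrite nmulr_rgt0 subr_lt0 // (lt_trans xy').
  have -> : lead_coef D * ((x - y') * Q.[x]) * (lead_coef D * ((y' - x) * Q.[y'])) =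
    - ((lead_coef D ^+ 2) * (y' - x) ^+ 2 * (Q.[x] * Q.[y'])) by ring.
  have dpos : 0 < (y' - x) ^+ 2 by rewrite exprn_even_gt0 //= subr_eq0.
  by rewrite oppr_lt0 (mulr_gt0 (mulr_gt0 lD dpos) Qsgn).
(* The residues have the same sign while D' changes sign, so N does too. *)
have Nsgn : N.[x] * N.[y'] < 0.
  have := sgn _ Dx; have := sgn _ Dy' => sy sx.
  have pp : 0 < (N.[x] * D^`().[x]) * (N.[y'] * D^`().[y']) by rewrite nmulr_rgt0.
  have pp' : 0 < (N.[x] * N.[y']) * (D^`().[x] * D^`().[y']) by move: pp; nra.
  by move: pp'; rewrite nmulr_lgt0.
have [u xuy Nu] := polyrcf.poly_ivtoo (ltW xy') Nsgn.
by exists u.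
Qed.

(** * Transfer of solutions across point masses *)

Section Chains.
Context {R : realType}.
Implicit Types (a x y d : R) (m : R * R * R) (u w : {poly R} * {poly R})
  (l : seq (R * R * R)).

Definition pos m : R := m.1.1.

(** The coefficient omega z + v z^2 of f in the jump of f' at the point mass. *)
Definition impedance m : {poly R} := m.1.2%:P * 'X + m.2%:P * 'X^2.

Definition admissible m : bool := (0 <= m.2) && (0 < `|m.1.2| + m.2).

Definition ltpos : rel (R * R * R) := [rel m m' | pos m < pos m'].

Lemma ltpos_trans : transitive ltpos.
Proof. by move=> m1 m2 m3; apply: lt_trans. Qed.

(** A state u stands for the function u.1 e^(x/2) + u.2 e^(-x/2); this is its
    value at x, as a polynomial in the spectral parameter. *)
Definition pval x u : {poly R} :=
  (expR (x / 2))%:P * u.1 + (expR (- (x / 2)))%:P * u.2.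

(** Minus the derivative at x of the function that u stands for: with this sign
    the two half-lines play symmetric roles. *)
Definition pder x u : {poly R} :=
  (2^-1)%:P * ((expR (- (x / 2)))%:P * u.2 - (expR (x / 2))%:P * u.1).

(** Crossing a point mass from right to left: the function keeps its value V at
    the point y and gains the multiple 2 c V sinh((x - y)/2), c the impedance. *)
Definition kick m u : {poly R} * {poly R} :=
  (u.1 + (expR (- (pos m / 2)))%:P * (impedance m * pval (pos m) u),
   u.2 - (expR (pos m / 2))%:P * (impedance m * pval (pos m) u)).

(** The state, to the left of all the masses of l, of the solution equal to
    e^(-x/2) to the right of them. *)
Definition chain l := foldr kick (0, 1) l.

Definition cosh_half d : R := (expR (d / 2) + expR (- (d / 2))) / 2.
Definition sinh_half d : R := (expR (d / 2) - expR (- (d / 2))) / 2.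

Lemma expR_half_mulV x : expR (x / 2) * expR (- (x / 2)) = 1.
Proof. by rewrite -expRD subrr expR0. Qed.

Lemma polyC_half_mulV x : (expR (x / 2))%:P * (expR (- (x / 2)))%:P = 1 :> {poly R}.
Proof. by rewrite -polyCM expR_half_mulV. Qed.

Lemma polyC_half2 : (2^-1)%:P * 2 = 1 :> {poly R}.
Proof. by rewrite -(polyC_natr R 2) -polyCM mulVf ?pnatr_eq0. Qed.

Lemma cosh_half_gt0 d : 0 < cosh_half d.
Proof. by rewrite divr_gt0 // addr_gt0 ?expR_gt0. Qed.

Lemma sinh_half_gt0 d : 0 < d -> 0 < sinh_half d.
Proof. by move=> d0; rewrite divr_gt0 // subr_gt0 ltr_expR; lra. Qed.

Lemma cosh_half2_sinh_half2 d : cosh_half d ^+ 2 - sinh_half d ^+ 2 = 1.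
Proof. by rewrite -(expR_half_mulV d) /cosh_half /sinh_half; field. Qed.

Lemma expR_travel a y :
  expR (a / 2) = (cosh_half (y - a) - sinh_half (y - a)) * expR (y / 2) /\
  expR (- (a / 2)) = (cosh_half (y - a) + sinh_half (y - a)) * expR (- (y / 2)).
Proof.
have -> : cosh_half (y - a) - sinh_half (y - a) = expR (- ((y - a) / 2)).
  by rewrite /cosh_half /sinh_half; field.
have -> : cosh_half (y - a) + sinh_half (y - a) = expR ((y - a) / 2).
  by rewrite /cosh_half /sinh_half; field.
by rewrite -!expRD; split; congr expR; field.
Qed.

(** Value and slope at y determine the function; between masses the transfer
    from y to a has constant coefficients. *)
Lemma travel_pval a y u :
  pval a u = (cosh_half (y - a))%:P * pval y u + (2 * sinh_half (y - a))%:P * pder y u.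
Proof.
rewrite /pval /pder; have [-> ->] := expR_travel a y.
set c := cosh_half _; set s := sinh_half _.
have -> : (c - s) * expR (y / 2) = c * expR (y / 2) - (2 * s) * 2^-1 * expR (y / 2).
  by field.
have -> : (c + s) * expR (- (y / 2)) =
    c * expR (- (y / 2)) + (2 * s) * 2^-1 * expR (- (y / 2)) by field.
by ring.
Qed.

Lemma travel_pder a y u :
  pder a u = (sinh_half (y - a) / 2)%:P * pval y u + (cosh_half (y - a))%:P * pder y u.
Proof.
rewrite /pval /pder; have [-> ->] := expR_travel a y.
by ring.
Qed.

Lemma pval_kick m u : pval (pos m) (kick m u) = pval (pos m) u.
Proof. by rewrite /pval /kick /=; ring. Qed.

Lemma pder_kick m u :
  pder (pos m) (kick m u) = pder (pos m) u - impedance m * pval (pos m) u.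
Proof.
rewrite /pder /kick /=; set V := pval _ _; set y := pos m.
transitivity ((2^-1)%:P * ((expR (- (y / 2)))%:P * u.2 - (expR (y / 2))%:P * u.1)
  - ((2^-1)%:P * 2) * ((expR (y / 2))%:P * (expR (- (y / 2)))%:P) * (impedance m * V)).
  by ring.
by rewrite polyC_half2 polyC_half_mulV !mul1r.
Qed.

Lemma size_impedance m : admissible m -> (1 < size (impedance m))%N.
Proof.
move=> /andP[v0 w0]; rewrite ltnNge; apply/negP => /leq_sizeP h.
have := h 1 isT; have := h 2 isT; rewrite /impedance !coefE /=.
rewrite mulr0 mulr1 add0r mulr0 mulr1 addr0 => v00 w00.
by move: w0; rewrite v00 w00 normr0 addr0 ltxx.
Qed.

Lemma top_comb (k h : R) (p q : {poly R}) : (size p < size q)%N -> h != 0 ->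
  size (k%:P * p + h%:P * q) = size q /\
  lead_coef (k%:P * p + h%:P * q) = h * lead_coef q.
Proof.
move=> pq h0; rewrite !mul_polyC.
have lt : (size (k *: p) < size (h *: q))%N.
  by rewrite (leq_ltn_trans (size_scale_leq _ _)) // size_scale.
by rewrite addrC size_polyDl // lead_coefDl // size_scale // lead_coefZ.
Qed.

Lemma size_subM (c p q : {poly R}) : (1 < size c)%N -> p != 0 ->
  size q = size p -> (size p < size (q - c * p)%R)%N.
Proof.
move=> c1 p0 sqp; have c0 : c != 0 by rewrite -size_poly_gt0 ltnW.
have lt : (size p < size (c * p)%R)%N.
  rewrite size_mul //; case: (size c) c1 => [|[|k]] // _.
  by rewrite !addSn /= ltnS leq_addl.
by rewrite addrC size_polyDl size_polyN // sqp.
Qed.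

(** Each point mass raises the degree: after the kick the slope dominates the
    value, and moving away from the mass mixes both with positive weights. *)
Lemma chain_top a l : sorted ltpos l -> all admissible l ->
    all (fun m => a < pos m) l ->
  [/\ pval a (chain l) != 0, size (pder a (chain l)) = size (pval a (chain l))
    & 0 < lead_coef (pval a (chain l)) * lead_coef (pder a (chain l))].
Proof.
elim: l a => [|m l IH] a /=.
  move=> _ _ _; rewrite /pval /pder /= !(mulr0, mulr1, add0r, subr0) -polyCM.
  have e0 : expR (- (a / 2)) != 0 :> R by rewrite gt_eqF ?expR_gt0.
  by rewrite polyC_eq0 !size_polyC mulf_neq0 ?invr_eq0 // e0 !lead_coefC !mulr_gt0 ?expR_gt0.
rewrite path_sortedE => [/andP[ml sl] /andP[am al] /andP[aym aal]|]; last exact: ltpos_trans.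
have [p0 sqp _] := IH (pos m) sl al ml.
have := size_subM (size_impedance am) p0 sqp; rewrite -pder_kick; set q := pder _ (kick _ _) => lt.
have s0 : 0 < sinh_half (pos m - a) by rewrite sinh_half_gt0 // subr_gt0.
have c0 := cosh_half_gt0 (pos m - a).
rewrite (travel_pval a (pos m)) (travel_pder a (pos m)) pval_kick -/q.
have [|-> ->] := @top_comb (cosh_half (pos m - a)) (2 * sinh_half (pos m - a)) _ _ lt.
  by rewrite mulf_neq0 // gt_eqF.
have [|-> ->] := @top_comb (sinh_half (pos m - a) / 2) (cosh_half (pos m - a)) _ _ lt.
  by rewrite gt_eqF.
have q0 : q != 0 by rewrite -size_poly_gt0 (leq_ltn_trans _ lt).
split=> //.
  rewrite -size_poly_gt0.
  have [|-> _] := @top_comb (cosh_half (pos m - a)) (2 * sinh_half (pos m - a)) _ _ lt.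
    by rewrite mulf_neq0 // gt_eqF.
  by rewrite size_poly_gt0.
have -> : 2 * sinh_half (pos m - a) * lead_coef q * (cosh_half (pos m - a) * lead_coef q) =
  (2 * sinh_half (pos m - a) * cosh_half (pos m - a)) * lead_coef q ^+ 2 by ring.
rewrite mulr_gt0 //; first by rewrite mulr_gt0 // mulr_gt0.
by rewrite exprn_even_gt0 //= lead_coef_eq0.
Qed.

(** With a mass allowed at a itself, value and slope need not have the same
    degree any more. *)
Lemma chain_top_le a l :
    sorted ltpos l -> all admissible l -> all (fun m => a <= pos m) l ->
  let p := pval a (chain l) in let q := pder a (chain l) in
  [/\ q != 0, (size p <= size q)%N & 0 <= p`_(size q).-1 * lead_coef q].
Proof.
move=> sl al aal.
have lt_case : all (fun m => a < pos m) l ->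
    let p := pval a (chain l) in let q := pder a (chain l) in
    [/\ q != 0, (size p <= size q)%N & 0 <= p`_(size q).-1 * lead_coef q].
  move=> /(chain_top sl al)[p0 sqp lpq] p q; rewrite sqp -size_poly_gt0.
  by rewrite sqp size_poly_gt0 p0 leqnn -lead_coefE ltW.
case: l sl al aal lt_case => [|m l]; first by move=> _ _ _; exact.
rewrite [sorted _ _]path_sortedE => [|]; last exact: ltpos_trans.
move=> /andP[ml sl] /andP[am al] /andP[aym aal] h.
move: aym; rewrite le_eqVlt => /predU1P[e|lt]; last first.
  by apply: h; rewrite /= lt /=; apply: sub_all ml => k; exact: lt_trans.
have [p0 sqp _] := chain_top sl al ml.
have := size_subM (size_impedance am) p0 sqp; rewrite -pder_kick.
rewrite e /= pval_kick; set q := pder _ (kick _ _); set p := pval _ _ => lt.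
split; first by rewrite -size_poly_gt0 (leq_ltn_trans _ lt).
  exact: ltnW.
by rewrite nth_default ?mul0r // -ltnS prednK // (leq_ltn_trans _ lt).
Qed.

(** phi_+ at x: only the masses to the right of x matter. *)
Definition phi_at l x : {poly R} := pval x (chain [seq m <- l | x < pos m]).

(** The Wronskian with respect to the spectral parameter, not to x. *)
Definition wronsk u : {poly R} := u.2^`() * u.1 - u.1^`() * u.2.

Lemma wronsk_kick m u :
  wronsk (kick m u) = wronsk u - (impedance m)^`() * pval (pos m) u ^+ 2.
Proof.
rewrite /wronsk /kick /=; set c := impedance m.
rewrite /pval !(derivD, derivN, derivM, derivC) !mul0r !add0r /=.
have H := polyC_half_mulV (pos m).
ring: H.
Qed.

Lemma phi_at_head m l : sorted ltpos (m :: l) -> phi_at (m :: l) (pos m) = pval (pos m) (chain l).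
Proof.
rewrite /= path_sortedE => [/andP[ml _]|]; last exact: ltpos_trans.
by rewrite /phi_at /= ltxx; congr (pval _ (chain _)); apply/all_filterP.
Qed.

Lemma phi_at_tail m l x : pos m <= x -> phi_at (m :: l) x = phi_at l x.
Proof. by move=> mx; rewrite /phi_at /= ltNge mx. Qed.

Lemma sum_phi_at_cons (V : zmodType) (F : R * R * R -> {poly R} -> V) m l :
  sorted ltpos (m :: l) ->
  \sum_(k <- m :: l) F k (phi_at (m :: l) (pos k)) =
  F m (pval (pos m) (chain l)) + \sum_(k <- l) F k (phi_at l (pos k)).
Proof.
move=> sl; rewrite big_cons phi_at_head //; congr (_ + _).
move: sl; rewrite /= path_sortedE => [/andP[ml _]|]; last exact: ltpos_trans.
apply: eq_big_seq => k kl; rewrite phi_at_tail //.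
by apply/ltW/(allP ml).
Qed.

(** The Lagrange identity: differentiating the equation in z, every mass
    contributes minus the z-derivative of its impedance times phi_+^2. *)
Lemma wronsk_chain l : sorted ltpos l ->
  wronsk (chain l) = - \sum_(m <- l) (impedance m)^`() * phi_at l (pos m) ^+ 2.
Proof.
elim: l => [|m l IH] sl; first by rewrite big_nil /wronsk /= !derivC !mul0r subrr oppr0.
rewrite (sum_phi_at_cons (fun m p => (impedance m)^`() * p ^+ 2)) //= wronsk_kick IH.
  by rewrite opprD addrC.
by move: sl => /= /path_sorted.
Qed.

(** The first term is - f f' at a for the solution f of the chain.  Integrating by
    parts, the whole is the integral of f'^2 + f^2 / 4 over [a, +oo). *)
Lemma chain_energy a l (t : R) : sorted ltpos l -> all (fun m => a <= pos m) l ->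
  0 < (expR (- a) * (chain l).2.[t] ^+ 2 - expR a * (chain l).1.[t] ^+ 2) / 2
      + \sum_(m <- l) (impedance m).[t] * (phi_at l (pos m)).[t] ^+ 2.
Proof.
elim: l a => [|m l IH] a sl.
  rewrite big_nil [_.1.[t]]horner0 [_.2.[t]]hornerC expr0n expr1n mulr0 mulr1.
  by rewrite subr0 addr0 divr_gt0 ?expR_gt0.
move=> /= /andP[am aal].
rewrite (sum_phi_at_cons (fun m p => (impedance m).[t] * p.[t] ^+ 2)) //=.
have sl' : sorted ltpos l by move: sl => /= /path_sorted.
have ml : all (fun k => pos m <= pos k) l.
  move: sl; rewrite /= path_sortedE => [/andP[ml _]|]; last exact: ltpos_trans.
  by apply: sub_all ml => k /ltW.
have := IH (pos m) sl' ml; set S := \sum_(_ <- l) _; set u := chain l => e0.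
rewrite /kick /=; move: (impedance m) => cp; rewrite !(hornerD, hornerN, hornerM, hornerC).
set c := cp.[t]; set A := u.1.[t]; set B := u.2.[t].
set y := pos m.
have le1 : expR a <= expR y by rewrite ler_expR.
have le2 : expR (- y) <= expR (- a) by rewrite ler_expR lerN2.
move: e0; rewrite -/A -/B -/y.
have -> : expR (- y) = expR (- (y / 2)) ^+ 2.
  by rewrite -expRM_natl; congr expR; field.
have -> : expR y = expR (y / 2) ^+ 2.
  by rewrite -expRM_natl; congr expR; field.
move: le1 le2.
have -> : expR (- y) = expR (- (y / 2)) ^+ 2.
  by rewrite -expRM_natl; congr expR; field.
have -> : expR y = expR (y / 2) ^+ 2.
  by rewrite -expRM_natl; congr expR; field.
have := expR_half_mulV y.
set e := expR (y / 2); set e' := expR (- (y / 2)) => ee' le1 le2 e0.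
set F := e * A + e' * B.
set A' := A + e' * (c * F); set B' := B - e * (c * F).
have h1 : expR a * A' ^+ 2 <= e ^+ 2 * A' ^+ 2 by rewrite ler_wpM2r ?sqr_ge0.
have h2 : e' ^+ 2 * B' ^+ 2 <= expR (- a) * B' ^+ 2 by rewrite ler_wpM2r ?sqr_ge0.
have id : (e' ^+ 2 * B' ^+ 2 - e ^+ 2 * A' ^+ 2) / 2 =
   (e' ^+ 2 * B ^+ 2 - e ^+ 2 * A ^+ 2) / 2 - c * F ^+ 2.
  rewrite /A' /B'.
  have -> : e' ^+ 2 * (B - e * (c * F)) ^+ 2 = (e' * B - (e * e') * (c * F)) ^+ 2 by ring.
  have -> : e ^+ 2 * (A + e' * (c * F)) ^+ 2 = (e * A + (e * e') * (c * F)) ^+ 2 by ring.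
  by rewrite ee' /F; field.
lra.
Qed.

Lemma chain0 l : (chain l).1.[0] = 0 /\ (chain l).2.[0] = 1.
Proof.
elim: l => [|m l [IH1 IH2]] /=; first by rewrite !hornerE.
have c0 : (impedance m).[0] = 0 by rewrite /impedance !hornerE /= !(mulr0, addr0).
move: (impedance m) c0 => c c0; rewrite /pval !(hornerD, hornerN, hornerM, hornerC).
by rewrite c0 IH1 IH2 !(mul0r, mulr0) subr0 addr0.
Qed.

Lemma pval_chain0 a l : (pval a (chain l)).[0] = expR (- (a / 2)).
Proof.
have [h1 h2] := chain0 l.
by rewrite /pval !(hornerD, hornerM, hornerC) h1 h2 mulr0 add0r mulr1.
Qed.

Definition mirror m : R * R * R := (- pos m, m.1.2, m.2).

(** The state of x |-> f (- x). *)
Definition swap_state (u : {poly R} * {poly R}) := (u.2, u.1).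

Definition unkick m := kick (pos m, - m.1.2, - m.2).

Lemma unkickK m u : kick m (unkick m u) = u.
Proof.
rewrite /unkick /kick /= /pos /=; set y := m.1.1.
have -> : impedance (y, - m.1.2, - m.2) = - impedance m.
  by rewrite /impedance /= !polyCN; ring.
have H := polyC_half_mulV y.
rewrite /pval; case: u => A B /=; congr (_, _); ring: H.
Qed.

(** Crossing a mass from left to right, computed in the mirror, is undone by the
    crossing from right to left. *)
Lemma kick_swap m u : kick m (swap_state (kick (mirror m) u)) = swap_state u.
Proof.
rewrite /swap_state /kick /= -[impedance (mirror m)]/(impedance m).
move: (impedance m) => c; rewrite /pval /mirror /pos /= mulNr opprK; set y := m.1.1.
have H := polyC_half_mulV y.
case: u => A B /=; congr (_, _); ring: H.
Qed.

Lemma pval_swap_state a u : pval a (swap_state u) = pval (- a) u.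
Proof. by rewrite /pval mulNr opprK addrC. Qed.

(** The solution equal to e^(x/2) to the left of the masses of l, seen in the
    mirror: it is again a solution decaying at +oo. *)
Definition lchain l := chain (rev (map mirror l)).

Lemma kick_lchain l : foldr kick (swap_state (lchain l)) l = (1, 0).
Proof.
rewrite /lchain /chain -[RHS]/(swap_state (0, 1)).
rewrite -(foldl_rev (fun u m => kick m u) _ (rev _)) revK.
elim: l (0, 1) => [|m l IH] u0 //=.
by rewrite IH kick_swap.
Qed.

Definition wedge u w : {poly R} := u.1 * w.2 - u.2 * w.1.

(** Kicks have determinant 1, so they preserve the Wronskian in x of two solutions. *)
Lemma wedge_kick m u w : wedge (kick m u) (kick m w) = wedge u w.
Proof.
rewrite /wedge /kick /=; set c := impedance m.
have H := polyC_half_mulV (pos m).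
rewrite /pval; case: u w => A B [A' B'] /=; ring: H.
Qed.

Lemma wedge_foldr_kick l u w : wedge (foldr kick u l) (foldr kick w l) = wedge u w.
Proof. by elim: l => //= m l IH; rewrite wedge_kick. Qed.

Lemma chain_cat2 l r :
  (chain (l ++ r)).2 = (chain r).2 * (lchain l).2 - (chain r).1 * (lchain l).1.
Proof.
have := wedge_foldr_kick l (chain r) (swap_state (lchain l)).
rewrite kick_lchain /chain foldr_cat /wedge /= mulr0 mulr1 add0r => h.
by rewrite -[LHS]opprK h opprB.
Qed.

(** The Wronskian of phi_+ and phi_-, computed at a and near -oo. *)
Lemma chain_cat2_at a l r :
  (chain (l ++ r)).2 = pval a (chain r) * pder (- a) (lchain l)
                     + pder a (chain r) * pval (- a) (lchain l).
Proof.
rewrite chain_cat2 /pval /pder mulNr opprK.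
set u := chain r; set w := lchain l.
transitivity (((2^-1)%:P * 2) * ((expR (a / 2))%:P * (expR (- (a / 2)))%:P)
  * (u.2 * w.2 - u.1 * w.1)).
  by rewrite polyC_half2 polyC_half_mulV !mul1r.
by ring.
Qed.

(** The first coefficient of the full chain is the ratio phi_+ / phi_- wherever
    the second one vanishes: write the state of phi_+ on the basis formed by
    phi_- and a second solution. *)
Lemma pval_chain_cat a l r : exists w : {poly R},
  pval a (chain r) = (chain (l ++ r)).1 * pval (- a) (lchain l) + (chain (l ++ r)).2 * w.
Proof.
pose w0 := foldl (fun u m => unkick m u) (0, 1) l.
have ew0 : foldr kick w0 l = (0, 1).
  rewrite /w0; elim: l (0, 1) {w0} => [|m l IH] u0 //=.
  by rewrite IH unkickK.
have h1 := wedge_foldr_kick l (chain r) (swap_state (lchain l)).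
have h2 := wedge_foldr_kick l (chain r) w0.
have h3 := wedge_foldr_kick l (swap_state (lchain l)) w0.
move: h1 h2 h3; rewrite ew0 kick_lchain -[foldr kick (chain r) l]foldr_cat -/(chain (l ++ r)).
rewrite /wedge /= !(mulr0, mulr1, mul1r, add0r, subr0) => h1 h2 h3.
exists (pval a w0); rewrite -pval_swap_state h2 -[(chain (l ++ r)).2]opprK h1 -[LHS]mul1r h3.
by rewrite /pval /swap_state /=; ring.
Qed.

End Chains.

(** * The inverse problem on a half-line *)

Section InverseHalfLine.
Context {R : realType}.

Lemma root_seq_mulX (p : {poly R}) s :
  p.[0] != 0 -> root_seq ('X * p) s -> root_seq p (rem 0 s).
Proof.
move=> p0 h; have [us rs sz] := h.
have pn0 : p != 0 by apply: contraNneq p0 => ->; rewrite horner0.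
have s0 : 0 \in s by rewrite (mem_root_seq _ h) rootE hornerM hornerX mul0r.
split; first by rewrite rem_uniq.
  apply/allP => x; rewrite mem_rem_uniq // inE => /andP[x0 /(allP rs)].
  by rewrite !rootE hornerM hornerX mulf_eq0 (negbTE x0).
move: sz; rewrite mulrC size_mulX // size_rem // => -[->].
by rewrite prednK //; case: (s) s0.
Qed.

(** Every value above 1/2 is taken by coth(L/2) / 2: the limit at infinity of the
    slope-to-value ratio determines the distance to the first mass. *)
Lemma exists_coth (k : R) : 2^-1 < k -> exists2 L : R, 0 < L & cosh_half L = 2 * k * sinh_half L.
Proof.
move=> k2; pose t : R := (2 * k + 1) / (2 * k - 1).
have d0 : 0 < 2 * k - 1 by lra.
have t1 : 1 < t by rewrite /t ltr_pdivlMr //; lra.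
have t0 : 0 < t by apply: lt_trans t1.
exists (ln t); first by rewrite ln_gt0.
have eL : expR (ln t / 2) ^+ 2 = t.
  rewrite -expRM_natl; have -> : 2 * (ln t / 2) = ln t by field.
  by rewrite lnK ?posrE.
have e0 := expR_gt0 (ln t / 2 : R).
rewrite /cosh_half /sinh_half expRN; set e := expR _ in eL e0 *.
have : e ^+ 2 * (2 * k - 1) = 2 * k + 1 by rewrite eL /t divfK // gt_eqF.
move=> h; have en : e != 0 by rewrite gt_eqF.
apply/eqP; rewrite -subr_eq0; apply/eqP.
have -> : (e + e^-1) / 2 - 2 * k * ((e - e^-1) / 2) =
   - (e ^+ 2 * (2 * k - 1) - (2 * k + 1)) / (2 * e) by field.
by rewrite h subrr oppr0 mul0r.
Qed.

Lemma poly_size3 (Q : {poly R}) : (size Q <= 3)%N ->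
  Q = (Q`_0)%:P + (Q`_1)%:P * 'X + (Q`_2)%:P * 'X^2.
Proof.
move=> sQ; apply/polyP => -[|[|[|i]]]; rewrite !coefE /= ?mulr0 ?mulr1 ?addr0 ?add0r //.
by rewrite nth_default // (leq_trans sQ).
Qed.

Lemma coef_quadM (c0 c1 c2 : R) (p r : {poly R}) : (size r < size p)%N ->
  ((c0%:P + c1%:P * 'X + c2%:P * 'X^2) * p + r)`_(size p).+1 = c2 * lead_coef p.
Proof.
move=> sr; have [d sp] : exists d, size p = d.+1 by case: (size p) sr => // d; exists d.
rewrite expr2 !mulrDl -!mulrA !coefD !coefCM !coefXM /= lead_coefE sp /=.
rewrite [p`_d.+2]nth_default ?sp // [p`_d.+1]nth_default ?sp //.
rewrite [r`__]nth_default ?mulr0 ?addr0 ?add0r //.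
by rewrite (leq_trans (ltnW sr)) // sp leqnSn.
Qed.

(** Stieltjes-type continued fraction.  With m = q / p, the limit kap of m at
    infinity gives the distance L to the first mass, since a solution vanishing
    there has slope-to-value ratio coth(L/2) / 2.  The function z (kap - m) is
    again Nevanlinna, hence so is -1 / (z (kap - m)); the value p1 just to the
    right of the mass is proportional to kap p - q, and the polynomial part of
    - p / p1, up to a positive factor and a constant, is the impedance, with
    v >= 0 by the growth condition.  The degree
    of p1 is smaller than that of p. *)
Lemma halfline_inverse (a : R) (p q : {poly R}) :
  nevanlinna (- q) ('X * p) -> (size q <= size p)%N ->
  p.[0] = expR (- (a / 2)) -> q.[0] = expR (- (a / 2)) / 2 ->
  exists l, [/\ sorted ltpos l, all admissible l, all (fun m => a < pos m) l,
    pval a (chain l) = p & pder a (chain l) = q].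
Proof.
move: {2}(size p) (leqnn (size p)) => n.
elim: n a p q => [|n IH] a p q spn hn sqp p00 q00.
  by move: (expR_gt0 (- (a / 2) : R)); rewrite -p00 (size_poly_leq0P _ spn) horner0 ltxx.
have E0 := expR_gt0 (- (a / 2) : R).
have pn0 : p != 0 by apply: contraTneq E0 => pe; rewrite -p00 pe horner0 ltxx.
have p0n : p.[0] != 0 by rewrite p00 gt_eqF.
have [sp1|sp1] := leqP (size p) 1.
  exists [::]; split => //.
    rewrite (size1_polyC sp1) -horner_coef0 p00 /pval /=.
    by rewrite mulr0 add0r mulr1.
  rewrite (size1_polyC (leq_trans sqp sp1)) -horner_coef0 q00 /pder /=.
  by rewrite mulr0 mulr1 subr0 -polyCM mulrC.
have [[s hs] sgn _ _] := hn.
have hsp := root_seq_mulX p0n hs.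
have lp0 : lead_coef p != 0 by rewrite lead_coef_eq0.
pose kap := q`_(size p).-1 / lead_coef p.
pose D := kap%:P * p - q.
have sD : (size D < size p)%N.
  rewrite -(prednK (ltnW sp1)) ltnS; apply/leq_sizeP => j.
  rewrite leq_eqVlt => /predU1P[<-|jp]; rewrite /D coefB coefCM.
    by rewrite -lead_coefE /kap divfK ?subrr.
  rewrite prednK ?(ltnW sp1) // in jp.
  by rewrite !nth_default ?mulr0 ?subrr // (leq_trans sqp).
have sgnp x : root p x -> (- q.[x]) * (x * p^`().[x]) < 0.
  move=> px; have /sgn : root ('X * p) x by rewrite rootM px orbT.
  by rewrite derivM derivX mul1r hornerN !(hornerD, hornerM, hornerX) (rootP px) add0r.
have sXD : (size ('X * D)%R <= size p)%N.
  by rewrite (leq_trans (size_polyMleq _ _)) // size_polyX addSn.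
(* At a root x of p the residue is - x q(x) / p'(x), which is x^2 times the
   residue of - q / (X p). *)
have hXD : nevanlinna ('X * D) p.
  split; first by exists (rem 0 s).
  - move=> x px; have := sgnp x px; rewrite /D.
    by rewrite !(hornerM, hornerX, hornerD, hornerN, hornerC) (rootP px) mulr0 sub0r mulrCA mulrA.
  - by rewrite (leq_trans sXD).
  - by rewrite nth_default ?mul0r.
have Dn0 : D != 0.
  apply/eqP => D0; have [_ _ szp] := hsp.
  case es : (rem 0 s) => [|x t]; first by move: sp1; rewrite szp es.
  have px : root p x by rewrite -(mem_root_seq _ hsp) es mem_head.
  have := sgnp x px; have -> : q = kap%:P * p by apply/eqP; rewrite eq_sym -subr_eq0 -/D D0.
  by rewrite hornerM (rootP px) mulr0 oppr0 mul0r ltxx.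
have XDn0 : 'X * D != 0 by rewrite mulf_neq0 ?polyX_eq0.
have hR := nev_recip hXD XDn0.
have [[s1 hs1] sgn1 sz1 top1] := hR.
have szXD : size ('X * D) = (size D).+1 by rewrite mulrC size_mulX.
have D0pos : 0 < D.[0].
  have /sgn1 : root ('X * D) 0 by rewrite rootE hornerM hornerX mul0r.
  rewrite derivM derivX mul1r hornerN !(hornerD, hornerM, hornerX) mul0r addr0 p00.
  by rewrite mulNr oppr_lt0 pmulr_rgt0.
have D0E : D.[0] = (kap - 2^-1) * expR (- (a / 2)).
  by rewrite /D hornerD hornerN hornerM hornerC p00 q00; ring.
have kap2 : 2^-1 < kap by move: D0pos; rewrite D0E pmulr_lgt0 // subr_gt0.
have [L L0 chL] := exists_coth kap2.
have s0 := sinh_half_gt0 L0; have := cosh_half2_sinh_half2 L.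
have em : expR (- (L / 2)) = cosh_half L - sinh_half L by rewrite /cosh_half /sinh_half; field.
rewrite chL in em *; set S := sinh_half L in s0 em chL * => SS.
have sk : 4 * S ^+ 2 * (kap ^+ 2 - 4^-1) = 1 by rewrite -[RHS]SS; field.
have S2 : 2 * S != 0 by rewrite mulf_neq0 ?gt_eqF.
pose k := (2 * S)^-1.
have [p1 p1E] : exists p1, p1 = (2 * S)%:P * D by eexists.
have sp1D : size p1 = size D by rewrite p1E mul_polyC size_scale.
have p1n0 : p1 != 0 by rewrite -size_poly_gt0 sp1D size_poly_gt0.
pose Q := (k%:P * p) %/ p1; pose rm := (k%:P * p) %% p1.
have eQ : k%:P * p = Q * p1 + rm by exact: divp_eq.
have szkp : size (k%:P * p) = size p by rewrite mul_polyC size_scale // invr_eq0.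
have szQ : size Q = (size p - (size D).-1)%N by rewrite /Q size_divp // szkp sp1D.
have srm : (size rm < size p1)%N by rewrite ltn_modp.
have szD0 : (0 < size D)%N by rewrite size_poly_gt0.
rewrite szXD size_polyN in sz1.
have sQ3 : (size Q <= 3)%N.
  by rewrite szQ leq_subLR; move: sz1; case: (size D) szD0 => // d _ /=; rewrite addn3.
have sQ2 : (1 < size Q)%N.
  by rewrite szQ ltn_subRL; move: sD; case: (size D) szD0 => // d _ /=; rewrite addn1.
have {}eQ : k%:P * p = ((Q`_0)%:P + (Q`_1)%:P * 'X + (Q`_2)%:P * 'X^2) * p1 + rm.
  by rewrite -poly_size3.
pose y := a + L.
pose m : R * R * R := (y, - Q`_1, - Q`_2).
have Q2 : Q`_2 <= 0.
  have : (k%:P * p)`_(size D).+1 = Q`_2 * lead_coef p1.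
    by rewrite eQ -sp1D coef_quadM.
  rewrite coefCM => eq2.
  have : 0 <= - p`_(size D).+1 * lead_coef D.
    by move: top1; rewrite szXD coefN [_ * D]mulrC lead_coefMX.
  have lD : lead_coef D != 0 by rewrite lead_coef_eq0.
  have -> : p`_(size D).+1 = 2 * S * (Q`_2 * lead_coef p1) by rewrite -eq2 /k mulVKf.
  rewrite p1E lead_coefM lead_coefC => hge.
  have : 0 <= - Q`_2 * ((2 * S) ^+ 2 * lead_coef D ^+ 2).
    by move: hge; congr (0 <= _); ring.
  rewrite pmulr_lge0 ?oppr_ge0 // mulr_gt0 //.
    by rewrite exprn_even_gt0.
  by rewrite exprn_even_gt0.
have am : admissible m.
  rewrite /admissible /= oppr_ge0 Q2 /= lt_neqAle addr_ge0 ?oppr_ge0 // andbT eq_sym.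
  rewrite paddr_eq0 ?oppr_ge0 // normr_eq0 !oppr_eq0; apply/negP => /andP[/eqP Q1 /eqP Q20].
  move: sQ2; rewrite ltnNge => /negP; apply.
  by rewrite (poly_size3 sQ3) Q1 Q20 !mul0r !addr0 size_polyC_leq1.
have [q1 q1D] : exists q1, q1 = rm + (Q`_0 - kap)%:P * p1 by eexists.
have q1E : q1 = - kap%:P * p1 + k%:P * p + impedance m * p1.
  by rewrite q1D eQ /impedance /= !polyCN polyCB; ring.
have sq1 : (size q1 <= size p1)%N.
  rewrite q1D (leq_trans (size_polyD _ _)) // geq_max (ltnW srm) /= mul_polyC.
  exact: size_scale_leq.
have yE : expR (- (y / 2)) = expR (- (a / 2)) * (2 * kap * S - S).
  by rewrite -em -expRD /y; congr expR; field.
have p10 : p1.[0] = expR (- (y / 2)).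
  by rewrite p1E hornerM hornerC D0E yE; field.
have kE : k = 2 * S * (kap ^+ 2 - 4^-1).
  by apply: (mulfI S2); rewrite /k divff // -[LHS]sk; ring.
have q10 : q1.[0] = expR (- (y / 2)) / 2.
  have c0 : (impedance m).[0] = 0 by rewrite /impedance !hornerE /= !(mulr0, addr0).
  have -> : q1.[0] = - kap * p1.[0] + k * p.[0].
    rewrite q1E; move: (impedance m) c0 (p1) => c c0 t.
    by rewrite !(hornerD, hornerM) c0 mul0r addr0 hornerN !hornerC.
  rewrite p10 p00 yE kE.
  by field.
have [] := IH y p1 q1 _ _ sq1 p10 q10.
- by rewrite sp1D -ltnS (leq_trans sD).
- have eX : 'X * p1 = (2 * S)%:P * ('X * D) by rewrite p1E mulrCA.
  have rX x : root ('X * p1) x = root ('X * D) x.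
    by rewrite eX mul_polyC rootZ.
  split.
  + exists s1; have [us rs sz] := hs1; split => //.
      by apply/allP => x /(allP rs); rewrite rX.
    by rewrite eX mul_polyC size_scale.
  + move=> x rx; have [x0|x0] := eqVneq x 0.
      rewrite x0 hornerN q10 derivM derivX mul1r !(hornerD, hornerM, hornerX) mul0r addr0 p10.
      by rewrite mulNr oppr_lt0 mulr_gt0 ?divr_gt0 ?expR_gt0.
    have p1x : p1.[x] = 0.
      by move: rx; rewrite rootM rootE hornerX (negbTE x0) => /rootP.
    have q1x : q1.[x] = k * p.[x].
      rewrite q1E; move: (impedance m) (p1) p1x => c t tx.
      by rewrite !(hornerD, hornerM) tx !mulr0 add0r addr0 hornerC.
    have := sgn1 x; rewrite -rX rx => /(_ isT); rewrite hornerN.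
    rewrite eX mul_polyC derivZ hornerZ hornerN q1x /k.
    by congr (_ < 0); field; rewrite gt_eqF.
  + by rewrite size_polyN (leq_trans sq1) // mulrC size_mulX // leqW.
  + by rewrite nth_default ?mul0r // size_polyN (leq_trans sq1) // mulrC size_mulX.
move=> l [sl al yl vl dl].
have ym : pos m = y by [].
have yaL : pos m - a = L by rewrite ym /y addrC addKr.
exists (m :: l); split.
- rewrite /= path_sortedE; last exact: ltpos_trans.
  by rewrite sl andbT.
- by rewrite /= am.
- rewrite /= ym /y ltrDl L0 /=; apply: sub_all yl => u; apply: lt_trans.
  by rewrite /y ltrDl.
- rewrite (travel_pval a (pos m)) /= pval_kick pder_kick ym -[chain l]/(chain l) vl dl -ym yaL.
  rewrite chL q1E -/S.
  transitivity ((2 * S * k)%:P * p); last by rewrite /k divff // mul1r.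
  by ring.
- rewrite (travel_pder a (pos m)) /= pval_kick pder_kick ym vl dl -ym yaL.
  rewrite chL q1E -/S.
  transitivity ((kap * (2 * S * k))%:P * p
    - (4 * S ^+ 2 * (kap ^+ 2 - 4^-1))%:P * D); last first.
    by rewrite sk /k divff // mulr1 mul1r /D; ring.
  have -> : S / 2 = 2 * S * (4^-1) by field.
  by rewrite p1E; ring.
Qed.

End InverseHalfLine.

(** * Signs of polynomials between their roots *)

Section SignLemmas.
Context {R : rcfType}.
Implicit Types (p : {poly R}) (x y t : R).

Lemma horner_same_sign p x y : x <= y ->
  (forall t, x <= t <= y -> ~~ root p t) -> 0 < p.[x] * p.[y].
Proof.
move=> xy nr; rewrite lt_neqAle; apply/andP; split.
  rewrite eq_sym mulf_neq0 //; [have := nr x | have := nr y];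
    by rewrite rootE lexx xy; apply.
rewrite leNgt; apply/negP => /(polyrcf.poly_ivtoo xy)[t /andP[xt ty] rt].
by have := nr t; rewrite (ltW xt) (ltW ty) rt => /(_ isT).
Qed.

Lemma horner_sign_change p x y z : x < z < y -> root p z -> p^`().[z] != 0 ->
  (forall t, x <= t <= y -> root p t -> t = z) -> p.[x] * p.[y] < 0.
Proof.
move=> /andP[xz zy] rz p'z uni.
have ep := divX_root rz; set g := p %/ _ in ep.
have gz : g.[z] != 0 by rewrite /g horner_deriv_divX.
have : 0 < g.[x] * g.[y].
  apply: horner_same_sign => [|t ht]; first by rewrite ltW // (lt_trans xz).
  apply/negP => gt; have tz : t = z by apply: uni => //; rewrite ep rootM gt.
  by move: gz; rewrite -tz (rootP gt) eqxx.
rewrite ep !hornerM !hornerXsubC => gg.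
have -> : g.[x] * (x - z) * (g.[y] * (y - z)) = - ((z - x) * (y - z) * (g.[x] * g.[y])).
  by ring.
by rewrite oppr_lt0 (mulr_gt0 _ gg) // mulr_gt0 ?subr_gt0.
Qed.

(** Otherwise p / (X - x) would have as many roots as its size. *)
Lemma root_seq_simple p s x : root_seq p s -> root p x -> p^`().[x] != 0.
Proof.
move=> h rx; have p0 := root_seq_neq0 h; have [us rs sz] := h.
rewrite -horner_deriv_divX //; apply/negP => gx.
have xs : x \in s by rewrite (mem_root_seq _ h).
have g0 : p %/ ('X - x%:P) != 0.
  by apply: contraNneq p0 => e; rewrite (divX_root rx) e mul0r.
have := @max_poly_roots _ _ s g0.
rewrite size_divp ?polyXsubC_eq0 // size_XsubC sz subSS subn0 ltnn => h'.
have /h'/(_ us) // : all (root (p %/ ('X - x%:P))) s.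
apply/allP => y ys; have [->|yx] := eqVneq y x; first by rewrite rootE gx.
have := allP rs _ ys; rewrite {1}(divX_root rx) rootM root_XsubC (negbTE yx) orbF.
by [].
Qed.

Lemma deriv2_mul_root p q x : root p x -> root q x ->
  (p * q)^`()^`().[x] = (p^`().[x] * q^`().[x]) *+ 2.
Proof.
move=> /rootP px /rootP qx; rewrite derivM derivD !derivM !hornerD !hornerM px qx.
by rewrite !(mulr0, mul0r, addr0, add0r) mulr2n.
Qed.

End SignLemmas.

(** * The polynomials of the spectral data *)

Section Data.
Context {R : realType} {N : nat}.
Variables (lam alpha : 'I_N -> R).
Implicit Types (i j k : 'I_N) (P : pred 'I_N) (x y t : R).

Definition zero_factor (c : R) : {poly R} := 1 - (c^-1)%:P * 'X.

Definition Wpoly P : {poly R} := \prod_(i | P i) zero_factor (lam i).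

(** The polynomial interpolating P(0) = 1 and P(lam_i) = - lam_i W'(lam_i) alpha_i^2.
    Allowing a subset of the indices makes it possible to drop the indices with
    alpha_i = 0, where W and P have a common zero, without changing P / W. *)
Definition Ppoly P : {poly R} := (1 - \sum_i alpha i ^+ 2)%:P * Wpoly P
  + \sum_(i | P i) (alpha i ^+ 2)%:P * Wpoly (fun j => P j && (j != i)).

Let S i := alpha i != 0.
Let T i := alpha i == 0.

Lemma horner_zero_factor c x : (zero_factor c).[x] = 1 - x / c.
Proof. by rewrite /zero_factor !(hornerD, hornerN, hornerM, hornerC, hornerX) mulrC. Qed.

Lemma deriv_zero_factor c : (zero_factor c)^`() = - (c^-1)%:P.
Proof. by rewrite /zero_factor derivB derivM !derivC derivX mul0r mulr1 sub0r add0r. Qed.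

Lemma zero_factor_XsubC c : c != 0 -> zero_factor c = (- c^-1) *: ('X - c%:P).
Proof.
move=> c0; rewrite /zero_factor -mul_polyC polyCN.
rewrite mulNr mulrBr -polyCM mulVf //; by rewrite opprB.
Qed.

Lemma root_zero_factor c x : c != 0 -> root (zero_factor c) x = (x == c).
Proof. by move=> c0; rewrite zero_factor_XsubC // rootZ ?root_XsubC // oppr_eq0 invr_eq0. Qed.

Lemma size_zero_factor c : c != 0 -> size (zero_factor c) = 2.
Proof. by move=> c0; rewrite zero_factor_XsubC // size_scale ?size_XsubC // oppr_eq0 invr_eq0. Qed.

Lemma Wpoly0 P : (Wpoly P).[0] = 1.
Proof. by rewrite /Wpoly horner_prod big1 // => i _; rewrite horner_zero_factor mul0r subr0. Qed.

(** The nodes with alpha_i = 0 contribute the same factor to P and to W. *)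
Lemma Ppoly_all : Ppoly predT = Wpoly T * Ppoly S.
Proof.
have WST Q : Wpoly (fun j => Q j) = Wpoly (fun j => Q j && T j) * Wpoly (fun j => Q j && S j).
  by rewrite /Wpoly (bigID T).
rewrite /Ppoly mulrDr; congr (_ + _).
  by rewrite (WST predT) /= mulrCA.
rewrite mulr_sumr [LHS](bigID S) /= [X in _ + X]big1 ?addr0; last first.
  by move=> i; rewrite negbK => /eqP ->; rewrite expr0n mul0r.
apply: eq_bigr => i Si; rewrite mulrCA; congr (_ * _).
rewrite (WST (fun j => j != i)); congr (_ * _); apply: eq_bigl => j.
  rewrite /T andbC; case: eqP => //= aj; apply/eqP => ji; move: Si.
  by rewrite /S -ji aj eqxx.
by rewrite andbC.
Qed.

Hypothesis lam_mono : forall i j, (i < j)%N -> lam i < lam j.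
Hypothesis lam_neq0 : forall i, lam i != 0.

Lemma lam_lt i j : (lam i < lam j) = (i < j)%N.
Proof.
have [/lam_mono//|/lam_mono ji|/val_inj ->] := ltngtP i j; last by rewrite ltxx.
by apply/negbTE; rewrite -leNgt ltW.
Qed.

Lemma lam_inj : injective lam.
Proof.
move=> i j e; have [/lam_mono|/lam_mono|/val_inj //] := ltngtP i j; by rewrite e ltxx.
Qed.

Lemma root_Wpoly P x : reflect (exists2 i, P i & x = lam i) (root (Wpoly P) x).
Proof.
apply: (iffP idP); last first.
  move=> [i Pi ->]; rewrite /Wpoly (bigD1 i) //= rootM root_zero_factor ?eqxx //.
rewrite rootE horner_prod => /prodf_eq0[i Pi].
by rewrite -rootE root_zero_factor // => /eqP ->; exists i.
Qed.

Lemma size_Wpoly P : size (Wpoly P) = #|P|.+1.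
Proof.
rewrite /Wpoly size_prod => [|i _]; last by rewrite -size_poly_gt0 size_zero_factor.
rewrite (eq_bigr (fun _ => 2%N)) => [|i _]; last by rewrite size_zero_factor.
by rewrite sum_nat_const muln2 -addnn -addSn addnK.
Qed.

Lemma root_seq_Wpoly P : root_seq (Wpoly P) [seq lam i | i <- enum P].
Proof.
split; first by rewrite map_inj_uniq ?enum_uniq //; apply: lam_inj.
  by rewrite all_map; apply/allP => i; rewrite mem_enum => Pi /=; apply/root_Wpoly; exists i.
by rewrite size_Wpoly size_map -cardE.
Qed.

Lemma Wpoly_D1 P i : P i -> Wpoly P = zero_factor (lam i) * Wpoly (fun j => P j && (j != i)).
Proof. by move=> Pi; rewrite /Wpoly (bigD1 i). Qed.

Lemma horner_deriv_Wpoly P i : P i ->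
  (Wpoly P)^`().[lam i] = - (lam i)^-1 * (Wpoly (fun j => P j && (j != i))).[lam i].
Proof.
move=> Pi; rewrite (Wpoly_D1 Pi) derivM deriv_zero_factor hornerD !hornerM horner_zero_factor.
by rewrite divff // subrr mul0r addr0 hornerN hornerC.
Qed.

Lemma horner_Ppoly_lam P i : P i ->
  (Ppoly P).[lam i] = alpha i ^+ 2 * (Wpoly (fun j => P j && (j != i))).[lam i].
Proof.
move=> Pi; rewrite /Ppoly hornerD hornerM.
have -> : (Wpoly P).[lam i] = 0 by apply/rootP/root_Wpoly; exists i.
rewrite mulr0 add0r horner_sum (bigD1 i) //= big1 ?addr0 ?hornerM ?hornerC //.
move=> j /andP[Pj ji]; rewrite hornerM.
suff -> : (Wpoly (fun j0 => P j0 && (j0 != j))).[lam i] = 0 by rewrite mulr0.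
by apply/rootP/root_Wpoly; exists i; rewrite // Pi eq_sym.
Qed.

Lemma Wpoly_D1_neq0 P i : P i -> (Wpoly (fun j => P j && (j != i))).[lam i] != 0.
Proof.
move=> Pi; apply/negP => /root_Wpoly[j /andP[_ ji] /lam_inj ij].
by rewrite ij eqxx in ji.
Qed.

Lemma size_Wpoly_D1 P i : P i -> (size (Wpoly (fun j => P j && (j != i))) < size (Wpoly P))%N.
Proof.
move=> Pi; rewrite !size_Wpoly ltnS (cardD1 i P) unfold_in Pi add1n ltnS.
rewrite (@eq_card _ _ [predD1 P & i]) // => j.
by rewrite !inE [in LHS]unfold_in andbC.
Qed.

Lemma Ppoly0 P : (forall i, ~~ P i -> alpha i = 0) -> (Ppoly P).[0] = 1.
Proof.
move=> hP; rewrite /Ppoly hornerD hornerM hornerC Wpoly0 mulr1 horner_sum.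
rewrite [X in _ + X](eq_bigr (fun i => alpha i ^+ 2)) => [|i _]; last first.
  by rewrite hornerM hornerC Wpoly0 mulr1.
rewrite [X in 1 - X](bigID P) /= [X in 1 - (_ + X)]big1 ?addr0 ?subrK //.
by move=> i /hP ->; rewrite expr0n.
Qed.

Lemma Ppoly_size P : (size (Ppoly P) <= size (Wpoly P))%N.
Proof.
rewrite /Ppoly (leq_trans (size_polyD _ _)) // geq_max mul_polyC size_scale_leq /=.
rewrite (leq_trans (size_sum _ _ _)) //; apply/bigmax_leqP => i Pi.
by rewrite mul_polyC (leq_trans (size_scale_leq _ _)) // ltnW // size_Wpoly_D1.
Qed.

Lemma Ppoly_top P :
  (Ppoly P)`_(size (Wpoly P)).-1 = (1 - \sum_i alpha i ^+ 2) * lead_coef (Wpoly P).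
Proof.
rewrite /Ppoly coefD coefCM -lead_coefE coef_sum [X in _ + X]big1 ?addr0 // => i Pi.
by rewrite coefCM nth_default ?mulr0 // -ltnS size_Wpoly -size_Wpoly size_Wpoly_D1.
Qed.

Lemma G_Ppoly x : (forall i, S i -> x != lam i) ->
  G lam alpha x = x * (Ppoly S).[x] / (Wpoly S).[x].
Proof.
move=> xl; have W0 : (Wpoly S).[x] != 0.
  by apply/negP => /root_Wpoly[i /xl/eqP].
have lx i : S i -> lam i - x != 0 by move=> /xl; rewrite subr_eq0 eq_sym.
rewrite /G /Ppoly hornerD hornerM hornerC horner_sum.
have WD i : S i -> (Wpoly (fun j => S j && (j != i))).[x] = (Wpoly S).[x] * (lam i / (lam i - x)).
  move=> Si; rewrite (Wpoly_D1 Si) hornerM horner_zero_factor; field.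
  by rewrite lam_neq0 lx.
have -> : \sum_(i | S i) ((alpha i ^+ 2)%:P * Wpoly (fun j => S j && (j != i))).[x] =
    (Wpoly S).[x] * \sum_(i | S i) alpha i ^+ 2 * (lam i / (lam i - x)).
  rewrite mulr_sumr; apply: eq_bigr => i Si.
  by rewrite hornerM hornerC WD //; ring.
have -> : \sum_i lam i * alpha i ^+ 2 = \sum_(i | S i) lam i * alpha i ^+ 2.
  rewrite (bigID S) /= [X in _ + X]big1 ?addr0 // => i; rewrite negbK => /eqP ->.
  by rewrite expr0n mulr0.
have -> : \sum_i lam i ^+ 2 * alpha i ^+ 2 / (lam i - x) =
    \sum_(i | S i) lam i ^+ 2 * alpha i ^+ 2 / (lam i - x).
  rewrite (bigID S) /= [X in _ + X]big1 ?addr0 // => i; rewrite negbK => /eqP ->.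
  by rewrite expr0n mulr0 mul0r.
have -> : \sum_(i | S i) lam i ^+ 2 * alpha i ^+ 2 / (lam i - x) =
   \sum_(i | S i) lam i * alpha i ^+ 2 + x * \sum_(i | S i) alpha i ^+ 2 * (lam i / (lam i - x)).
  rewrite mulr_sumr -big_split /=; apply: eq_bigr => i Si.
  by field; rewrite lx.
set c := 1 - _; set s1 := \sum_(i | S i) lam i * _; set s2 := \sum_(i | S i) _ * (_ / _).
by field.
Qed.

Lemma PpolyS0 : (Ppoly S).[0] = 1.
Proof. by apply: Ppoly0 => i; rewrite negbK => /eqP. Qed.

Hypothesis sum_le1 : \sum_i alpha i ^+ 2 <= 1.

(** At lam_i the residue of G is - lam_i^2 alpha_i^2; the slope of G at infinity
    is 1 - sum alpha_i^2. *)
Lemma nev_green : nevanlinna ('X * Ppoly S) (Wpoly S).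
Proof.
have P0 : Ppoly S != 0.
  apply/eqP => P0; have := PpolyS0; rewrite P0 horner0 => /esym/eqP.
  by rewrite oner_eq0.
split; first by exists [seq lam i | i <- enum S]; apply: root_seq_Wpoly.
- move=> x /root_Wpoly[i Si ->]; rewrite hornerM hornerX horner_Ppoly_lam //.
  rewrite horner_deriv_Wpoly //; set w := (Wpoly _).[_].
  have -> : lam i * (alpha i ^+ 2 * w) * (- (lam i)^-1 * w) = - (alpha i * w) ^+ 2.
    by field.
  by rewrite oppr_lt0 exprn_even_gt0 //= mulf_neq0 // Wpoly_D1_neq0.
- by rewrite mulrC size_mulX // ltnS Ppoly_size.
- rewrite coefXM size_Wpoly /= -[#|S|]/(#|S|.+1.-1) -size_Wpoly Ppoly_top.
  by rewrite -mulrA -expr2 mulr_ge0 ?sqr_ge0 // subr_ge0.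
Qed.

Lemma nev_green_recip : nevanlinna (- Wpoly S) ('X * Ppoly S).
Proof.
apply: nev_recip nev_green _; rewrite mulf_neq0 ?polyX_eq0 //.
by apply/eqP => P0; have := PpolyS0; rewrite P0 horner0 => /esym/eqP; rewrite oner_eq0.
Qed.

Lemma root_XPpoly x : root ('X * Ppoly S) x = (x == 0) || root (Ppoly S) x.
Proof. by rewrite rootM rootE hornerX. Qed.

Lemma root_PpolyS_neq0 x : root (Ppoly S) x -> x != 0.
Proof. by apply: contraTneq => ->; rewrite rootE PpolyS0 oner_eq0. Qed.

Lemma PpolyS_lam_neq0 i : S i -> ~~ root (Ppoly S) (lam i).
Proof.
move=> Si; rewrite rootE horner_Ppoly_lam // mulf_neq0 ?expf_neq0 //.
exact: Wpoly_D1_neq0.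
Qed.

(** Zeros of z P are poles of -1/G, which are separated by zeros of -1/G. *)
Lemma zero_separation x y : root ('X * Ppoly S) x -> root ('X * Ppoly S) y ->
  x < y -> exists2 i, S i & x < lam i < y.
Proof.
move=> rx ry xy; have [t ht] := nev_interlace nev_green_recip rx ry xy.
by rewrite rootN => /root_Wpoly[i Si e]; exists i; rewrite -?e.
Qed.

Lemma lam_separation i k : S i -> S k -> (i < k)%N ->
  exists2 x, lam i < x < lam k & root ('X * Ppoly S) x.
Proof.
move=> Si Sk ik; apply: (nev_interlace nev_green).
- by apply/root_Wpoly; exists i.
- by apply/root_Wpoly; exists k.
- exact: lam_mono.
Qed.

(** All the conditions follow from a factorization P = pp * pm with pp carrying
    the signs of the alpha_i, and pp, pm vanishing together at the lam_i. *)
Lemma factorization_necessary (pp pm : {poly R}) :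
  pp * pm = Ppoly predT -> 0 < pp.[0] ->
  (forall i, exists2 c, 0 < c & alpha i = c * pp.[lam i]) ->
  (forall i, root pp (lam i) -> root pm (lam i)) ->
  [/\ forall j, alpha j = 0 -> G lam alpha (lam j) = 0,
      forall i j k, j = i.+1 :> nat -> k = j.+1 :> nat ->
        alpha j = 0 -> alpha i * alpha k < 0
    & in_T lam alpha].
Proof.
move=> ppm pp0 ha hpm; rewrite Ppoly_all in ppm.
have rpp i : alpha i = 0 -> root pp (lam i).
  move=> a0; have [c c0] := ha i; rewrite a0 => /esym/eqP.
  by rewrite mulf_eq0 gt_eqF.
have WTj j : alpha j = 0 -> root (Wpoly T) (lam j).
  by move=> aj; apply/root_Wpoly; exists j => //; apply/eqP.
have PSj j : alpha j = 0 -> root (Ppoly S) (lam j).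
  move=> aj; have rp := rpp _ aj; have rm := hpm _ rp.
  have := congr1 (fun p : {poly R} => p^`().[lam j]) ppm.
  rewrite /= !derivM !hornerD !hornerM (rootP rp) (rootP rm) (rootP (WTj _ aj)).
  rewrite !(mulr0, mul0r, addr0) => /esym/eqP; rewrite mulf_eq0.
  by rewrite (negbTE (root_seq_simple (root_seq_Wpoly T) (WTj _ aj))).
have rootpp x : root pp x -> (exists2 i, alpha i = 0 & x = lam i) \/ root (Ppoly S) x.
  move=> rx; have : root (Wpoly T * Ppoly S) x by rewrite -ppm rootM rx.
  rewrite rootM => /orP[/root_Wpoly[i /eqP Ti ->]|]; last by right.
  by left; exists i.
have rootpp' x : root pp x -> root ('X * Ppoly S) x.
  by rewrite root_XPpoly => /rootpp[[i /PSj ? ->]|->]; rewrite ?orbT //; apply/orP; right.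
have G0 j : alpha j = 0 -> G lam alpha (lam j) = 0.
  move=> aj; rewrite G_Ppoly ?(rootP (PSj _ aj)) ?mulr0 ?mul0r // => i Si.
  by apply: contraTneq Si => /lam_inj <-; rewrite /S negbK aj.
split => //.
- move=> i j k ji kj aj.
  have ij : (i < j)%N by rewrite ji.
  have jk : (j < k)%N by rewrite kj.
  have none x y : root ('X * Ppoly S) x -> root ('X * Ppoly S) y -> x < y ->
      lam i <= x -> y <= lam k -> x < lam j < y.
    move=> rx ry xy ix yk; have [t St /andP[xt ty]] := zero_separation rx ry xy.
    have it : (i < t)%N by rewrite -lam_lt (le_lt_trans ix).
    have tk : (t < k)%N by rewrite -lam_lt (lt_le_trans ty).
    suff -> : j = t by rewrite xt.
    by apply: val_inj; apply/eqP; rewrite eqn_leq /= {1}ji it -ltnS -kj.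
  have Xj : root ('X * Ppoly S) (lam j) by rewrite root_XPpoly PSj ?orbT.
  have ai : alpha i != 0.
    apply/eqP => /PSj ri; have := none (lam i) (lam j).
    rewrite Xj root_XPpoly ri orbT !lam_lt ltnn andbF => /(_ isT isT ij (lexx _)).
    by rewrite ltW ?lam_lt // => /(_ isT).
  have ak : alpha k != 0.
    apply/eqP => /PSj rk; have := none (lam j) (lam k).
    rewrite Xj root_XPpoly rk orbT !lam_lt ltnn => /(_ isT isT jk).
    by rewrite ltW ?lam_lt // => /(_ isT (lexx _)).
  have [c c0 ->] := ha i; have [d d0 ->] := ha k.
  have -> : c * pp.[lam i] * (d * pp.[lam k]) = (c * d) * (pp.[lam i] * pp.[lam k]) by ring.
  rewrite pmulr_rlt0 ?mulr_gt0 //.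
  apply: (@horner_sign_change _ pp _ _ (lam j)).
  + by rewrite !lam_lt ij.
  + exact: rpp.
  + have rp := rpp _ aj; have rm := hpm _ rp.
    have := congr1 (fun p : {poly R} => p^`()^`().[lam j]) ppm.
    rewrite /= (deriv2_mul_root rp rm) (deriv2_mul_root (WTj _ aj) (PSj _ aj)) => e.
    have : (pp^`().[lam j] * pm^`().[lam j]) *+ 2 != 0.
      rewrite e mulrn_eq0 /= mulf_neq0 //.
        exact: (root_seq_simple (root_seq_Wpoly T) (WTj _ aj)).
      have := nev_deriv_neq0 nev_green_recip Xj.
      rewrite derivM derivX mul1r hornerD hornerM hornerX (rootP (PSj _ aj)) add0r.
      by rewrite mulf_eq0 negb_or => /andP[].
    by rewrite mulrn_eq0 /= mulf_eq0 negb_or => /andP[].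
  + move=> t /andP[it tk] /rootpp' rt; apply/eqP; apply: contraT => tj.
    move: tj; rewrite neq_lt => /orP[tj|jt].
      by have := none _ _ rt Xj tj it (ltW (lam_mono jk)); rewrite ltxx andbF.
    by have := none _ _ Xj rt jt (ltW (lam_mono ij)) tk; rewrite ltxx.
- split => //.
  (* The index j0 of the class T is the number of negative lam_i. *)
  pose Q n := [forall i : 'I_N, (n <= i)%N ==> (0 < lam i)].
  have exQ : exists n, Q n.
    by exists N; apply/forallP => i; rewrite leqNgt ltn_ord.
  have [j0 Qj0 min] := ex_minnP exQ.
  have pos_ge i : (j0 <= i)%N -> 0 < lam i.
    by move=> ji; have /forallP/(_ i) := Qj0; rewrite ji.
  have neg_lt i : (i < j0)%N -> lam i < 0.
    move=> ij; rewrite lt_neqAle lam_neq0 /= leNgt; apply/negP => li.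
    suff /min : Q i by rewrite leqNgt ij.
    apply/forallP => k; apply/implyP; rewrite leq_eqVlt => /predU1P[e|ik].
      by rewrite -(val_inj e).
    by rewrite (lt_trans li) // lam_mono.
  exists j0; first by apply: min; apply/forallP => i; rewrite leqNgt ltn_ord.
  have X0 : root ('X * Ppoly S) 0 by rewrite root_XPpoly eqxx.
  move=> i; split => [ij|ij].
    have li : lam i < 0 by apply: neg_lt; rewrite -ij.
    split=> //; have [c c0 ->] := ha i; rewrite pmulr_rgt0 //.
    have : 0 < pp.[lam i] * pp.[0].
      apply: horner_same_sign => [|t /andP[it t0]]; first exact: ltW.
      apply/negP => rt; have : t != 0.
        by apply: contraTneq rt => ->; rewrite rootE gt_eqF.
      move=> tn0; have tlt0 : t < 0 by rewrite lt_neqAle tn0.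
      have [k Sk /andP[tk k0]] := zero_separation (rootpp' _ rt) X0 tlt0.
      have : (i < k)%N by rewrite -lam_lt (le_lt_trans it).
      rewrite -ltnS in ij *; rewrite leqNgt ltnS ij -ltnNge => kj.
      by have := pos_ge k; rewrite -ltnS kj => /(_ isT); rewrite ltNge ltW.
    by rewrite pmulr_lgt0.
  have li : 0 < lam i by apply: pos_ge; rewrite ij.
  split=> //; have [c c0 ->] := ha i; rewrite pmulr_rgt0 //.
  have : 0 < pp.[0] * pp.[lam i].
    apply: horner_same_sign => [|t /andP[t0 ti]]; first exact: ltW.
    apply/negP => rt; have : t != 0.
      by apply: contraTneq rt => ->; rewrite rootE gt_eqF.
    move=> tn0; have tgt0 : 0 < t by rewrite lt_neqAle eq_sym tn0.
    have [k Sk /andP[k0 kt]] := zero_separation X0 (rootpp' _ rt) tgt0.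
    have : (k < i)%N by rewrite -lam_lt (lt_le_trans kt).
    by rewrite ij => /neg_lt; rewrite ltNge ltW.
  by rewrite pmulr_rgt0.
Qed.

End Data.

(** * Sharing the poles between the two half-lines *)

Section HalfPairs.
Context {R : realType}.
Implicit Types (p : {poly R}) (s : seq R) (x : R).

(** For p with simple roots x in s, this is the q with
    q / p = 1/2 + sum r_x z / (z - x), the form of slope over value for the
    solution on a half-line. *)
Definition half_partner p s (r : R -> R) : {poly R} :=
  (2^-1)%:P * p + \sum_(x <- s) (r x)%:P * ('X * (p %/ ('X - x%:P))).

Lemma horner_divX_other p x y : root p x -> root p y -> x != y ->
  (p %/ ('X - x%:P)).[y] = 0.
Proof.
move=> rx /rootP ry xy; move: ry; rewrite {1}(divX_root rx) hornerM hornerXsubC.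
by move/eqP; rewrite mulf_eq0 subr_eq0 [y == x]eq_sym (negbTE xy) orbF => /eqP.
Qed.

Lemma nev_half_partner p s (r : R -> R) (q := half_partner p s r) :
  root_seq p s -> p.[0] != 0 -> (forall x, x \in s -> 0 < r x) ->
  [/\ nevanlinna (- q) ('X * p), (size q <= size p)%N & q.[0] = p.[0] / 2].
Proof.
move=> h p0 rpos; have [us rs sz] := h; have pn0 := root_seq_neq0 h.
have s0 : 0 \notin s by rewrite (mem_root_seq _ h) rootE.
have q0 : q.[0] = p.[0] / 2.
  rewrite /q /half_partner hornerD hornerM hornerC horner_sum big1; first by rewrite addr0 mulrC.
  by move=> x _; rewrite !hornerM hornerX mul0r mulr0.
have sq : (size q <= size p)%N.
  rewrite /q (leq_trans (size_polyD _ _)) // geq_max mul_polyC size_scale_leq /=.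
  rewrite (leq_trans (size_sum _ _ _)) //; apply/bigmax_leqP_seq => x xs _.
  rewrite mul_polyC (leq_trans (size_scale_leq _ _)) //.
  rewrite (leq_trans (size_polyMleq _ _)) // size_polyX.
  by rewrite size_divp ?polyXsubC_eq0 // size_XsubC sz subSS subn0.
have qx x : x \in s -> q.[x] = r x * x * p^`().[x].
  move=> xs; have px := allP rs _ xs.
  rewrite /q /half_partner hornerD hornerM (rootP px) mulr0 add0r horner_sum.
  rewrite (bigD1_seq x) //= !hornerM hornerC hornerX horner_deriv_divX //.
  rewrite big1_seq ?addr0 ?mulrA // => y /andP[yx ys].
  by rewrite !hornerM horner_divX_other ?mulr0 //; apply: allP rs _ _.
have szX : size ('X * p) = (size p).+1 by rewrite mulrC size_mulX.
clearbody q; split => //; split.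
- exists (0 :: s); split; first by rewrite /= s0.
    rewrite /= rootM rootE hornerX eqxx /=; apply: sub_all rs => x.
    by rewrite rootM => ->; rewrite orbT.
  by rewrite szX sz.
- move=> x; rewrite rootM [root 'X _]rootE hornerX hornerN derivM derivX mul1r.
  rewrite !(hornerD, hornerM, hornerX) => /orP[/eqP ->|px].
    rewrite q0 mul0r addr0.
    have -> : - (p.[0] / 2) * p.[0] = - (p.[0] ^+ 2 / 2) by field.
    by rewrite oppr_lt0 divr_gt0 // exprn_even_gt0.
  have xs : x \in s by rewrite (mem_root_seq _ h).
  rewrite qx // (rootP px) add0r.
  have -> : - (r x * x * p^`().[x]) * (x * p^`().[x]) = - (r x * (x * p^`().[x]) ^+ 2).
    by ring.
  rewrite oppr_lt0 mulr_gt0 ?rpos // exprn_even_gt0 //= mulf_neq0 //.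
    by apply: contraNneq s0 => <-.
  exact: root_seq_simple h px.
- by rewrite size_polyN szX (leq_trans sq) // leqW.
- by rewrite nth_default ?mul0r // size_polyN szX leqW.
Qed.

Lemma divX_mulr p t x : root p x -> (t * p) %/ ('X - x%:P) = t * (p %/ ('X - x%:P)).
Proof. by move=> px; rewrite {1}(divX_root px) mulrA mulpK // polyXsubC_eq0. Qed.

Lemma prod_zero_factor s : all (fun x => x != 0) s ->
  \prod_(x <- s) zero_factor x = (\prod_(x <- s) (- x^-1)) *: \prod_(x <- s) ('X - x%:P).
Proof.
elim: s => [|x s IH] /=; first by rewrite !big_nil scale1r.
move=> /andP[x0 s0]; rewrite !big_cons IH // zero_factor_XsubC //.
by rewrite -scalerAl -scalerAr scalerA.
Qed.

Lemma root_seq_zero_factor p s : root_seq p s -> p.[0] = 1 -> p = \prod_(x <- s) zero_factor x.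
Proof.
move=> h p0; have s0 : all (fun x => x != 0) s.
  apply/allP => x; rewrite (mem_root_seq _ h); apply: contraTneq => ->.
  by rewrite rootE p0 oner_eq0.
rewrite prod_zero_factor // {1}(root_seq_prod h); congr (_ *: _).
have e1 : lead_coef p * (\prod_(x <- s) ('X - x%:P)).[0] = 1.
  by rewrite -hornerZ -(root_seq_prod h).
have e2 : \prod_(x <- s) (- x^-1) * (\prod_(x <- s) ('X - x%:P)).[0] = 1.
  rewrite -hornerZ -prod_zero_factor // horner_prod big1 // => x _.
  by rewrite horner_zero_factor mul0r subr0.
apply: (mulIf (_ : (\prod_(x <- s) ('X - x%:P)).[0] != 0)); last by rewrite e1 e2.
by apply: contra_eq_neq e1 => ->; rewrite mulr0 eq_sym oner_neq0.
Qed.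

Lemma root_seq_prod_zero_factor (e : R) s : e != 0 -> uniq s -> all (fun x => x != 0) s ->
  root_seq (e%:P * \prod_(x <- s) zero_factor x) s.
Proof.
move=> e0 us s0; rewrite prod_zero_factor // mul_polyC scalerA.
set c := _ * _; have c0 : c != 0.
  rewrite /c mulf_neq0 // prodf_seq_neq0; apply: sub_all s0 => x x0.
  by rewrite oppr_eq0 invr_eq0.
split => //; last by rewrite size_scale // size_prod_XsubC.
by apply/allP => x xs; rewrite rootZ // root_prod_XsubC.
Qed.

Lemma horner_prod_zero_factor0 (e : R) (s : seq R) : (e%:P * \prod_(x <- s) zero_factor x).[0] = e.
Proof.
rewrite hornerM hornerC horner_prod big1 ?mulr1 // => x _.
by rewrite horner_zero_factor mul0r subr0.
Qed.

End HalfPairs.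

Section Splitting.
Context {R : realType} {N : nat}.
Variables (lam alpha : 'I_N -> R).
Implicit Types (i j k : 'I_N) (x y t : R).
Let S i := alpha i != 0.
Let T i := alpha i == 0.
Hypothesis lam_mono : forall i j, (i < j)%N -> lam i < lam j.
Hypothesis lam_neq0 : forall i, lam i != 0.
Hypothesis sum_le1 : \sum_i alpha i ^+ 2 <= 1.

Let WS := Wpoly lam S.
Let WT := Wpoly lam T.
Let PS := Ppoly lam alpha S.

Lemma Wpoly_all : Wpoly lam predT = WT * WS.
Proof. by rewrite /Wpoly (bigID T). Qed.

Lemma PpolyS_root_seq : exists Z, root_seq PS Z.
Proof.
have [[s hs] _ _ _] := nev_green_recip lam_mono lam_neq0 sum_le1.
have P0 : PS.[0] = 1 by apply: PpolyS0.
by exists (rem 0 s); apply: root_seq_mulX => //; rewrite -/PS P0 oner_eq0.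
Qed.

(** The expansion of -1/G = - W / (z P) in partial fractions, multiplied by -z P.
    The pole at 0 of -1/G has residue -1 and produces the term P. *)
Lemma data_expansion Z : root_seq PS Z -> exists v om (r : R -> R),
  [/\ 0 <= v, forall x, x \in Z -> 0 < r x &
   WS = PS - (om%:P * 'X + v%:P * 'X^2) * PS
      + \sum_(x <- Z) (r x)%:P * ('X * (PS %/ ('X - x%:P)))].
Proof.
move=> hZ; have hR := nev_green_recip lam_mono lam_neq0 sum_le1.
have P0 : PS.[0] = 1 by apply: PpolyS0.
have W0 : WS.[0] = 1 by apply: Wpoly0.
rewrite -/WS -/PS in hR; clearbody WS PS.
have [us rs sz] := hZ; have PSn0 := root_seq_neq0 hZ.
have Z0 : 0 \notin Z by rewrite (mem_root_seq _ hZ) rootE P0 oner_eq0.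
have h : root_seq ('X * PS) (0 :: Z).
  split; first by rewrite /= Z0.
    rewrite /= rootM rootE hornerX eqxx /=; apply: sub_all rs => x.
    by rewrite rootM => ->; rewrite orbT.
  by rewrite mulrC size_mulX // sz.
have D0 := root_seq_neq0 h; have [_ _ sN top] := hR.
have [||b eN] := @partial_fractions _ (- WS) ('X * PS) (0 :: Z) h => //.
  by move=> x xs; apply: nev_deriv_neq0 hR _; rewrite -(mem_root_seq _ h).
set a := _ / _ in eN.
exists a, b, (fun x => - ((- WS).[x] / ('X * PS)^`().[x])); split.
- have -> : a = (- WS)`_(size ('X * PS)) * lead_coef ('X * PS) / lead_coef ('X * PS) ^+ 2.
    by rewrite /a; field; rewrite lead_coef_eq0.
  by rewrite divr_ge0 ?sqr_ge0.
- move=> x xZ; rewrite oppr_gt0; apply: nev_ratio_lt0 hR _.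
  by rewrite -(mem_root_seq _ h) inE xZ orbT.
- apply: oppr_inj; rewrite {1}eN big_cons.
  have -> : ('X * PS) %/ ('X - 0%:P) = PS.
    by rewrite polyC0 subr0 mulrC mulpK // polyX_eq0.
  have -> : (- WS).[0] / ('X * PS)^`().[0] = -1.
    rewrite derivM derivX mul1r hornerN W0 !(hornerD, hornerM, hornerX) P0.
    by rewrite mul0r addr0 divr1.
  rewrite (eq_big_seq (fun x => - ((- ((- WS).[x] / ('X * PS)^`().[x]))%:P
      * ('X * (PS %/ ('X - x%:P)))))).
    by rewrite sumrN scaleN1r; ring.
  move=> x xZ; rewrite divX_mulr ?(allP rs) //.
  by rewrite -mul_polyC polyCN mulNr opprK.
Qed.

(** The poles of -1/G are shared between the two sides: Zp and Zm cover the zeros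
    of P_S and overlap exactly in the zeros of W_T, where each side gets half of
    the residue; the constants 1/2 in both partners add up to the term P of the
    expansion. *)
Lemma split_data Z (Zp Zm : pred R) (e e' : R) : root_seq PS Z -> e * e' = 1 ->
  (forall i, alpha i = 0 -> root PS (lam i)) ->
  (forall x, x \in Z -> Zp x || Zm x) ->
  (forall x, x \in Z -> Zp x && Zm x = root WT x) ->
  let pp := e%:P * \prod_(x <- [seq x <- Z | Zp x]) zero_factor x in
  let pm := e'%:P * \prod_(x <- [seq x <- Z | Zm x]) zero_factor x in
  exists om v (qp qm : {poly R}),
  [/\ pp * pm = Ppoly lam alpha predT,
      0 <= v,
      Wpoly lam predT = pp * qm + qp * pm - (om%:P * 'X + v%:P * 'X^2) * (pp * pm),
      [/\ nevanlinna (- qp) ('X * pp), (size qp <= size pp)%N & qp.[0] = e / 2] &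
      [/\ nevanlinna (- qm) ('X * pm), (size qm <= size pm)%N & qm.[0] = e' / 2]].
Proof.
move=> hZ ee' hT hcov hboth pp pm.
have P0 : PS.[0] = 1 by apply: PpolyS0.
have [us rs sz] := hZ.
have Z0 : all (fun x => x != 0) Z.
  apply: sub_all rs => x; apply: contraTneq => ->; by rewrite rootE P0 oner_eq0.
have e0 : e != 0 by apply: contra_eq_neq ee' => ->; rewrite mul0r eq_sym oner_neq0.
have e'0 : e' != 0 by apply: contra_eq_neq ee' => ->; rewrite mulr0 eq_sym oner_neq0.
have filt0 (A : pred R) : all (fun x => x != 0) [seq x <- Z | A x].
  by apply/allP => x; rewrite mem_filter => /andP[_ /(allP Z0)].
have hpp : root_seq pp [seq x <- Z | Zp x].
  by apply: root_seq_prod_zero_factor; rewrite ?filter_uniq.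
have hpm : root_seq pm [seq x <- Z | Zm x].
  by apply: root_seq_prod_zero_factor; rewrite ?filter_uniq.
have pp0 : pp.[0] = e by apply: horner_prod_zero_factor0.
have pm0 : pm.[0] = e' by apply: horner_prod_zero_factor0.
have eWT : WT = \prod_(x <- [seq x <- Z | root WT x]) zero_factor x.
  have hW := root_seq_Wpoly lam_mono lam_neq0 T.
  rewrite {1}/WT (root_seq_zero_factor hW (Wpoly0 _ _)); apply: perm_big.
  apply: uniq_perm; [by case: hW | by rewrite filter_uniq |].
  move=> x; rewrite (mem_root_seq _ hW) mem_filter (mem_root_seq _ hZ) -/WT.
  apply/idP/andP => [rx|[] //]; split => //.
  by move: rx => /(root_Wpoly lam_neq0)[i /eqP Ti ->]; apply: hT.
have eall : pp * pm = WT * PS.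
  rewrite eWT [in RHS](root_seq_zero_factor hZ P0) /pp /pm mulrACA -polyCM ee' mul1r.
  rewrite !big_filter [\prod_(x <- Z | Zp x) _]big_mkcond [\prod_(x <- Z | Zm x) _]big_mkcond.
  rewrite [\prod_(x <- Z | root WT x) _]big_mkcond -!big_split /=.
  apply: eq_big_seq => x xZ; have := hcov x xZ; rewrite -(hboth x xZ).
  by case: (Zp x) (Zm x) => [] [] //= _; rewrite ?mulr1 ?mul1r.
have [v [om [r [v0 rpos eW]]]] := data_expansion hZ.
pose rp x := r x * (if Zm x then 2^-1 else 1).
pose rm x := r x * (if Zp x then 2^-1 else 1).
have halfpos (b : bool) : 0 < (if b then 2^-1 else 1) :> R by case: b.
have [] := @nev_half_partner _ _ _ rp hpp; rewrite ?pp0 //.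
  move=> x; rewrite mem_filter => /andP[_ xZ]; by rewrite mulr_gt0 ?rpos.
have [] := @nev_half_partner _ _ _ rm hpm; rewrite ?pm0 //.
  move=> x; rewrite mem_filter => /andP[_ xZ]; by rewrite mulr_gt0 ?rpos.
set qm := half_partner pm _ _; set qp := half_partner pp _ _ => nm sm vm np sp vp.
exists om, v, qp, qm; split => //; first by rewrite eall Ppoly_all.
have divp x : x \in [seq x <- Z | Zp x] ->
    (pp %/ ('X - x%:P)) * pm = WT * (PS %/ ('X - x%:P)).
  move=> xs; have px : root pp x by rewrite -(mem_root_seq _ hpp).
  rewrite [LHS]mulrC -(divX_mulr _ px) [pm * pp]mulrC eall.
  by rewrite divX_mulr // -(mem_root_seq _ hZ); move: xs; rewrite mem_filter => /andP[].
have divm x : x \in [seq x <- Z | Zm x] ->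
    pp * (pm %/ ('X - x%:P)) = WT * (PS %/ ('X - x%:P)).
  move=> xs; have px : root pm x by rewrite -(mem_root_seq _ hpm).
  rewrite -(divX_mulr _ px) eall.
  by rewrite divX_mulr // -(mem_root_seq _ hZ); move: xs; rewrite mem_filter => /andP[].
have esum : WT * (\sum_(x <- Z) (r x)%:P * ('X * (PS %/ ('X - x%:P)))) =
    pp * (\sum_(x <- [seq x <- Z | Zm x]) (rm x)%:P * ('X * (pm %/ ('X - x%:P))))
  + (\sum_(x <- [seq x <- Z | Zp x]) (rp x)%:P * ('X * (pp %/ ('X - x%:P)))) * pm.
  rewrite !mulr_sumr mulr_suml.
  rewrite [X in _ = X + _](eq_big_seq (fun x => (rm x)%:P * ('X * (WT * (PS %/ ('X - x%:P)))))).
    rewrite [X in _ = _ + X](eq_big_seq (fun x => (rp x)%:P * ('X * (WT * (PS %/ ('X - x%:P)))))).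
      rewrite !big_filter [\sum_(x <- Z | Zp x) _]big_mkcond.
      rewrite [\sum_(x <- Z | Zm x) _]big_mkcond -big_split /=.
      apply: eq_big_seq => x xZ; have := hcov x xZ; rewrite /rp /rm.
      have half : (r x)%:P = (r x * 2^-1)%:P + (r x * 2^-1)%:P :> {poly R}.
        by rewrite -polyCD; congr _%:P; field.
      case: (Zp x) (Zm x) => [] [] //= _; rewrite ?mulr1 ?addr0 ?add0r; last 2 first.
      - by ring.
      - by ring.
      by rewrite {1}half; ring.
    by move=> x /divp <-; ring.
  by move=> x /divm <-; ring.
rewrite Wpoly_all {1}eW mulrDr esum eall /qm /qp /half_partner.
have h2 := polyC_half2 (R := R).
have -> : WT * (PS - (om%:P * 'X + v%:P * 'X^2) * PS) =
  (2^-1)%:P * 2 * (pp * pm) - (om%:P * 'X + v%:P * 'X^2) * (WT * PS).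
  by rewrite h2 eall; ring.
by ring.
Qed.

End Splitting.

(** * Choosing the zeros of the right factor *)

Section Selection.
Context {R : realType} {N : nat}.
Variables (lam alpha : 'I_N -> R).
Implicit Types (i j k : 'I_N) (x y t : R).
Let S i := alpha i != 0.
Let T i := alpha i == 0.
Let WT := Wpoly lam T.
Let PS := Ppoly lam alpha S.

Lemma in_T_lam_neq0 : in_T lam alpha -> forall i, lam i != 0.
Proof.
move=> [mono _ [j0 j0N hj0]] i; have [ij|ji] := ltnP i j0.
  have jN : (j0.-1 < N)%N by rewrite prednK // (leq_ltn_trans _ ij).
  have [/(_ (prednK (leq_ltn_trans (leq0n i) ij)))[neg _] _] := hj0 (Ordinal jN).
  suff : lam i < 0 by move=> /lt_eqF ->.
  have : (i <= j0.-1)%N by rewrite -ltnS prednK // (leq_ltn_trans _ ij).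
  rewrite leq_eqVlt => /predU1P[e|lt]; last exact: lt_trans (mono _ (Ordinal jN) lt) neg.
  by have -> : i = Ordinal jN by apply: val_inj.
have jN : (j0 < N)%N by rewrite (leq_ltn_trans ji).
have [_ /(_ erefl)[pos _]] := hj0 (Ordinal jN).
suff : 0 < lam i by move=> /gt_eqF ->.
move: ji; rewrite leq_eqVlt => /predU1P[e|lt]; last exact: lt_trans pos (mono (Ordinal jN) _ lt).
by have -> : i = Ordinal jN by apply: val_inj.
Qed.

Hypothesis hT : in_T lam alpha.
Hypothesis hG : forall j, alpha j = 0 -> G lam alpha (lam j) = 0.
Hypothesis hsgn : forall i j k, j = i.+1 :> nat -> k = j.+1 :> nat ->
  alpha j = 0 -> alpha i * alpha k < 0.

Let lam_mono : forall i j, (i < j)%N -> lam i < lam j := let: And3 h _ _ := hT in h.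
Let lam_neq0 : forall i, lam i != 0 := in_T_lam_neq0 hT.
Let sum_le1 : \sum_i alpha i ^+ 2 <= 1 := let: And3 _ h _ := hT in h.

Lemma PpolyS_root_lam i : alpha i = 0 -> root PS (lam i).
Proof.
move=> ai; have xl k : S k -> lam i != lam k.
  by apply: contraTneq => /(lam_inj lam_mono) <-; rewrite /S ai eqxx.
have := hG ai; rewrite (G_Ppoly lam_neq0 xl) => /eqP.
rewrite !mulf_eq0 (negbTE (lam_neq0 i)) invr_eq0 /= => /orP[//|].
by rewrite -rootE => /(root_Wpoly lam_neq0)[k Sk e]; have := xl k Sk; rewrite e eqxx.
Qed.

(** Consecutive among the indices with nonzero alpha. *)
Definition consecutive i k :=
  [&& S i, S k, (i < k)%N & [forall t, S t ==> ~~ (i < t < k)%N]].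

(** x lies in a gap where p_+ has to change sign. *)
Definition sign_gap x :=
  [exists i, exists k, [&& consecutive i k, lam i < x < lam k & alpha i * alpha k < 0]].

Lemma consecutiveP i k (t : 'I_N) : consecutive i k -> S t -> (i < t < k)%N -> False.
Proof. by move=> /and4P[_ _ _ /forallP/(_ t)/implyP h] /h/negP. Qed.

Lemma consecutive_root_unique i k x y : consecutive i k ->
  root ('X * PS) x -> root ('X * PS) y -> lam i < x < lam k -> lam i < y < lam k -> x = y.
Proof.
move=> ck; wlog xy : x y / x < y.
  move=> h rx ry hx hy; have [xy|yx|//] := ltgtP x y; first exact: h.
  by apply/esym; apply: h.
move=> rx ry /andP[ix _] /andP[_ yk].
have [t St /andP[xt ty]] := zero_separation lam_mono lam_neq0 sum_le1 rx ry xy.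
by case: (consecutiveP ck St); rewrite -!(lam_lt lam_mono) (lt_trans ix) // (lt_trans ty).
Qed.

(** Interlacing provides a zero of z P in the gap.  It is not 0, because the two
    neighbours of 0 have positive alpha. *)
Lemma consecutive_neg_root i k : consecutive i k -> alpha i * alpha k < 0 ->
  exists2 x, lam i < x < lam k & root PS x.
Proof.
move=> ck neg; have /and4P[Si Sk ik _] := ck.
have [x hx] := lam_separation lam_mono lam_neq0 sum_le1 Si Sk ik.
rewrite root_XPpoly => /orP[/eqP x0|rx]; last by exists x.
move: hx; rewrite x0 => /andP[li lk]; case: hT => _ _ [j0 j0N hj0].
have ij : (i < j0)%N.
  rewrite ltnNge; apply/negP => ji.
  have jN : (j0 < N)%N by rewrite (leq_ltn_trans ji).
  have [_ /(_ erefl)[pos _]] := hj0 (Ordinal jN).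
  have : lam (Ordinal jN) <= lam i by rewrite leNgt (lam_lt lam_mono) /= -leqNgt.
  by rewrite leNgt (lt_trans li).
have jk : (j0 <= k)%N.
  rewrite leqNgt; apply/negP => kj.
  have jN : (j0.-1 < N)%N by rewrite prednK // (leq_ltn_trans _ ij).
  have [/(_ (prednK (leq_ltn_trans (leq0n i) ij)))[ng _] _] := hj0 (Ordinal jN).
  have : lam k <= lam (Ordinal jN).
    by rewrite leNgt (lam_lt lam_mono) /= -leqNgt -ltnS prednK // (leq_ltn_trans _ ij).
  by rewrite leNgt (lt_trans ng).
have jN1 : (j0.-1 < N)%N by rewrite prednK // (leq_ltn_trans _ ij).
have jN2 : (j0 < N)%N by rewrite (leq_ltn_trans jk).
have [/(_ (prednK (leq_ltn_trans (leq0n i) ij)))[_ a1] _] := hj0 (Ordinal jN1).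
have [_ /(_ erefl)[_ a2]] := hj0 (Ordinal jN2).
have ei : i = Ordinal jN1.
  apply: val_inj; apply/eqP; rewrite eqn_leq /= -[X in (X <= _)%N && _]/(val i).
  apply/andP; split; first by rewrite -ltnS prednK // (leq_ltn_trans _ ij).
  rewrite leqNgt; apply/negP => ij1; apply: (consecutiveP ck (t := Ordinal jN1)).
    by rewrite /S gt_eqF.
  by rewrite /= ij1 prednK // (leq_ltn_trans _ ij).
have ek : k = Ordinal jN2.
  apply: val_inj; apply/eqP; rewrite eqn_leq /= jk andbT leqNgt.
  apply/negP => kj; apply: (consecutiveP ck (t := Ordinal jN2)).
    by rewrite /S gt_eqF.
  by rewrite /= kj ij.
by move: neg; rewrite {1}ei ek ltNge (mulr_ge0 (ltW a1) (ltW a2)).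
Qed.

Lemma sign_gap_consecutive i k x : consecutive i k -> lam i < x < lam k ->
  sign_gap x -> alpha i * alpha k < 0.
Proof.
move=> ck /andP[ix xk] /existsP[i' /existsP[k' /and3P[ck' /andP[ix' xk'] neg]]].
have /and4P[Si Sk ik _] := ck; have /and4P[Si' Sk' ik' _] := ck'.
have i'k : (i' < k)%N by rewrite -(lam_lt lam_mono) (lt_trans ix').
have ik2 : (i < k')%N by rewrite -(lam_lt lam_mono) (lt_trans ix).
have -> : i = i'.
  apply: val_inj; case: (ltngtP i i') => //= h.
    by case: (consecutiveP ck Si'); rewrite h i'k.
  by case: (consecutiveP ck' Si); rewrite h ik2.
suff -> : k = k' by [].
apply: val_inj; case: (ltngtP k k') => //= h.
  by case: (consecutiveP ck' Sk); rewrite i'k h.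
by case: (consecutiveP ck Sk'); rewrite h ik2.
Qed.

(** Condition (ii) makes j-1 and j+1 the neighbours of j with nonzero alpha. *)
Lemma node_gap_consecutive i j k : consecutive i k -> alpha j = 0 ->
  (i < j < k)%N -> alpha i * alpha k < 0.
Proof.
move=> ck aj /andP[ij jk]; have /and4P[Si Sk ik _] := ck.
have jN1 : (j.-1 < N)%N by rewrite (leq_ltn_trans (leq_pred _)).
have jN2 : (j.+1 < N)%N by rewrite (leq_ltn_trans jk).
have j0 : (0 < j)%N by rewrite (leq_ltn_trans _ ij).
have neg := @hsgn (Ordinal jN1) j (Ordinal jN2) (esym (prednK j0)) erefl aj.
have S1 : S (Ordinal jN1).
  by apply: contraTN neg => /eqP ->; rewrite mul0r ltxx.
have S2 : S (Ordinal jN2).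
  by apply: contraTN neg => /eqP ->; rewrite mulr0 ltxx.
have -> : i = Ordinal jN1.
  apply: val_inj; case: (ltngtP i (Ordinal jN1)) => //= h.
    by case: (consecutiveP ck S1); rewrite /= h (leq_ltn_trans (leq_pred _)).
  by move: ij; rewrite ltnNge -ltnS -(prednK j0) ltnS h.
suff -> : k = Ordinal jN2 by [].
apply: val_inj; case: (ltngtP k (Ordinal jN2)) => //= h.
  by move: jk; rewrite ltnNge -ltnS h.
by case: (consecutiveP ck S2); rewrite /= h (ltn_trans ij).
Qed.

Section SelectedPolynomial.
Variables (Z : seq R) (e : R).
Hypothesis hZ : root_seq PS Z.
Hypothesis e0 : 0 < e.

Definition chosen x := root WT x || sign_gap x.

(** The candidate for p_+.  Outside the range of the lam_i with nonzero alpha the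
    choice is free, and such a zero is given to p_- alone unless it is shared. *)
Definition selected := e%:P * \prod_(x <- [seq x <- Z | chosen x]) zero_factor x.

Lemma root_seq_selected : root_seq selected [seq x <- Z | chosen x].
Proof.
have [us rs _] := hZ; apply: root_seq_prod_zero_factor; rewrite ?gt_eqF ?filter_uniq //.
apply/allP => x; rewrite mem_filter => /andP[_ /(allP rs)].
exact: root_PpolyS_neq0.
Qed.

Lemma root_selected x : root selected x = root PS x && chosen x.
Proof. by rewrite -(mem_root_seq _ root_seq_selected) mem_filter (mem_root_seq _ hZ) andbC. Qed.

(** A gap contains at most one zero of P_S, and it is selected exactly when the
    two alpha have opposite signs. *)
Lemma selected_consecutive i k : consecutive i k ->
  (0 < selected.[lam i] * alpha i) = (0 < selected.[lam k] * alpha k).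
Proof.
move=> ck; have /and4P[Si Sk ik _] := ck.
have lik : lam i < lam k by apply: lam_mono.
have inner t : lam i <= t <= lam k -> root selected t ->
    [/\ lam i < t < lam k, root PS t & chosen t].
  move=> /andP[it tk]; rewrite root_selected => /andP[rt ct]; split => //.
  rewrite !lt_neqAle it tk !andbT; apply/andP; split.
    by apply: contraTneq rt => <-; apply: PpolyS_lam_neq0.
  by apply: contraTneq rt => ->; apply: PpolyS_lam_neq0.
have Si' : alpha i != 0 by []. have Sk' : alpha k != 0 by [].
have sgn_id : (selected.[lam i] * alpha i) * (selected.[lam k] * alpha k) =
  (selected.[lam i] * selected.[lam k]) * (alpha i * alpha k) by ring.
suff : 0 < (selected.[lam i] * alpha i) * (selected.[lam k] * alpha k).
  move=> h; apply/idP/idP => h1; first by rewrite pmulr_rgt0 in h.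
  by rewrite pmulr_lgt0 in h.
rewrite sgn_id.
have [neg|pos|/eqP] := ltgtP (alpha i * alpha k) 0; last first.
- by rewrite mulf_eq0 (negbTE Si') (negbTE Sk').
- rewrite pmulr_lgt0 //; apply: horner_same_sign => [|t ht]; first exact: ltW.
  apply/negP => /(inner t ht)[htt rt /orP[]].
    move=> /(root_Wpoly lam_neq0)[j /eqP aj tj].
    have /(node_gap_consecutive ck aj) : (i < j < k)%N.
      by rewrite -!(lam_lt lam_mono) -tj.
    by rewrite ltNge (ltW pos).
  by move=> /(sign_gap_consecutive ck htt); rewrite ltNge (ltW pos).
- rewrite nmulr_lgt0 //; have [x hx rx] := consecutive_neg_root ck neg.
  have sx : root selected x.
    rewrite root_selected rx /chosen; apply/orP; right.
    by apply/existsP; exists i; apply/existsP; exists k; rewrite ck hx neg.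
  apply: (horner_sign_change hx sx); first exact: root_seq_simple root_seq_selected sx.
  move=> t ht /(inner t ht)[htt rt _].
  by apply: (consecutive_root_unique ck) => //; rewrite root_XPpoly ?rt ?rx orbT.
Qed.

Lemma selected_propagates i k : S i -> S k -> (i < k)%N ->
  (0 < selected.[lam i] * alpha i) = (0 < selected.[lam k] * alpha k).
Proof.
move: {2}(k - i)%N (leqnn (k - i)) => n.
elim: n i k => [|n IH] i k kin Si Sk ik.
  by move: kin; rewrite leqn0 subn_eq0 leqNgt ik.
have [ck|] := boolP (consecutive i k); first exact: selected_consecutive.
rewrite /consecutive Si Sk ik /= negb_forall => /existsP[t].
rewrite negb_imply negbK => /and3P[St it tk].
rewrite (IH i t) ?(IH t k) //.
  by rewrite -ltnS (leq_trans _ kin) // ltn_sub2l.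
by rewrite -ltnS (leq_trans _ kin) // ltn_sub2r.
Qed.

Lemma selected0 : selected.[0] = e.
Proof. exact: horner_prod_zero_factor0. Qed.

(** The signs agree at the index next to 0, because no selected zero separates
    the corresponding lam from 0, where the value is e > 0; they then propagate
    from gap to gap. *)
Lemma selected_sign i : S i -> 0 < selected.[lam i] * alpha i.
Proof.
have rootX t : root selected t -> root ('X * PS) t /\ t != 0.
  rewrite root_selected root_XPpoly => /andP[rt _]; rewrite rt orbT.
  by split=> //; apply: root_PpolyS_neq0 rt.
have X0 : root ('X * PS) 0 by rewrite root_XPpoly eqxx.
have [i0 S0 base] : exists2 i0, S i0 & 0 < selected.[lam i0] * alpha i0.
  case: hT => _ _ [[|j0] j0N hj0].
    have N0 : (0 < N)%N by rewrite (leq_ltn_trans _ (ltn_ord i)).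
    have [_ /(_ erefl)[li ai]] := hj0 (Ordinal N0).
    exists (Ordinal N0); first by rewrite /S gt_eqF.
    rewrite mulr_gt0 // -(pmulr_rgt0 _ e0) -selected0.
    apply: horner_same_sign => [|t /andP[t0 ti]]; first exact: ltW.
    apply/negP => /rootX[rt tn0]; have tgt0 : 0 < t by rewrite lt_neqAle eq_sym tn0.
    have [k Sk /andP[_ kt]] := zero_separation lam_mono lam_neq0 sum_le1 X0 rt tgt0.
    by have := lt_le_trans kt ti; rewrite (lam_lt lam_mono) ltn0.
  have [/(_ erefl)[li ai] _] := hj0 (Ordinal j0N).
  exists (Ordinal j0N); first by rewrite /S gt_eqF.
  rewrite mulr_gt0 // -(pmulr_lgt0 _ e0) -selected0.
  apply: horner_same_sign => [|t /andP[it t0]]; first exact: ltW.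
  apply/negP => /rootX[rt tn0]; have tlt0 : t < 0 by rewrite lt_neqAle tn0.
  have [k Sk /andP[tk k0]] := zero_separation lam_mono lam_neq0 sum_le1 rt X0 tlt0.
  have jk : (j0 < k)%N by have := le_lt_trans it tk; rewrite (lam_lt lam_mono).
  have jN : (j0.+1 < N)%N by rewrite (leq_ltn_trans jk).
  have [_ /(_ erefl)[pos _]] := hj0 (Ordinal jN).
  have : lam (Ordinal jN) <= lam k by rewrite leNgt (lam_lt lam_mono) /= -leqNgt.
  by rewrite leNgt (lt_trans k0).
move=> Si; case: (ltngtP i i0) => [h|h|/val_inj ->//].
  by rewrite (selected_propagates Si S0 h).
by rewrite -(selected_propagates S0 Si h).
Qed.

End SelectedPolynomial.

(** The polynomial side of sufficiency: a factorization P = pp * pm with the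
    right signs, slopes qp and qm that solve the two half-line problems, and the
    mass (om, v) at a. *)
Lemma factorization_exists (e e' : R) : 0 < e -> e * e' = 1 ->
  exists om v (pp pm qp qm : {poly R}),
  [/\ [/\ pp * pm = Ppoly lam alpha predT, 0 <= v,
        Wpoly lam predT = pp * qm + qp * pm - (om%:P * 'X + v%:P * 'X^2) * (pp * pm)
      & forall i, alpha i != 0 -> 0 < pp.[lam i] * alpha i],
      [/\ nevanlinna (- qp) ('X * pp), (size qp <= size pp)%N, pp.[0] = e & qp.[0] = e / 2] &
      [/\ nevanlinna (- qm) ('X * pm), (size qm <= size pm)%N, pm.[0] = e' & qm.[0] = e' / 2]].
Proof.
move=> e0 ee'.
have [Z hZ] := PpolyS_root_seq lam_mono lam_neq0 sum_le1.
have cov x : x \in Z -> chosen x || (root WT x || ~~ sign_gap x).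
  by move=> _; rewrite /chosen; case: root; case: sign_gap.
have both x : x \in Z -> chosen x && (root WT x || ~~ sign_gap x) = root WT x.
  by move=> _; rewrite /chosen; case: root; case: sign_gap.
have [om [v [qp [qm [h1 v0 h2 [np sp vp] [nm sm vm]]]]]] :=
  split_data lam_mono lam_neq0 sum_le1 hZ ee' PpolyS_root_lam cov both.
exists om, v, (selected Z e),
  (e'%:P * \prod_(x <- [seq x <- Z | root WT x || ~~ sign_gap x]) zero_factor x), qp, qm.
have s0 : (selected Z e).[0] = e by apply: horner_prod_zero_factor0.
by split; split; rewrite ?horner_prod_zero_factor0 // => i; apply: selected_sign.
Qed.

End Selection.

(** * Solutions on an interval free of masses *)

Section ExponentialSolutions.
Local Open Scope classical_set_scope.
Local Open Scope complex_scope.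
Context {R : realType}.
Implicit Types (a b x y : R) (A B : R[i]).

Definition rexp a b x : R := a * expR (x / 2) + b * expR (- (x / 2)).

Lemma is_derive_expR_scale (c x : R) :
  is_derive x 1 (fun t => expR (c * t)) (c * expR (c * x)).
Proof.
have h1 := is_deriveZ c (is_derive_id x (1 : R)).
have h2 := is_derive1_comp (is_derive_expR (c * x)) h1.
by apply: (is_derive_eq h2); rewrite [RHS]mulrC /GRing.scale /= mulr1.
Qed.

Lemma rexpE a b : rexp a b = fun x => a * expR (2^-1 * x) + b * expR (- 2^-1 * x).
Proof. by apply/funext => x; rewrite /rexp mulNr [_ / 2]mulrC. Qed.

Lemma is_derive_rexp a b x : is_derive x 1 (rexp a b) (rexp (a / 2) (- (b / 2)) x).
Proof.
rewrite !rexpE.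
have h1 := is_deriveZ a (is_derive_expR_scale 2^-1 x).
have h2 := is_deriveZ b (is_derive_expR_scale (- 2^-1) x).
apply: (is_derive_eq (is_deriveD h1 h2)); rewrite /GRing.scale /=.
by rewrite !mulrA mulrN.
Qed.

Lemma continuous_rexp a b : continuous (rexp a b).
Proof.
move=> x; apply: differentiable_continuous; apply/derivable1_diffP.
by case: (is_derive_rexp a b x).
Qed.

Lemma derive0_const (P : R -> Prop) (h : R -> R) x y :
  (forall t, x <= t <= y -> P t) -> (forall t, P t -> is_derive t 1 h 0) ->
  x < y -> h x = h y.
Proof.
move=> cvx dh xy; have [||c _ e] := @MVT R h (fun=> 0) x y xy.
- by move=> t; rewrite in_itv /= => /andP[xt ty]; apply/dh/cvx; rewrite !ltW.
- apply: derivable_within_continuous => t; rewrite in_itv /= => ht.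
  by case: (dh t (cvx t ht)).
by apply/esym/eqP; rewrite -subr_eq0 e mul0r.
Qed.

(** The functions (g' + g/2) e^(-x/2) and (g/2 - g') e^(x/2) have derivative 0. *)
Lemma ode_rexp (P : R -> Prop) (g g1 : R -> R) :
  (forall x y t, P x -> P y -> x <= t <= y -> P t) ->
  (forall x, P x -> is_derive x 1 g (g1 x)) ->
  (forall x, P x -> is_derive x 1 g1 (4^-1 * g x)) ->
  exists a b, forall x, P x -> g x = rexp a b x /\ g1 x = rexp (a / 2) (- (b / 2)) x.
Proof.
move=> cvx dg dg1; have [[x0 Px0]|nP] := pselect (exists x, P x); last first.
  by exists 0, 0 => x Px; case: nP; exists x.
pose h1 x := (g1 x + 2^-1 * g x) * expR (- 2^-1 * x).
pose h2 x := (2^-1 * g x - g1 x) * expR (2^-1 * x).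
have dh1 x : P x -> is_derive x 1 h1 0.
  move=> Px; have d1 := is_deriveD (dg1 x Px) (is_deriveZ 2^-1 (dg x Px)).
  apply: (is_derive_eq (is_deriveM d1 (is_derive_expR_scale (- 2^-1) x))).
  by rewrite /GRing.scale /= -[X in X * _ + _]/(g1 x + 2^-1 * g x); field.
have dh2 x : P x -> is_derive x 1 h2 0.
  move=> Px; have d1 := is_deriveB (is_deriveZ 2^-1 (dg x Px)) (dg1 x Px).
  apply: (is_derive_eq (is_deriveM d1 (is_derive_expR_scale 2^-1 x))).
  by rewrite /GRing.scale /= -[X in X * _ + _]/(2^-1 * g x - g1 x); field.
have cst (h : R -> R) : (forall t, P t -> is_derive t 1 h 0) -> forall x, P x -> h x = h x0.
  move=> dh x Px; have [xx|xx|-> //] := ltgtP x x0.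
    by apply: (derive0_const (P := P)) => // t; apply: cvx.
  by apply/esym/(derive0_const (P := P)) => // t; apply: cvx.
exists (h1 x0), (h2 x0) => x Px; rewrite -(cst _ dh1 x Px) -(cst _ dh2 x Px) /h1 /h2 /rexp.
rewrite -[x / 2]mulrC -mulNr.
set e := expR (2^-1 * x); set e' := expR (- 2^-1 * x).
have ee : e * e' = 1 by rewrite /e /e' -expRD mulNr subrr expR0.
split.
  transitivity ((2^-1 + 2^-1) * (e * e') * g x); first by rewrite ee; field.
  by ring.
transitivity ((2^-1 + 2^-1) * (e * e') * g1 x); first by rewrite ee; field.
by field.
Qed.

Definition cexp A B x : R[i] := A * (expR (x / 2))%:C + B * (expR (- (x / 2)))%:C.

Lemma Re_cexp A B x : complex.Re (cexp A B x) = rexp (complex.Re A) (complex.Re B) x.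
Proof. by case: A B => ? ? [? ?]; rewrite /cexp /rexp /= !mulr0 !subr0. Qed.

Lemma Im_cexp A B x : complex.Im (cexp A B x) = rexp (complex.Im A) (complex.Im B) x.
Proof. by case: A B => ? ? [? ?]; rewrite /cexp /rexp /= !mulr0 !add0r. Qed.

(** 2^-1 as an embedded real, so that multiplying by it commutes with taking real
    and imaginary parts. *)
Definition halfC : R[i] := (2^-1 : R)%:C.

Lemma Re_halfC A : complex.Re (halfC * A) = 2^-1 * complex.Re A.
Proof. by case: A => ? ?; rewrite /= mul0r subr0. Qed.

Lemma Im_halfC A : complex.Im (halfC * A) = 2^-1 * complex.Im A.
Proof. by case: A => ? ?; rewrite /= mul0r addr0. Qed.

Lemma is_cderive_cexp A B x :
  is_cderive x (cexp A B) (cexp (halfC * A) (- (halfC * B)) x).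
Proof.
have ReN (z : R[i]) : complex.Re (- z) = - complex.Re z by case: z.
have ImN (z : R[i]) : complex.Im (- z) = - complex.Im z by case: z.
split; rewrite ?Re_cexp ?Im_cexp ?ReN ?ImN ?Re_halfC ?Im_halfC.
  have -> : (fun t => complex.Re (cexp A B t)) = rexp (complex.Re A) (complex.Re B).
    by apply/funext => t; rewrite Re_cexp.
  by have := is_derive_rexp (complex.Re A) (complex.Re B) x; rewrite ![_ / 2]mulrC.
have -> : (fun t => complex.Im (cexp A B t)) = rexp (complex.Im A) (complex.Im B).
  by apply/funext => t; rewrite Im_cexp.
by have := is_derive_rexp (complex.Im A) (complex.Im B) x; rewrite ![_ / 2]mulrC.
Qed.

Lemma halfC_sqr : halfC * halfC = 4^-1 :> R[i].
Proof.
rewrite /halfC -rmorphM /= -invfM -[4^-1]/((4 : R[i])^-1).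
rewrite fmorphV /=; congr (_^-1).
by rewrite -natrM rmorph_nat.
Qed.

Lemma cexp_ode A B x : cexp (halfC * (halfC * A)) (- (halfC * - (halfC * B))) x = 4^-1 * cexp A B x.
Proof. by rewrite -halfC_sqr /cexp; ring. Qed.

Lemma ode_cexp (P : R -> Prop) (f f' : R -> R[i]) :
  (forall x y t, P x -> P y -> x <= t <= y -> P t) ->
  (forall x, P x -> is_cderive x f (f' x) /\
     exists f2 : R[i], is_cderive x f' f2 /\ - f2 + 4^-1 * f x = 0) ->
  exists A B, forall x, P x -> f x = cexp A B x /\ f' x = cexp (halfC * A) (- (halfC * B)) x.
Proof.
move=> cvx df.
have h4 z : 4^-1 * z = halfC * (halfC * z) by rewrite mulrA halfC_sqr.
have df2 x : P x -> is_cderive x f' (halfC * (halfC * f x)).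
  move=> /df[_ [f2 [d2 e]]]; rewrite -h4.
  by have -> : 4^-1 * f x = f2 by apply/eqP; rewrite -subr_eq0 addrC e.
have q4 (c : R) : 2^-1 * (2^-1 * c) = 4^-1 * c by field.
have [|x /df[[] //]|x Px|ar [br hr]] :=
    @ode_rexp P (fun t => complex.Re (f t)) (fun t => complex.Re (f' t)).
- exact: cvx.
- by have [] := df2 x Px; rewrite !Re_halfC q4.
have [|x /df[[] //]|x Px|ai [bi hi]] :=
    @ode_rexp P (fun t => complex.Im (f t)) (fun t => complex.Im (f' t)).
- exact: cvx.
- by have [] := df2 x Px; rewrite !Im_halfC q4.
exists (ar +i* ai), (br +i* bi) => x Px.
have [r1 r2] := hr x Px; have [i1 i2] := hi x Px.
have cext (u v : R[i]) : complex.Re u = complex.Re v -> complex.Im u = complex.Im v -> u = v.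
  by case: u v => ? ? [? ?] /= -> ->.
have ReN (z : R[i]) : complex.Re (- z) = - complex.Re z by case: z.
have ImN (z : R[i]) : complex.Im (- z) = - complex.Im z by case: z.
split; apply: cext; rewrite ?Re_cexp ?Im_cexp //.
  by rewrite r2 ReN !Re_halfC /= ![_ / 2]mulrC.
by rewrite i2 ImN !Im_halfC /= ![_ / 2]mulrC.
Qed.

Lemma cexp_inj A B A' B' x y : x != y -> cexp A B x = cexp A' B' x ->
  cexp A B y = cexp A' B' y -> A = A' /\ B = B'.
Proof.
move=> xy ex ey.
have key (u : R) : cexp A B u = cexp A' B' u -> (A - A') * (expR u)%:C = B' - B.
  move=> e; have e1 : (expR (u / 2))%:C * (expR (- (u / 2)))%:C = 1 :> R[i].
    by rewrite -rmorphM /= expR_half_mulV.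
  have -> : (expR u)%:C = (expR (u / 2))%:C * (expR (u / 2))%:C :> R[i].
    by rewrite -rmorphM /= -expRD; congr (expR _)%:C; field.
  apply/eqP; rewrite -subr_eq0; apply/eqP.
  transitivity ((expR (u / 2))%:C * (cexp A B u - cexp A' B' u)); last by rewrite e subrr mulr0.
  rewrite /cexp; transitivity ((A - A') * ((expR (u / 2))%:C * (expR (u / 2))%:C)
     - ((expR (u / 2))%:C * (expR (- (u / 2)))%:C) * (B' - B)); first by rewrite e1 mul1r.
  by ring.
have /eqP : (A - A') * ((expR x)%:C - (expR y)%:C) = 0.
  by rewrite mulrBr (key _ ex) (key _ ey) subrr.
rewrite mulf_eq0 -rmorphB /= fmorph_eq0 !subr_eq0 => /orP[/eqP A0|/eqP exy]; last first.
  by rewrite (expR_inj exy) eqxx in xy.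
split=> //; by apply/esym/eqP; rewrite -subr_eq0 -(key _ ex) A0 subrr mul0r.
Qed.

End ExponentialSolutions.

(** * Solutions on the line *)

Section Solutions.
Local Open Scope classical_set_scope.
Local Open Scope complex_scope.
Context {R : realType}.
Implicit Types (x y : R) (z : R[i]) (m : R * R * R) (l : seq (R * R * R))
  (u : {poly R} * {poly R}) (f : R -> R[i]) (P Q : {poly R}).

Definition ceval z P : R[i] := (map_poly (real_complex R) P).[z].

Lemma cevalD z P Q : ceval z (P + Q) = ceval z P + ceval z Q.
Proof. by rewrite /ceval rmorphD hornerD. Qed.

Lemma cevalB z P Q : ceval z (P - Q) = ceval z P - ceval z Q.
Proof. by rewrite /ceval rmorphB hornerD hornerN. Qed.

Lemma cevalM z P Q : ceval z (P * Q) = ceval z P * ceval z Q.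
Proof. by rewrite /ceval rmorphM hornerM. Qed.

Lemma cevalC z (c : R) : ceval z c%:P = c%:C.
Proof. by rewrite /ceval map_polyC hornerC. Qed.

Lemma cevalX z : ceval z 'X = z.
Proof. by rewrite /ceval map_polyX hornerX. Qed.

Lemma ceval_real (t : R) P : ceval t%:C P = (P.[t])%:C.
Proof. by rewrite /ceval horner_map. Qed.

Lemma ceval0 z : ceval z 0 = 0.
Proof. by rewrite /ceval rmorph0 horner0. Qed.

Lemma ceval1 z : ceval z 1 = 1.
Proof. by rewrite /ceval rmorph1 hornerC. Qed.

Lemma ceval_impedance z m :
  ceval z (impedance m) = z * (m.1.2)%:C + z ^+ 2 * (m.2)%:C.
Proof. by rewrite /impedance expr2 cevalD !cevalM !cevalC cevalX; ring. Qed.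

Lemma ceval_pval z x u : ceval z (pval x u) = cexp (ceval z u.1) (ceval z u.2) x.
Proof. by rewrite /pval cevalD !cevalM !cevalC /cexp; ring. Qed.

Lemma ceval_pder z x u :
  ceval z (pder x u) = - cexp (halfC * ceval z u.1) (- (halfC * ceval z u.2)) x.
Proof. by rewrite /pder cevalM cevalB !cevalM !cevalC /cexp -[(2^-1)%:C]/halfC; ring. Qed.

Definition phi_plus l z x : R[i] := ceval z (phi_at l x).

Definition dphi_plus l z x : R[i] :=
  - ceval z (pder x (chain [seq m <- l | x < pos m])).

Lemma filter_gt_right l x : \forall t \near x^'+,
  [seq m <- l | t < pos m] = [seq m <- l | x < pos m].
Proof.
elim: l => [|m l IH] /=; first by apply: nearW.
have [xm|mx] := ltP x (pos m).
  by apply: filterS2 IH (nbhs_right_lt xm) => t -> ->.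
apply: filterS2 IH (nbhs_right_gt x) => t -> xt.
by rewrite ltNge (le_trans mx (ltW xt)).
Qed.

Lemma filter_gt_left l x : \forall t \near x^'-,
  [seq m <- l | t < pos m] = [seq m <- l | x <= pos m].
Proof.
elim: l => [|m l IH] /=; first by apply: nearW.
have [xm|mx] := leP x (pos m).
  by apply: filterS2 IH (nbhs_left_lt x) => t -> tx; rewrite (lt_le_trans tx xm).
by apply: filterS2 IH (nbhs_left_ge mx) => t -> mt; rewrite ltNge mt.
Qed.

Lemma filter_gt_near l x : x \notin map pos l -> \forall t \near x,
  [seq m <- l | t < pos m] = [seq m <- l | x < pos m].
Proof.
elim: l => [|m l IH] /=; first by move=> _; apply: filterE.
rewrite inE negb_or => /andP[xm xl].
have [lt|mx] := ltP x (pos m).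
  by apply: filterS2 (IH xl) (lt_nbhsl lt) => t -> ->.
have mx' : pos m < x by rewrite lt_neqAle eq_sym xm.
by apply: filterS2 (IH xl) (lt_nbhsr mx') => t -> mt; rewrite ltNge (ltW mt).
Qed.

Lemma filter_ge_notin l x : x \notin map pos l ->
  [seq m <- l | x <= pos m] = [seq m <- l | x < pos m].
Proof.
move=> xl; apply: eq_in_filter => m ml; rewrite lt_neqAle andbC.
by case: (x <= pos m) => //=; apply/esym/eqP => e; move: xl; rewrite e map_f.
Qed.

Lemma filter_ge_in l m : sorted ltpos l -> m \in l ->
  [seq k <- l | pos m <= pos k] = m :: [seq k <- l | pos m < pos k].
Proof.
elim: l => //= k l IH; rewrite path_sortedE => [/andP[kl sl]|]; last exact: ltpos_trans.
rewrite inE => /predU1P[->|ml].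
  rewrite lexx ltxx; congr (_ :: _).
  apply: eq_in_filter => j /(allP kl) kj; have {}kj : pos k < pos j := kj.
  by rewrite (ltW kj) kj.
have km : pos k < pos m := allP kl m ml.
by rewrite leNgt km /= [_ < pos k]ltNge (ltW km) /= IH.
Qed.

Lemma pval_filter_ge l x : sorted ltpos l ->
  pval x (chain [seq m <- l | x <= pos m]) = phi_at l x.
Proof.
move=> sl; have [/mapP[m ml ->]|xl] := boolP (x \in map pos l).
  by rewrite filter_ge_in //= pval_kick.
by rewrite filter_ge_notin.
Qed.

Lemma cvg_near_eq {T : topologicalType} (F : set_system R) {FF : Filter F}
    (f g : R -> T) (a : T) :
  (\forall t \near F, f t = g t) -> g @ F --> a -> f @ F --> a.
Proof.
move=> fg; apply: cvg_trans; apply: near_eq_cvg.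
by apply: filterS fg => t ->.
Qed.

Lemma ccvg_near_cexp (F : set_system R) {FF : Filter F} f A B x :
  F `=>` nbhs x -> (\forall t \near F, f t = cexp A B t) -> ccvg_to F f (cexp A B x).
Proof.
move=> Fx fE; split.
  rewrite Re_cexp; apply: (@cvg_near_eq _ _ _ _ (rexp (complex.Re A) (complex.Re B))).
    by apply: filterS fE => t ->; rewrite Re_cexp.
  apply: cvg_trans (@continuous_rexp R (complex.Re A) (complex.Re B) x).
  exact: cvg_app.
rewrite Im_cexp; apply: (@cvg_near_eq _ _ _ _ (rexp (complex.Im A) (complex.Im B))).
  by apply: filterS fE => t ->; rewrite Im_cexp.
apply: cvg_trans (@continuous_rexp R (complex.Im A) (complex.Im B) x).
exact: cvg_app.
Qed.

Lemma at_left_nbhs x : x^'- `=>` nbhs x.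
Proof. exact: cvg_within. Qed.

Lemma at_right_nbhs x : x^'+ `=>` nbhs x.
Proof. exact: cvg_within. Qed.

Lemma ccvg_unique (F : set_system R) {FF : ProperFilter F} f (a b : R[i]) :
  ccvg_to F f a -> ccvg_to F f b -> a = b.
Proof.
move=> [r1 i1] [r2 i2].
have er := cvg_unique (@Rhausdorff R) r1 r2.
have ei := cvg_unique (@Rhausdorff R) i1 i2.
by case: a b er ei {r1 r2 i1 i2} => ? ? [? ?] /= -> ->.
Qed.

Lemma is_cderive_near x f g (d : R[i]) :
  (\forall t \near x, f t = g t) -> is_cderive x f d -> is_cderive x g d.
Proof.
move=> fg [dr di]; split.
  by apply: near_eq_is_derive dr; apply: filterS fg => t ->.
by apply: near_eq_is_derive di; apply: filterS fg => t ->.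
Qed.

Lemma phi_plus_left l z x : sorted ltpos l ->
  let u := chain [seq m <- l | x <= pos m] in
  [/\ ccvg_to x^'- (phi_plus l z) (phi_plus l z x) &
      ccvg_to x^'- (dphi_plus l z) (- ceval z (pder x u))].
Proof.
move=> sl u; split.
  have -> : phi_plus l z x = cexp (ceval z u.1) (ceval z u.2) x.
    by rewrite /phi_plus -pval_filter_ge // ceval_pval.
  apply: ccvg_near_cexp; first exact: at_left_nbhs.
  by apply: filterS (filter_gt_left l x) => t e; rewrite /phi_plus /phi_at e ceval_pval.
rewrite ceval_pder opprK; apply: ccvg_near_cexp; first exact: at_left_nbhs.
by apply: filterS (filter_gt_left l x) => t e; rewrite /dphi_plus e ceval_pder opprK.
Qed.

Lemma phi_plus_right l z x :
  ccvg_to x^'+ (phi_plus l z) (phi_plus l z x) /\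
  ccvg_to x^'+ (dphi_plus l z) (dphi_plus l z x).
Proof.
split.
  rewrite {2}/phi_plus /phi_at ceval_pval; apply: ccvg_near_cexp; first exact: at_right_nbhs.
  by apply: filterS (filter_gt_right l x) => t e; rewrite /phi_plus /phi_at e ceval_pval.
rewrite {2}/dphi_plus ceval_pder opprK; apply: ccvg_near_cexp; first exact: at_right_nbhs.
by apply: filterS (filter_gt_right l x) => t e; rewrite /dphi_plus e ceval_pder opprK.
Qed.

Lemma phi_plus_continuous l z : sorted ltpos l -> ccontinuous (phi_plus l z).
Proof.
move=> sl; split=> x; apply/left_right_continuousP;
  by have [[? ?] _] := phi_plus_left z x sl; have [[? ?] _] := phi_plus_right l z x.
Qed.

Lemma phi_plus_ode l z x : x \notin map pos l ->
  is_cderive x (phi_plus l z) (dphi_plus l z x) /\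
  exists f2 : R[i], is_cderive x (dphi_plus l z) f2 /\ - f2 + 4^-1 * phi_plus l z x = 0.
Proof.
move=> xl; set u := chain [seq m <- l | x < pos m].
have nl := filter_gt_near xl.
split.
  rewrite /dphi_plus ceval_pder opprK.
  apply: is_cderive_near (is_cderive_cexp _ _ _).
  by apply: filterS nl => t e; rewrite /phi_plus /phi_at e ceval_pval.
exists (4^-1 * phi_plus l z x); split; last by rewrite addNr.
rewrite /phi_plus /phi_at ceval_pval -cexp_ode.
apply: is_cderive_near (is_cderive_cexp _ _ _).
by apply: filterS nl => t e; rewrite /dphi_plus e ceval_pder opprK.
Qed.

Lemma phi_plus_jump l z m : sorted ltpos l -> m \in l ->
  - ceval z (pder (pos m) (chain [seq k <- l | pos m <= pos k])) =
  dphi_plus l z (pos m) + z * (m.1.2)%:C * phi_plus l z (pos m)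
    + z ^+ 2 * (m.2)%:C * phi_plus l z (pos m).
Proof.
move=> sl ml; rewrite filter_ge_in //= pder_kick /dphi_plus /phi_plus /phi_at.
by rewrite cevalB cevalM ceval_impedance; ring.
Qed.

Lemma cexp_cauchy_inj (A B A' B' : R[i]) x : cexp A B x = cexp A' B' x ->
  cexp (halfC * A) (- (halfC * B)) x = cexp (halfC * A') (- (halfC * B')) x -> A = A' /\ B = B'.
Proof.
rewrite /cexp; set e := (expR (x / 2))%:C; set e' := (expR (- (x / 2)))%:C => h1 h2.
have ee : e * e' = 1 :> R[i] by rewrite /e /e' -rmorphM /= expR_half_mulV.
have hh : halfC + halfC = 1 :> R[i] by rewrite /halfC -rmorphD /=; congr (_%:C); field.
split.
  have -> : A = e' * (halfC * (A * e + B * e') + (halfC * A * e + - (halfC * B) * e')).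
    by rewrite -[LHS]mul1r -ee -[LHS]mul1r -hh; ring.
  by rewrite h1 h2 -[RHS]mul1r -ee -[RHS]mul1r -hh; ring.
have -> : B = e * (halfC * (A * e + B * e') - (halfC * A * e + - (halfC * B) * e')).
  by rewrite -[LHS]mul1r -ee -[LHS]mul1r -hh; ring.
by rewrite h1 h2 -[RHS]mul1r -ee -[RHS]mul1r -hh; ring.
Qed.

Lemma ccontinuous_left f x : ccontinuous f -> ccvg_to x^'- f (f x).
Proof.
by move=> [cr ci]; split; [apply: cvg_at_left_filter (cr x) | apply: cvg_at_left_filter (ci x)].
Qed.

Lemma ccontinuous_right f x : ccontinuous f -> ccvg_to x^'+ f (f x).
Proof.
by move=> [cr ci]; split; [apply: cvg_at_right_filter (cr x) | apply: cvg_at_right_filter (ci x)].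
Qed.

Lemma near_notin_right l x : x \notin map pos l -> \forall t \near x^'+, t \notin map pos l.
Proof.
elim: l => [|m l IH] /=; first by move=> _; apply: filterE.
rewrite inE negb_or => /andP[xm xl]; move: xm; rewrite neq_lt => /orP[xm|mx].
  apply: filterS2 (IH xl) (nbhs_right_lt xm) => t tl tm.
  by rewrite inE negb_or tl lt_eqF.
apply: filterS2 (IH xl) (nbhs_right_gt x) => t tl xt.
by rewrite inE negb_or tl gt_eqF // (lt_trans mx).
Qed.

Lemma cexpZ (c A B : R[i]) x : c * cexp A B x = cexp (c * A) (c * B) x.
Proof. by rewrite /cexp; ring. Qed.

Lemma near_pinfty_two (P : R -> Prop) (c : R) : (\forall x \near +oo, P x) ->
  exists x y, [/\ c < x, x < y, P x & P y].
Proof.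
move=> [M [_ hM]]; exists (Num.max M c + 1), (Num.max M c + 2).
have h1 : M <= Num.max M c by rewrite le_max lexx.
have h2 : c <= Num.max M c by rewrite le_max lexx orbT.
split; [lra|lra|apply: hM; lra|apply: hM; lra].
Qed.

(** Going down from +oo, the solution is an exponential sum on each interval; at
    a mass, continuity and the jump condition fix the two coefficients on the
    left.  The statement is restricted to x > l0 so that each interval between
    masses is treated in turn. *)
Lemma solution_from_pinfty l z f f' (c : R[i]) (l0 : R) :
  sorted ltpos l -> all (fun m => l0 < pos m) l -> ccontinuous f ->
  (forall x, l0 < x -> x \notin map pos l ->
     is_cderive x f (f' x) /\
     exists f2 : R[i], is_cderive x f' f2 /\ - f2 + 4^-1 * f x = 0) ->
  (forall m, m \in l -> exists a b : R[i],
     [/\ ccvg_to (pos m)^'- f' a, ccvg_to (pos m)^'+ f' b &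
      a = b + z * (m.1.2)%:C * f (pos m) + z ^+ 2 * (m.2)%:C * f (pos m)]) ->
  (\forall x \near +oo, f x = c * (expR (- (x / 2)))%:C) ->
  forall x, l0 < x -> f x = c * phi_plus l z x /\
    (x \notin map pos l -> f' x = c * dphi_plus l z x).
Proof.
elim: l l0 => [|m l IH] l0 sl al cf ode jump finf.
  have [|x /(ode x)|A [B hAB]] := @ode_cexp R (fun x => l0 < x) f f'.
  - by move=> x y t xl _ /andP[xt _]; apply: lt_le_trans xt.
  - exact.
  have [x [y [lx xy fx fy]]] := near_pinfty_two l0 finf.
  have ce t : c * (expR (- (t / 2)))%:C = cexp 0 c t by rewrite /cexp mul0r add0r.
  have [] : A = 0 /\ B = c.
    apply: (@cexp_inj R _ _ _ _ x y).
    - by rewrite lt_eqF.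
    - by rewrite -ce -fx; have [-> _] := hAB x lx.
    - by rewrite -ce -fy; have [-> _] := hAB y (lt_trans lx xy).
  move=> eA eB t lt; have [-> ->] := hAB t lt.
  rewrite /phi_plus /dphi_plus ceval_pval ceval_pder opprK /= ceval0 ceval1 eA eB.
  rewrite !cexpZ; split; [|move=> _]; congr (cexp _ _ t); ring.
set y := pos m.
have sl' : sorted ltpos l by move: sl => /= /path_sorted.
have ml : all (fun k => y < pos k) l.
  by move: sl; rewrite /= path_sortedE => [/andP[]//|]; apply: ltpos_trans.
have yl : y \notin map pos l.
  by apply/mapP => -[k kl e]; have := allP ml k kl; rewrite e ltxx.
move: al => /= /andP[l0y al].
have {}IH : forall x, y < x -> f x = c * phi_plus l z x /\
    (x \notin map pos l -> f' x = c * dphi_plus l z x).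
  apply: IH => //.
    move=> x yx xl; apply: ode; first exact: lt_trans yx.
    by rewrite /= inE negb_or xl gt_eqF.
  by move=> k kl; apply: jump; rewrite inE kl orbT.
have [a [b [la rb ab]]] := jump m (mem_head _ _); rewrite -/y in la rb ab.
set u := chain l.
have fil x : x < y -> [seq k <- m :: l | x < pos k] = m :: l.
  move=> xy; apply/all_filterP; rewrite /= xy; apply: sub_all ml => k; exact: lt_trans.
have fily : [seq k <- l | y < pos k] = l by apply/all_filterP.
have fy : f y = c * phi_plus l z y.
  apply: (ccvg_unique (ccontinuous_right y cf)).
  rewrite /phi_plus /phi_at ceval_pval cexpZ.
  apply: ccvg_near_cexp; first exact: at_right_nbhs.
  apply: filterS2 (nbhs_right_gt y) (filter_gt_right l y) => t yt e.
  by have [-> _] := IH t yt; rewrite /phi_plus /phi_at e ceval_pval cexpZ.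
have eb : b = c * - ceval z (pder y u).
  apply: (ccvg_unique rb); rewrite ceval_pder opprK cexpZ.
  apply: ccvg_near_cexp; first exact: at_right_nbhs.
  apply: filterS3 (nbhs_right_gt y) (filter_gt_right l y) (near_notin_right yl) => t yt e tl.
  have [_ /(_ tl) ->] := IH t yt.
  by rewrite /dphi_plus e fily ceval_pder opprK cexpZ.
have notin x : x < y -> x \notin map pos (m :: l).
  move=> xy; rewrite /= inE negb_or lt_eqF //=; apply/mapP => -[k kl e].
  by have := allP ml k kl; rewrite -e ltNge (ltW xy).
have [|x /andP[lx xy]|A [B hAB]] := @ode_cexp R (fun x => l0 < x < y) f f'.
- move=> x1 x2 t /andP[l1 _] /andP[_ l2] /andP[h1 h2].
  by rewrite (lt_le_trans l1 h1) (le_lt_trans h2 l2).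
- by apply: ode => //; exact: notin.
have eval : cexp A B y = c * phi_plus l z y.
  rewrite -fy; apply: esym; apply: (ccvg_unique (ccontinuous_left y cf)).
  apply: ccvg_near_cexp; first exact: at_left_nbhs.
  apply: filterS2 (nbhs_left_lt y) (nbhs_left_gt l0y) => t ty lt.
  by have [] := hAB t _; rewrite ?lt ?ty.
have ea : a = cexp (halfC * A) (- (halfC * B)) y.
  apply: (ccvg_unique la); apply: ccvg_near_cexp; first exact: at_left_nbhs.
  apply: filterS2 (nbhs_left_lt y) (nbhs_left_gt l0y) => t ty lt.
  by have [] := hAB t _; rewrite ?lt ?ty.
set K := chain (m :: l); have eK : K = kick m u by [].
have [eA eB] : A = c * ceval z K.1 /\ B = c * ceval z K.2.
  apply: (@cexp_cauchy_inj _ _ _ _ y).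
    by rewrite eval -cexpZ -ceval_pval eK pval_kick /phi_plus /phi_at fily.
  rewrite -ea ab eb fy [halfC * (c * ceval z K.1)]mulrCA [halfC * (c * ceval z K.2)]mulrCA.
  rewrite -[- (c * (halfC * ceval z K.2))]mulrN -cexpZ.
  rewrite -[cexp (halfC * _) _ y]opprK -ceval_pder eK pder_kick cevalB cevalM.
  by rewrite ceval_impedance /phi_plus /phi_at fily -/u; ring.
move=> x l0x; have [xy|yx|->] := ltgtP x y.
- have [] := hAB x; first by rewrite l0x.
  move=> -> ->; rewrite /phi_plus /dphi_plus /phi_at fil // -/K ceval_pval ceval_pder opprK.
  rewrite !cexpZ eA eB; split=> // _; congr (cexp _ _ x); ring.
- have [-> h] := IH x yx; rewrite /phi_plus phi_at_tail ?ltW //; split=> //.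
  rewrite /= inE negb_or => /andP[_ /h ->]; rewrite /dphi_plus /=.
  by rewrite -/y ltNge (ltW yx).
- split; last by rewrite /= inE eqxx.
  by rewrite fy /phi_plus phi_at_tail.
Qed.

End Solutions.

(** * Eigenvalues and norming constants *)

Section DiscretePairs.
Local Open Scope classical_set_scope.
Local Open Scope complex_scope.
Context {R : realType}.
Implicit Types (p : discrete_pair R) (x y : R) (z : R[i]) (m : R * R * R)
  (l : seq (R * R * R)) (f : R -> R[i]).

Definition mass_of p (i : 'I_(supp_size p)) : R * R * R :=
  (mass_point p i, omega_weight p i, v_weight p i).

Definition masses p : seq (R * R * R) := [seq mass_of i | i <- enum 'I_(supp_size p)].

Lemma masses_sorted p : sorted ltpos (masses p).
Proof.
rewrite sorted_map; apply: (sub_sorted (e := relpre val ltn)).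
  by move=> i j; apply: mass_point_increasing.
by rewrite -sorted_map val_enum_ord iota_ltn_sorted.
Qed.

Lemma masses_admissible p : all admissible (masses p).
Proof.
by rewrite all_map; apply/allP => i _; rewrite /= /admissible v_weight_ge0 weights_gt0.
Qed.

Lemma masses_surj l : sorted ltpos l -> all admissible l -> (0 < size l)%N ->
  exists p, masses p = l.
Proof.
move=> sl al l0; pose t i := tnth (in_tuple l) i.
have inc (i j : 'I_(size l)) : (i < j)%N -> pos (t i) < pos (t j).
  move=> ij; rewrite /t !(tnth_nth (0, 0, 0)) /=.
  suff : ltpos (nth (0, 0, 0) l i) (nth (0, 0, 0) l j) by [].
  by apply: (sorted_ltn_nth (@ltpos_trans R)) => //; rewrite inE.
have ad i : admissible (t i) by rewrite (allP al) // mem_tnth.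
have v0 i : 0 <= (t i).2 by case/andP: (ad i).
have w0 i : 0 < `|(t i).1.2| + (t i).2 by case/andP: (ad i).
exists (@DiscretePair R (size l) (fun i => pos (t i)) (fun i => (t i).1.2)
  (fun i => (t i).2) l0 inc v0 w0).
rewrite /masses /=; transitivity [seq t i | i <- enum 'I_(size l)].
  by apply: eq_map => i; rewrite /mass_of /= /pos; case: (t i) => [[? ?] ?].
by rewrite -[RHS](map_tnth_enum (in_tuple l)).
Qed.

Lemma mem_masses p (i : 'I_(supp_size p)) : mass_of i \in masses p.
Proof. by rewrite map_f ?mem_enum. Qed.

Lemma notin_masses p x : (forall i, x <> mass_point p i) <-> x \notin map pos (masses p).
Proof.
split=> [h|h i e].
  by apply/mapP => -[m /mapP[i _ ->]]; apply: h.
by move: h; rewrite e -[mass_point p i]/(pos (mass_of i)) map_f // mem_masses.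
Qed.

Lemma phi_plus_solution p z : is_solution p z (phi_plus (masses p) z).
Proof.
split; first exact: phi_plus_continuous (masses_sorted p).
exists (dphi_plus (masses p) z); split.
  by move=> x /notin_masses; apply: phi_plus_ode.
move=> i; have ml := mem_masses i.
have [_ hl] := phi_plus_left z (mass_point p i) (masses_sorted p).
have [_ hr] := phi_plus_right (masses p) z (mass_point p i).
exists (- ceval z (pder (mass_point p i) (chain [seq m <- masses p | mass_point p i <= pos m]))).
exists (dphi_plus (masses p) z (mass_point p i)); split=> //; split=> //.
exact: (phi_plus_jump z (masses_sorted p) ml).
Qed.

Lemma masses_bounds l : exists lo hi : R,
  all (fun m => lo < pos m) l /\ all (fun m => pos m < hi) l.
Proof.
elim: l => [|m l [lo [hi [h1 h2]]]]; first by exists 0, 0.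
exists (Num.min lo (pos m - 1)), (Num.max hi (pos m + 1)) => /=.
rewrite gt_min lt_max; split; apply/andP; split.
- by apply/orP; right; lra.
- by apply: sub_all h1 => k; rewrite gt_min => ->.
- by apply/orP; right; lra.
- by apply: sub_all h2 => k; rewrite lt_max => ->.
Qed.

Lemma solution_unique p z f (c : R[i]) : is_solution p z f ->
  (\forall x \near +oo, f x = c * (expR (- (x / 2)))%:C) ->
  forall x, f x = c * phi_plus (masses p) z x.
Proof.
move=> [cf [f' [ode jump]]] finf x.
have [lo [hi [hlo _]]] := masses_bounds (masses p).
(* Any lower end below x and below all the masses will do. *)
pose l0 := Num.min lo x - 1.
have l0lo : l0 < lo by rewrite /l0; have := ge_min lo lo x; rewrite lexx /=; lra.
have l0x : l0 < x by rewrite /l0; have := ge_min x lo x; rewrite lexx orbT; lra.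
have [|||-> _ //] :=
  @solution_from_pinfty R (masses p) z f f' c l0 (masses_sorted p) _ cf _ _ finf x l0x.
- by apply: sub_all hlo => m; apply: lt_trans.
- by move=> y _ /notin_masses; apply: ode.
- move=> m /mapP[i _ ->]; have [a [b [ha [hb e]]]] := jump i.
  by exists a, b; split.
Qed.

Lemma phi_plus_pinfty l z : \forall x \near +oo,
  phi_plus l z x = (expR (- (x / 2)))%:C.
Proof.
have [lo [hi [_ hhi]]] := masses_bounds l.
exists hi; split; first exact: num_real.
move=> x /= hx; rewrite /phi_plus /phi_at.
have -> : [seq m <- l | x < pos m] = [::].
  rewrite -(filter_pred0 l); apply: eq_in_filter => m ml /=.
  by apply/negbTE; rewrite -leNgt ltW // (lt_trans (allP hhi m ml)).
by rewrite ceval_pval /= ceval0 ceval1 /cexp mul0r add0r mul1r.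
Qed.

Lemma is_phi_plus_exists p z : is_phi_plus p z (phi_plus (masses p) z).
Proof.
split; first exact: phi_plus_solution.
by apply: filterS (phi_plus_pinfty (masses p) z) => x ->; rewrite mulNr.
Qed.

Lemma is_phi_plus_unique p z f : is_phi_plus p z f -> f =1 phi_plus (masses p) z.
Proof.
move=> [sf finf] x; rewrite -[RHS]mul1r; apply: (solution_unique sf).
by apply: filterS finf => t ->; rewrite mul1r mulNr.
Qed.

Lemma phi_plus_minfty l z (lo x : R) : all (fun m => lo < pos m) l -> x <= lo ->
  phi_plus l z x = cexp (ceval z (chain l).1) (ceval z (chain l).2) x.
Proof.
move=> hlo xlo; rewrite /phi_plus /phi_at ceval_pval.
suff -> : [seq m <- l | x < pos m] = l by [].
by apply/all_filterP; apply: sub_all hlo => m; apply: le_lt_trans.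
Qed.

Local Notation normc := ComplexField.Normc.normc.

Lemma normc_real (t : R) : normc t%:C = `|t|.
Proof. by rewrite /= expr0n addr0 sqrtr_sqr. Qed.

Lemma normc_ge0 z : 0 <= normc z.
Proof. by case: z => ? ?; apply: sqrtr_ge0. Qed.

Lemma cexp_bounded (A B : R[i]) (M x1 : R) :
  (forall x, x1 <= x -> normc (cexp A B x) <= M) -> A = 0.
Proof.
move=> bd; apply/ComplexField.Normc.eq0_normc/eqP; apply: contraT => nA0.
have nA : 0 < normc A by rewrite lt_neqAle eq_sym nA0 normc_ge0.
(* At this x the term A e^(x/2) alone exceeds K = M + |B|. *)
pose K := M + normc B.
pose x := Num.max (Num.max x1 0) (2 * (K / normc A)).
have x1x : x1 <= x by rewrite /x !le_max lexx.
have x0 : 0 <= x by rewrite /x !le_max lexx orbT.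
have Kx : K / normc A <= x / 2.
  rewrite ler_pdivlMr // mulrC; by rewrite /x le_max lexx orbT.
have e1 : expR (- (x / 2)) <= 1 by rewrite -expR0 ler_expR oppr_le0 divr_ge0.
have e2 : 1 + x / 2 <= expR (x / 2) by apply: expR_ge1Dx.
have : normc A * expR (x / 2) <= K.
  have -> : normc A * expR (x / 2) = normc (cexp A B x - B * (expR (- (x / 2)))%:C).
    have -> : cexp A B x - B * (expR (- (x / 2)))%:C = A * (expR (x / 2))%:C.
      by rewrite /cexp addrK.
    by rewrite ComplexField.Normc.normcM normc_real ger0_norm ?expR_ge0.
  apply: le_trans (le_normcD _ _) _; rewrite /K lerD ?bd //.
  rewrite normcN ComplexField.Normc.normcM normc_real ger0_norm ?expR_ge0 //.
  by rewrite ler_piMr ?normc_ge0.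
have : normc A * (1 + x / 2) <= normc A * expR (x / 2) by rewrite ler_wpM2l // ltW.
have : K <= normc A * (x / 2) by rewrite mulrC -ler_pdivrMr.
lra.
Qed.

Lemma cexp_opp (A B : R[i]) x : cexp A B (- x) = cexp B A x.
Proof. by rewrite /cexp mulNr opprK addrC. Qed.

(** Boundedness near +oo forces a multiple of phi_+, and boundedness near -oo
    then means that its coefficient of e^(-x/2) vanishes. *)
Lemma eigenvalueP p z : is_eigenvalue p z <-> ceval z (chain (masses p)).2 = 0.
Proof.
have [lo [hi [hlo hhi]]] := masses_bounds (masses p).
split=> [[f [sf [x0 fx0] [M fM]]]|B0].
  have [cf [f' [ode jump]]] := sf.
  have [|x hx|A [B hAB]] := @ode_cexp R (fun x => hi < x) f f'.
  - by move=> x y t xl _ /andP[xt _]; apply: lt_le_trans xt.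
  - apply: ode; apply/notin_masses/mapP => -[m ml e].
    by have := allP hhi m ml; rewrite -e ltNge (ltW hx).
  have A0 : A = 0.
    apply: (@cexp_bounded A B M (hi + 1)) => x hx.
    have hix : hi < x by apply: lt_le_trans hx; rewrite ltrDl.
    by have [<- _] := hAB x hix; apply: fM.
  have fphi : forall x, f x = B * phi_plus (masses p) z x.
    apply: solution_unique sf _; exists hi; split; first exact: num_real.
    by move=> x /= hx; have [-> _] := hAB x hx; rewrite /cexp A0 mul0r add0r.
  have B0 : B != 0 by apply/eqP => B0; apply: fx0; rewrite fphi B0 mul0r.
  suff /eqP : B * ceval z (chain (masses p)).2 = 0 by rewrite mulf_eq0 (negbTE B0) => /eqP.
  apply: (@cexp_bounded _ (B * ceval z (chain (masses p)).1) M (- lo)) => x hx.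
  rewrite -cexp_opp -cexpZ -(@phi_plus_minfty _ _ lo) // -?fphi ?fM //.
  by rewrite lerNl.
exists (phi_plus (masses p) z); split; first exact: phi_plus_solution.
  have [M [_ hM]] := phi_plus_pinfty (masses p) z; exists (M + 1).
  rewrite hM ?ltrDl // => /eqP; rewrite fmorph_eq0 gt_eqF ?expR_gt0 //.
have [cr ci] := phi_plus_continuous z (masses_sorted p).
set f := phi_plus _ _ in cr ci *.
pose g x := complex.Re (f x) ^+ 2 + complex.Im (f x) ^+ 2.
have cg : continuous g.
  move=> x; rewrite /g; apply: cvgD.
    by under eq_fun do rewrite expr2; rewrite expr2; apply: cvgM; apply: cr.
  by under eq_fun do rewrite expr2; rewrite expr2; apply: cvgM; apply: ci.
have [M1 [_ hM1]] := phi_plus_pinfty (masses p) z.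
pose U := Num.max (Num.max lo M1 + 1) 0.
have loU : lo <= U.
  by rewrite /U !le_max; apply/orP; left; have := le_max lo lo M1; rewrite lexx /=; lra.
have M1U : M1 < U.
  by rewrite /U lt_max; apply/orP; left; have := le_max M1 lo M1; rewrite lexx orbT; lra.
have U0 : 0 <= U by rewrite /U le_max lexx orbT.
(* To the right of U and to the left of lo the solution is explicit; on the
   segment in between it is bounded by continuity. *)
have [|c _ hc] := @EVT_max R g lo U loU.
  by apply: continuous_subspaceT.
exists (Num.sqrt (g c) + 1 + normc (ceval z (chain (masses p)).1) * expR (lo / 2)).
have n0 : 0 <= normc (ceval z (chain (masses p)).1) * expR (lo / 2).
  by rewrite mulr_ge0 ?normc_ge0 ?expR_ge0.
have s0 : 0 <= Num.sqrt (g c) by apply: sqrtr_ge0.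
move=> x; have [xlo|lox] := leP x lo.
  rewrite /f (phi_plus_minfty _ hlo xlo) B0 /cexp mul0r addr0.
  rewrite ComplexField.Normc.normcM normc_real ger0_norm ?expR_ge0 //.
  have : expR (x / 2) <= expR (lo / 2) by rewrite ler_expR; lra.
  move=> /(ler_wpM2l (normc_ge0 (ceval z (chain (masses p)).1))) h.
  by apply: le_trans h _; rewrite lerDr; lra.
have [xU|Ux] := leP x U.
  have gx : g x <= g c by apply: hc; rewrite in_itv /= xU ltW.
  have : normc (f x) = Num.sqrt (g x) by rewrite /g; case: (f x).
  move=> ->; have : Num.sqrt (g x) <= Num.sqrt (g c) by apply: ler_wsqrtr.
  by lra.
rewrite /f hM1 ?(lt_trans M1U) // normc_real ger0_norm ?expR_ge0 //.
have : expR (- (x / 2)) <= 1 by rewrite -expR0 ler_expR oppr_le0 divr_ge0 // (le_trans U0) // ltW.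
by lra.
Qed.

Lemma discrete_integralE n (x w : 'I_n -> R) (g : R -> R) : continuous g ->
  discrete_integral x w g = \sum_(i < n) w i * g (x i).
Proof.
move=> cg; apply: eq_bigr => i _; congr (_ * _).
rewrite /Rintegral integral_dirac //; last first.
  by apply/measurable_EFinP; apply: continuous_measurable_fun.
by rewrite diracT mul1e.
Qed.

(** The two sums of gamma^2 combine because the impedance has derivative
    omega + 2 t v. *)
Lemma gamma_sq_phi_plus p (t : R) f : is_phi_plus p t%:C f ->
  gamma_sq p t f =
  \sum_(m <- masses p) (impedance m)^`().[t] * (phi_at (masses p) (pos m)).[t] ^+ 2.
Proof.
move=> hf; have [sf _] := hf; have [cf _] := sf.
have fE := is_phi_plus_unique hf.
have gE x : normc (f x) ^+ 2 = (phi_at (masses p) x).[t] ^+ 2.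
  by rewrite fE /phi_plus ceval_real normc_real real_normK ?num_real.
have cg : continuous (fun x => normc (f x) ^+ 2).
  have -> : (fun x => normc (f x) ^+ 2) =
      (fun x => complex.Re (f x) * complex.Re (f x)).
    by apply/funext => x; rewrite gE fE /phi_plus ceval_real -expr2.
  by move=> x; apply: cvgM; apply: (cf.1).
rewrite /gamma_sq !discrete_integralE // /masses big_map big_enum /=.
rewrite mulr_sumr -big_split; apply: eq_bigr => i _ /=.
rewrite !gE -/(masses p) /impedance /mass_of /pos /=.
rewrite expr2 !(derivD, derivM, derivC, derivX, mul0r, add0r, mulr1, mul1r).
by rewrite !(hornerD, hornerM, hornerC, hornerX); ring.
Qed.

End DiscretePairs.

(** * Necessity and sufficiency *)

Section Assembly.
Local Open Scope classical_set_scope.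
Local Open Scope complex_scope.
Context {R : realType}.
Implicit Types (a t x : R) (m : R * R * R) (l r : seq (R * R * R)) (P Q : {poly R}).

Lemma coefM_top P Q d e : (size P <= d.+1)%N -> (size Q <= e.+1)%N ->
  (P * Q)`_(d + e) = P`_d * Q`_e.
Proof.
move=> sP sQ; have dn : (d < (d + e).+1)%N by rewrite ltnS leq_addr.
rewrite coefM (bigD1 (Ordinal dn)) //= addKn big1 ?addr0 // => i id.
have [lt|gt|e'] := ltngtP i d; last by rewrite -val_eqE /= e' eqxx in id.
  rewrite [Q`__]nth_default ?mulr0 // (leq_trans sQ) //.
  by rewrite ltn_subRL ltn_add2r.
by rewrite [P`_i]nth_default ?mul0r // (leq_trans sP).
Qed.

(** Both products in W have leading coefficients of the same sign, so they do not
    cancel: P has at most the degree of W, and the limit of P / W at infinity is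
    nonnegative. *)
Lemma characteristic_top (pp qp pm qm : {poly R}) (W := pp * qm + qp * pm) :
  qp != 0 -> (size pp <= size qp)%N -> 0 <= pp`_(size qp).-1 * lead_coef qp ->
  pm != 0 -> size qm = size pm -> 0 < lead_coef pm * lead_coef qm ->
  (size (pp * pm)%R <= size W)%N /\ 0 <= (pp * pm)`_(size W).-1 * lead_coef W.
Proof.
move=> qp0 spp tp pm0 sqm tm.
have [d sd] : exists d, size qp = d.+1.
  by move: qp0; rewrite -size_poly_gt0; case: (size qp) => // d _; exists d.
have [e se] : exists e, size pm = e.+1.
  by move: pm0; rewrite -size_poly_gt0; case: (size pm) => // k _; exists k.
rewrite se in sqm; rewrite sd in spp tp; rewrite /= in tp.
have lqp : lead_coef qp = qp`_d by rewrite lead_coefE sd.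
have lpm : lead_coef pm = pm`_e by rewrite lead_coefE se.
have lqm : lead_coef qm = qm`_e by rewrite lead_coefE sqm.
rewrite lqp in tp; rewrite lpm lqm in tm.
have Wde : W`_(d + e) = pp`_d * qm`_e + qp`_d * pm`_e.
  by rewrite /W coefD !coefM_top ?sd ?se ?sqm.
have qpd : qp`_d != 0 by rewrite -lqp lead_coef_eq0.
have pme : pm`_e != 0 by rewrite -lpm lead_coef_eq0.
have sM P Q : (size P <= d.+1)%N -> (size Q <= e.+1)%N -> (size (P * Q)%R <= (d + e).+1)%N.
  move=> sP sQ; rewrite (leq_trans (size_polyMleq _ _)) //.
  case: (size P) sP => [_|i].
    by rewrite add0n (leq_trans (leq_pred _)) // (leq_trans sQ) // ltnS leq_addl.
  by rewrite ltnS addSn /= => id; rewrite -addnS leq_add.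
have sW : (size W <= (d + e).+1)%N.
  by rewrite (leq_trans (size_polyD _ _)) // geq_max !sM ?sd ?se ?sqm.
have prodpos : 0 < W`_(d + e) * (qp`_d * pm`_e).
  have -> : W`_(d + e) * (qp`_d * pm`_e) =
    (pp`_d * qp`_d) * (pm`_e * qm`_e) + (qp`_d * pm`_e) ^+ 2 by rewrite Wde; ring.
  rewrite ltr_wpDl //; first by rewrite mulr_ge0 // ltW.
  by rewrite exprn_even_gt0 //= mulf_neq0.
have W0 : W`_(d + e) != 0 by apply: contraTneq prodpos => ->; rewrite mul0r ltxx.
have szW : size W = (d + e).+1.
  apply/eqP; rewrite eqn_leq sW ltnNge; apply: contra W0 => h.
  by rewrite nth_default.
rewrite lead_coefE szW /= sM ?se //; split=> //.
rewrite coefM_top ?se // Wde.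
have -> : pp`_d * pm`_e * (pp`_d * qm`_e + qp`_d * pm`_e) =
   pp`_d ^+ 2 * (pm`_e * qm`_e) + (pp`_d * qp`_d) * pm`_e ^+ 2 by ring.
by rewrite addr_ge0 // mulr_ge0 ?sqr_ge0 // ltW.
Qed.

Lemma all_mirror_lt a l : all (fun m => pos m < a) l ->
  all (fun m => - a < pos m) (rev (map mirror l)).
Proof.
by rewrite all_rev all_map; apply: sub_all => m /=; rewrite /mirror /pos /= ltrN2.
Qed.

Lemma sorted_mirror l : sorted ltpos l -> sorted ltpos (rev (map mirror l)).
Proof.
rewrite rev_sorted sorted_map; apply: sub_sorted => m m' mm'.
by change (- pos m' < - pos m); rewrite ltrN2.
Qed.

Lemma mirrorK : involutive (@mirror R).
Proof. by case=> [[? ?] ?]; rewrite /mirror /pos /= opprK. Qed.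

Lemma sorted_split a l : sorted ltpos l ->
  l = [seq m <- l | pos m < a] ++ [seq m <- l | a <= pos m].
Proof.
elim: l => //= m l IH; rewrite path_sortedE => [/andP[ml sl]|]; last exact: ltpos_trans.
have [ma|am] := ltP (pos m) a; first by rewrite /= -IH.
have -> : [seq k <- l | pos k < a] = [::].
  rewrite -(filter_pred0 l); apply: eq_in_filter => k /(allP ml) mk.
  by apply/negbTE; rewrite -leNgt (le_trans am) // ltW.
congr (_ :: _); apply/esym/all_filterP; apply: sub_all ml => k mk.
by rewrite (le_trans am) // ltW.
Qed.

Lemma phi_at_cat a l r : sorted ltpos r -> all (fun m => pos m < a) l ->
  all (fun m => a <= pos m) r -> phi_at (l ++ r) a = pval a (chain r).
Proof.
move=> sr la ar; rewrite /phi_at filter_cat.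
have -> : [seq m <- l | a < pos m] = [::].
  rewrite -(filter_pred0 l); apply: eq_in_filter => k /(allP la) ka.
  by apply/negbTE; rewrite -leNgt ltW.
rewrite /= -[LHS]/(phi_at r a) -pval_filter_ge //.
by have /all_filterP -> := ar.
Qed.

Definition norming l t := \sum_(m <- l) (impedance m)^`().[t] * (phi_at l (pos m)).[t] ^+ 2.

(** Positivity is the energy inequality near -oo, where the second coefficient
    vanishes; the identity is the Lagrange identity, reduced to one term for the
    same reason. *)
Lemma eigenvalue_norming l t : sorted ltpos l -> all admissible l ->
  (chain l).2.[t] = 0 ->
  0 < t * norming l t /\ (chain l).2^`().[t] * (chain l).1.[t] = - norming l t.
Proof.
move=> sl al B0; split.
  have [lo [_ [hlo _]]] := masses_bounds l.
  have lol : all (fun m => lo <= pos m) l by apply: sub_all hlo => m; apply: ltW.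
  have := @chain_energy R lo l t sl lol.
  rewrite B0 expr0n mulr0 sub0r => e0.
  have : 0 < \sum_(m <- l) (impedance m).[t] * (phi_at l (pos m)).[t] ^+ 2.
    have : 0 <= expR lo * (chain l).1.[t] ^+ 2 by rewrite mulr_ge0 ?expR_ge0 ?sqr_ge0.
    by lra.
  move=> /lt_le_trans; apply; rewrite /norming mulr_sumr.
  rewrite big_seq [leRHS]big_seq; apply: ler_sum => m ml.
  have /andP[v0 _] := allP al m ml.
  have -> : t * ((impedance m)^`().[t] * (phi_at l (pos m)).[t] ^+ 2) =
     (impedance m).[t] * (phi_at l (pos m)).[t] ^+ 2 + m.2 * (t * (phi_at l (pos m)).[t]) ^+ 2.
    rewrite /impedance expr2 !(derivD, derivM, derivC, derivX, mul0r, add0r, mulr1, mul1r).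
    by rewrite !(hornerD, hornerM, hornerC, hornerX); ring.
  by rewrite lerDl mulr_ge0 ?sqr_ge0.
have := congr1 (fun P : {poly R} => P.[t]) (wronsk_chain sl).
rewrite /wronsk hornerD hornerN !hornerM B0 mulr0 subr0 hornerN horner_sum => ->.
by congr (- _); apply: eq_bigr => m _; rewrite hornerM horner_exp.
Qed.

Lemma eigenvalue_factor a l r t : (chain (l ++ r)).2.[t] = 0 ->
  (pval a (chain r)).[t] = (chain (l ++ r)).1.[t] * (pval (- a) (lchain l)).[t].
Proof.
have [w ->] := pval_chain_cat a l r => B0.
by rewrite hornerD !hornerM B0 mul0r addr0.
Qed.

Lemma ceval_Wpoly (N : nat) (lam : 'I_N -> R) (z : R[i]) : (forall i, lam i != 0) ->
  ceval z (Wpoly lam predT) = 0 <-> exists i, z = (lam i)%:C.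
Proof.
move=> l0; have prodE : ceval z (Wpoly lam predT) = \prod_i ceval z (zero_factor (lam i)).
  by rewrite /ceval /Wpoly rmorph_prod horner_prod.
have facE i : ceval z (zero_factor (lam i)) = 1 - z / (lam i)%:C.
  by rewrite /zero_factor cevalB cevalM ceval1 cevalC cevalX mulrC fmorphV.
have li i : (lam i)%:C != 0 :> R[i] by rewrite fmorph_eq0.
rewrite prodE; split=> [/eqP/prodf_eq0[i _]|[i zi]].
  rewrite facE subr_eq0 => /eqP e; exists i.
  by rewrite -[RHS]mul1r e divfK.
by apply/eqP/prodf_eq0; exists i => //; rewrite facE zi divff // subrr.
Qed.

(** P = Ppoly because both have at most the degree of W and agree at 0 and at all
    the lam_i. *)
Lemma spectral_data_necessary (p : discrete_pair R) (a : R) (N : nat) (lam alpha : 'I_N -> R) :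
  is_interior_spectral_data p a lam alpha ->
  [/\ forall j : 'I_N, alpha j = 0 -> G lam alpha (lam j) = 0,
      forall i j k : 'I_N, j = i.+1 :> nat -> k = j.+1 :> nat ->
        alpha j = 0 -> alpha i * alpha k < 0
    & in_T lam alpha].
Proof.
move=> [mono eig nrm].
have sl := masses_sorted p; have al := masses_admissible p.
set L := masses p in sl al *.
pose l := [seq m <- L | pos m < a]; pose r := [seq m <- L | a <= pos m].
have eL : L = l ++ r := sorted_split a sl.
have la : all (fun m => pos m < a) l by apply: filter_all.
have ar : all (fun m => a <= pos m) r by apply: filter_all.
have sr : sorted ltpos r by apply: sorted_filter sl; apply: ltpos_trans.
have sll : sorted ltpos l by apply: sorted_filter sl; apply: ltpos_trans.
have adl : all admissible l by apply/allP => m; rewrite mem_filter => /andP[_ /(allP al)].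
have adr : all admissible r by apply/allP => m; rewrite mem_filter => /andP[_ /(allP al)].
pose pp := pval a (chain r); pose pm := pval (- a) (lchain l).
pose W := (chain L).2; pose A := (chain L).1.
have phia : phi_at L a = pp by rewrite eL phi_at_cat.
have [_ W00] := chain0 L.
have Wlam i : W.[lam i] = 0.
  have /eigenvalueP : is_eigenvalue p (lam i)%:C by apply/eig; exists i.
  by rewrite ceval_real => /eqP; rewrite fmorph_eq0 => /eqP.
have lam0 i : lam i != 0.
  by apply/eqP => e; have := Wlam i; rewrite e W00 => /eqP; rewrite oner_eq0.
have nor i := eigenvalue_norming sl al (Wlam i).
have fact i : pp.[lam i] = A.[lam i] * pm.[lam i].
  by rewrite /A eL; apply: eigenvalue_factor; rewrite -eL Wlam.
have WA0 i : W^`().[lam i] * A.[lam i] != 0.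
  have [n1 ->] := nor i; rewrite oppr_eq0.
  by apply: contraTneq n1 => ->; rewrite mulr0 ltxx.
have W'0 i : W^`().[lam i] != 0 by have := WA0 i; rewrite mulf_eq0 negb_or => /andP[].
have A0 i : A.[lam i] != 0 by have := WA0 i; rewrite mulf_eq0 negb_or => /andP[].
have rootW x : root W x -> exists i, x = lam i.
  move=> /rootP Wx; have /eigenvalueP/eig[i /complexI ->] : ceval x%:C W = 0.
    by rewrite ceval_real Wx.
  by exists i.
have Wn0 : W != 0.
  apply/eqP => e; have := W00; rewrite -/W e horner0 => /esym/eqP.
  by rewrite oner_eq0.
have [s hs] : exists s, root_seq W s.
  apply: simple_real_roots => // [z /rootP Wz|x /rootW[i ->] //].
  by have /eigenvalueP/eig[i ->] : ceval z W = 0 by [].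
have eW : W = Wpoly lam predT.
  have hW := root_seq_Wpoly mono lam0 predT.
  rewrite (root_seq_zero_factor hs W00) (root_seq_zero_factor hW (Wpoly0 _ _)); apply: perm_big.
  apply: uniq_perm; [by case: hs | by case: hW |] => x.
  rewrite (mem_root_seq _ hW) (mem_root_seq _ hs).
  apply/idP/(root_Wpoly lam0) => [/rootW[i ->]|[i _ ->]]; first by exists i.
  by rewrite rootE Wlam.
have alphaE i : alpha i = pp.[lam i] / Num.sqrt (lam i * norming L (lam i)).
  have [f hf] := nrm i; rewrite (gamma_sq_phi_plus hf) (is_phi_plus_unique hf).
  rewrite /phi_plus ceval_real -/L phia -fmorphV -rmorphM /= => /complexI ->.
  by [].
have sq i : 0 < Num.sqrt (lam i * norming L (lam i)) by rewrite sqrtr_gt0; case: (nor i).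
have [tq sp tp] := chain_top_le sr adr ar.
have adl' : all admissible (rev (map mirror l)) by rewrite all_rev all_map.
have [pm0 sm tm] := chain_top (sorted_mirror sll) adl' (all_mirror_lt la).
have eWat : W = pp * pder (- a) (lchain l) + pder a (chain r) * pm.
  by rewrite /W eL (chain_cat2_at a).
have [szP topP] := characteristic_top tq sp tp pm0 sm tm.
rewrite -/pp -/(lchain l) -/pm -eWat in szP topP.
have szW : size W = N.+1 by rewrite eW size_Wpoly // cardT size_enum_ord.
have WlamE i : W^`().[lam i] =
    - (lam i)^-1 * (Wpoly lam (fun j => predT j && (j != i))).[lam i].
  by rewrite eW horner_deriv_Wpoly.
have ppm : pp * pm = Ppoly lam alpha predT.
  apply/eqP; rewrite -subr_eq0; apply/eqP.
  apply: (@roots_geq_poly_eq0 _ _ (0 :: [seq lam i | i <- enum 'I_N])).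
  - rewrite /= all_map rootE hornerD hornerN hornerM !pval_chain0 Ppoly0 // mulNr opprK.
    rewrite mulrC expR_half_mulV subrr eqxx /=; apply/allP => i _ /=.
    rewrite rootE hornerD hornerN hornerM subr_eq0 horner_Ppoly_lam //.
    apply/eqP/(mulfI (A0 i)); rewrite mulrA mulrAC -fact -expr2.
    have [n1 n2] := nor i; rewrite -/W -/A WlamE in n2.
    have e2 : (alpha i * Num.sqrt (lam i * norming L (lam i))) ^+ 2 = pp.[lam i] ^+ 2.
      by rewrite (alphaE i) divfK // gt_eqF.
    rewrite -e2 exprMn sqr_sqrtr; last exact: ltW.
    rewrite [A.[_] * _]mulrCA; congr (_ * _).
    rewrite -[norming _ _]opprK -n2; field; exact: lam0.
  - rewrite /= map_inj_uniq ?enum_uniq ?andbT; last exact: lam_inj.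
    by apply/mapP => -[i _ e]; have := lam0 i; rewrite -e eqxx.
  - rewrite /= size_map size_enum_ord -szW (leq_trans (size_polyD _ _)) //.
    by rewrite geq_max szP size_polyN eW Ppoly_size.
have s1 : \sum_i alpha i ^+ 2 <= 1.
  move: topP; rewrite ppm eW Ppoly_top // -eW -mulrA -expr2 pmulr_lge0 ?subr_ge0 //.
  by rewrite exprn_even_gt0 //= lead_coef_eq0.
apply: (factorization_necessary mono lam0 s1 ppm).
- by rewrite pval_chain0 expR_gt0.
- move=> i; exists (Num.sqrt (lam i * norming L (lam i)))^-1; first by rewrite invr_gt0.
  by rewrite mulrC -alphaE.
- move=> i; rewrite /root fact mulf_eq0 (negbTE (A0 i)).
  by [].
Qed.

(** The masses are those of the two half-line problems together with the mass at
    a, which is omitted when both of its weights vanish.  At lam_i the numbers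
    alpha_i sqrt(lam_i gamma^2) and p_+ have equal squares and the same sign. *)
Lemma spectral_data_sufficient (a : R) (N : nat) (lam alpha : 'I_N -> R) : (0 < N)%N ->
  (forall j : 'I_N, alpha j = 0 -> G lam alpha (lam j) = 0) ->
  (forall i j k : 'I_N, j = i.+1 :> nat -> k = j.+1 :> nat ->
        alpha j = 0 -> alpha i * alpha k < 0) ->
  in_T lam alpha -> exists p, is_interior_spectral_data p a lam alpha.
Proof.
move=> N0 hG hs hT; have lam0 := in_T_lam_neq0 hT; have [mono s1 _] := hT.
have ee' : expR (- (a / 2)) * expR (a / 2) = 1 :> R by rewrite mulrC expR_half_mulV.
have [om [v [pp [pm [qp [qm [[ppm v0 eW sgn] [np sp p0 q0] [nm sm m0 k0]]]]]]]] :=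
  factorization_exists hT hG hs (expR_gt0 _) ee'.
have [r' [sr' ar' br' vr' dr']] := halfline_inverse np sp p0 q0.
have e'E : expR (a / 2) = expR (- (- a / 2)) :> R by rewrite mulNr opprK.
rewrite e'E in m0 k0.
have [l' [sl' al' bl' vl' dl']] := halfline_inverse nm sm m0 k0.
pose l := rev (map mirror l').
have el : lchain l = chain l'.
  by rewrite /lchain /l map_rev revK -map_comp map_id_in // => m _; apply: mirrorK.
have [r [sr ar br [vr dr]]] : exists r, [/\ sorted ltpos r, all admissible r,
    all (fun m => a <= pos m) r & pval a (chain r) = pp /\
    pder a (chain r) = qp - (om%:P * 'X + v%:P * 'X^2) * pp].
  have br'' : all (fun m => a <= pos m) r' by apply: sub_all br' => m; apply: ltW.
  (* A mass at a is allowed only if one of its weights is nonzero. *)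
  have [c0|c0] := boolP ((om == 0) && (v == 0)).
    exists r'; split=> //; split=> //; case/andP: c0 => /eqP -> /eqP ->.
    by rewrite !mul0r addr0 mul0r subr0.
  exists ((a, om, v) :: r'); split.
  - rewrite /= path_sortedE; last exact: ltpos_trans.
    by rewrite sr' andbT; apply: sub_all br' => m.
  - rewrite /= ar' andbT /admissible /= v0 /= lt_neqAle addr_ge0 // andbT eq_sym.
    by rewrite paddr_eq0 // normr_eq0.
  - by rewrite /= br'' andbT /pos.
  - split; first by rewrite -[a]/(pos (a, om, v)) /= pval_kick vr'.
    by rewrite -{1}[a]/(pos (a, om, v)) /= pder_kick -[pos _]/a vr' dr'.
have sl : sorted ltpos l by apply: sorted_mirror.
have bl : all (fun m => pos m < a) l.
  by rewrite all_rev all_map; apply: sub_all bl' => m; rewrite /= [pos (mirror m)]/pos /= ltrNl.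
have adl : all admissible l by rewrite all_rev all_map.
have sL : sorted ltpos (l ++ r).
  rewrite (sorted_pairwise (@ltpos_trans R)) pairwise_cat.
  rewrite -!(sorted_pairwise (@ltpos_trans R)) sl sr !andbT.
  apply/allrelP => m m' ml mr; exact: lt_le_trans (allP bl m ml) (allP br m' mr).
have adL : all admissible (l ++ r) by rewrite all_cat adl.
have eWL : (chain (l ++ r)).2 = Wpoly lam predT.
  by rewrite (chain_cat2_at a) el vl' dl' vr dr eW; ring.
have L0 : (0 < size (l ++ r))%N.
  rewrite lt0n; apply/eqP => /size0nil eL; have := size_Wpoly lam0 predT.
  by rewrite -eWL eL /= size_poly1 cardT size_enum_ord => -[e]; rewrite -e in N0.
have [p ep] := masses_surj sL adL L0; exists p; split.
- exact: mono.
- by move=> z; rewrite eigenvalueP ep eWL; apply: ceval_Wpoly.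
move=> i; exists (phi_plus (masses p) (lam i)%:C); first exact: is_phi_plus_exists.
rewrite (gamma_sq_phi_plus (is_phi_plus_exists p _)) ep -/(norming (l ++ r) (lam i)).
rewrite /phi_plus ceval_real phi_at_cat // vr -fmorphV -rmorphM /=; congr (_%:C).
have Wi : (chain (l ++ r)).2.[lam i] = 0 by rewrite eWL; apply/rootP/root_Wpoly => //; exists i.
have [n1 n2] := eigenvalue_norming sL adL Wi.
have fi := eigenvalue_factor a Wi; rewrite vr el vl' in fi.
rewrite eWL horner_deriv_Wpoly // in n2.
set g := norming _ _ in n1 n2 *; set A := (chain (l ++ r)).1.[lam i] in n2 fi.
set w := (Wpoly _ _).[_] in n2.
have wA : w * A = lam i * g by rewrite -[g]opprK -n2; field; apply: lam0.
have ppi : pp.[lam i] * pm.[lam i] = alpha i ^+ 2 * w.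
  by rewrite -hornerM ppm horner_Ppoly_lam.
have sq : 0 < Num.sqrt (lam i * g) by rewrite sqrtr_gt0.
have e2 : (alpha i * Num.sqrt (lam i * g)) ^+ 2 = pp.[lam i] ^+ 2.
  rewrite exprMn sqr_sqrtr ?ltW // -wA mulrA -ppi.
  by rewrite -mulrA [pm.[_] * A]mulrC -fi.
have [ai|ai] := eqVneq (alpha i) 0.
  move: e2; rewrite ai mul0r expr0n => /esym/eqP; rewrite expf_eq0 /= => /eqP ->.
  by rewrite mul0r.
move/eqP: e2; rewrite eqf_sqr => /orP[/eqP <-|/eqP e2]; first by rewrite mulfK // gt_eqF.
have := sgn i ai; rewrite -[pp.[_]]opprK -e2.
have -> : - (alpha i * Num.sqrt (lam i * g)) * alpha i = - (alpha i ^+ 2 * Num.sqrt (lam i * g)).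
  by ring.
by rewrite oppr_gt0 ltNge mulr_ge0 ?sqr_ge0 // ltW.
Qed.

End Assembly.

Theorem theorem4p8 (R : realType) (a : R) (N : nat) (hN : (1 <= N)%N)
    (lam alpha : 'I_N -> R) :
  (exists p : discrete_pair R, is_interior_spectral_data p a lam alpha) <->
  [/\ forall j : 'I_N, alpha j = 0 -> G lam alpha (lam j) = 0,
      forall i j k : 'I_N, j = i.+1 :> nat -> k = j.+1 :> nat ->
        alpha j = 0 -> alpha i * alpha k < 0
    & in_T lam alpha].
Proof.
split=> [[p]|[hG hs hT]]; first exact: spectral_data_necessary.
exact: spectral_data_sufficient.
Qed.
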